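(* The generating functions $X(q,u,v)$, $Y(q,u,v)$, $Z(q,u,v)$ of the classes $\mathcal{X},\mathcal{Y},\mathcal{Z}$ of 4-sided prudent polygons ending at $(-1,0)$ in a counter-clockwise direction (defined in the context) satisfy the functional equations $$X(q,u,v)=\frac{qv}{1-q}[X(q,u,v)-X(q,qu,v)]+\frac{qv}{1-q}[Y(q,v,u)-Y(q,v,qu)]+\frac{quv}{1-q}[Z(q,u,v)-qZ(q,qu,v)],$$ $$Y(q,u,v)=quv+\frac{qv}{1-q}[Y(q,u,v)-Y(q,qu,v)]+\frac{qv^2}{1-q}[Z(q,v,u)-Z(q,v,qu)]+quv[X(q,qv,u)+Y(q,u,qv)+qvZ(q,qv,u)],$$ $$Z(q,u,v)=\frac{qv}{1-q}[Z(q,u,v)-Z(q,qu,v)]+qvY(q,qv,u)+quvZ(q,u,qv).$$ The area generating function of 4-sided prudent polygons is then given by $$PA^{(4)}(q)=8[X(q,1,1)+Y(q,1,1)+Z(q,1,1)]$$ $$=8q+16q^2+40q^3+96q^4+232q^5+560q^6+1336q^7+3176q^8+7480q^9+17528q^{10}+\cdots.$$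
   Context: All walks are on the square lattice $\mathbb{Z}^2$, start at $(0,0)$ and take unit steps north, south, east, west. A walk is prudent if it is self-avoiding and never takes a step towards an already occupied site: if a step goes from $p$ to $p+d$ (with $d$ a unit direction vector), then none of the points $p+kd$, $k\ge1$, has been visited before that step. ''4-sided'' means unrestricted: every prudent walk is 4-sided. A prudent polygon is a prudent walk, with more than one step, that ends at a lattice site adjacent to its starting point $(0,0)$; the polygon is the closed curve obtained by adding the edge joining the endpoint to $(0,0)$. Polygons are counted as walks, i.e. they are rooted at $(0,0)$ and oriented. The area is the number of unit cells enclosed, and $PA^{(4)}(q)=\sum_{n\ge1}PA^{(4)}_nq^n$ with $PA^{(4)}_n$ the number of 4-sided prudent polygons of area $n$. Width and height of a polygon are those of its bounding box (number of columns and of rows of cells). Consider the prudent polygons whose walk ends at $(-1,0)$ and which are traversed counter-clockwise. They are split into three classes, with trivariate generating functions (formal power series): $X(q,u,v)=\sum_{n,i,j\ge1}x_{n,i,j}q^nu^iv^j$ is the generating function of the class $\mathcal{X}$ of those polygons for which removing the top row (of cells) does not change the width or leave two or more disconnected pieces; $q$ measures area, $u$ width and $v$ height. $Y(q,u,v)=\sum_{n,i,j\ge1}y_{n,i,j}q^nu^iv^j$ is the generating function of the class $\mathcal{Y}$ consisting of the unit square plus those polygons not in $\mathcal{X}$ for which removing the rightmost column does not change the height or leave two or more disconnected pieces; $q$ measures area, $u$ height and $v$ width. $Z(q,u,v)=\sum_{n,i,j\ge1}z_{n,i,j}q^nu^iv^j$ is the generating function of the class $\mathcal{Z}$ of those polygons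 not in $\mathcal{X}$ or $\mathcal{Y}$; $q$ measures area, $u$ measures width minus $1$, and $v$ measures height. *)

(* Defs.v *)
From HB Require Import structures.
From mathcomp Require Import all_boot all_order all_algebra.
From mathcomp Require Import finmap.
From mathcomp Require Import mathcomp_extra boolp classical_sets functions.
From mathcomp Require Import cardinality fsbigop.

Set Implicit Arguments.
Unset Strict Implicit.
Unset Printing Implicit Defensive.

Import Order.TTheory GRing.Theory Num.Theory.
Local Open Scope ring_scope.
Local Open Scope classical_set_scope.

Record fps (R : Type) := Fps { coef : nat -> R }.
Coercion coef : fps >-> Funclass.

HB.instance Definition _ (R : Type) := gen_eqMixin (fps R).
HB.instance Definition _ (R : Type) := gen_choiceMixin (fps R).

Lemma fpsP (R : Type) (f g : fps R) : (forall n, f n = g n) -> f = g.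
Proof. by case: f g => [f] [g] /= fg; congr Fps; apply/funext. Qed.

Section FpsRing.
Variable R : comNzRingType.
Implicit Types f g h : fps R.

Definition fps_add f g := Fps (fun n => f n + g n).
Definition fps_opp f := Fps (fun n => - f n).
Definition fps_mul f g := Fps (fun n => \sum_(k < n.+1) f k * g (n - k)%N).
Definition fpsC (c : R) := Fps (fun n => if n is 0%N then c else 0).
Definition fpsX := Fps (fun n => (n == 1%N)%:R : R).

Fact fps_addA : associative fps_add.
Proof. by move=> f g h; apply: fpsP => n /=; rewrite addrA. Qed.
Fact fps_addC : commutative fps_add.
Proof. by move=> f g; apply: fpsP => n /=; rewrite addrC. Qed.
Fact fps_add0 : left_id (fpsC 0) fps_add.
Proof. by move=> f; apply: fpsP => -[|n] /=; rewrite add0r. Qed.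
Fact fps_addN : left_inverse (fpsC 0) fps_opp fps_add.
Proof. by move=> f; apply: fpsP => -[|n] /=; rewrite addNr. Qed.

HB.instance Definition _ := GRing.isZmodule.Build (fps R)
  fps_addA fps_addC fps_add0 fps_addN.

Lemma fps_mulE f g n : fps_mul f g n = \sum_(k < n.+1) f k * g (n - k)%N.
Proof. by []. Qed.

Lemma fps_mulEr f g n : fps_mul f g n = \sum_(k < n.+1) f (n - k)%N * g k.
Proof.
rewrite fps_mulE (reindex_inj rev_ord_inj) /=.
by apply: eq_bigr => k _; rewrite subSS sub_ordK.
Qed.

Fact fps_mulC : commutative fps_mul.
Proof.
move=> f g; apply: fpsP => n; rewrite fps_mulE fps_mulEr.
by apply: eq_bigr => k _; rewrite mulrC.
Qed.

Fact fps_mulA : associative fps_mul.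
Proof.
move=> f g h; apply: fpsP => i; rewrite fps_mulE fps_mulEr.
pose coef3 j k := f j * (g (i - j - k)%N * h k).
transitivity (\sum_(j < i.+1) \sum_(k < i.+1 | (k <= i - j)%N) coef3 j k).
  apply: eq_bigr => j _; rewrite fps_mulEr big_distrr /=.
  by rewrite (big_ord_narrow_leq (leq_subr _ _)).
rewrite (exchange_big_dep predT) //; apply: eq_bigr => k _.
transitivity (\sum_(j < i.+1 | (j <= i - k)%N) coef3 j k).
  apply: eq_bigl => j; rewrite -ltnS -(ltnS j) -!subSn ?leq_ord //.
  by rewrite -subn_gt0 -(subn_gt0 j) -!subnDA addnC.
rewrite (big_ord_narrow_leq (leq_subr _ _)) fps_mulE big_distrl /=.
by apply: eq_bigr => j _; rewrite /coef3 -!subnDA addnC mulrA.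
Qed.

Fact fps_mul1 : left_id (fpsC 1) fps_mul.
Proof.
move=> f; apply: fpsP => n /=; rewrite big_ord_recl /= mul1r subn0.
by rewrite big1 ?addr0 // => k _; rewrite mul0r.
Qed.

Fact fps_mulDl : left_distributive fps_mul fps_add.
Proof.
move=> f g h; apply: fpsP => n /=; rewrite -big_split /=.
by apply: eq_bigr => k _; rewrite mulrDl.
Qed.

Fact fps_1neq0 : fpsC 1 != 0.
Proof. by apply/eqP => /(congr1 (@coef R ^~ 0%N))/eqP; rewrite /= oner_eq0. Qed.

HB.instance Definition _ := GRing.Zmodule_isComNzRing.Build (fps R)
  fps_mulA fps_mulC fps_mul1 fps_mulDl fps_1neq0.

Definition fps_unit : pred (fps R) := fun f => `[< exists g, g * f = 1 >].
Definition fps_inv f :=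
  if pselect (exists g, g * f = 1) is left e then sval (cid e) else f.

Fact fps_mulVf : {in fps_unit, left_inverse 1 fps_inv *%R}.
Proof.
move=> f /asboolP fU; rewrite /fps_inv; case: pselect => // e.
by case: cid.
Qed.
Fact fps_unitP f g : g * f = 1 -> fps_unit f.
Proof. by move=> gf1; apply/asboolP; exists g. Qed.
Fact fps_inv_out : {in [predC fps_unit], fps_inv =1 id}.
Proof.
move=> f; rewrite inE => /asboolP fNU; rewrite /fps_inv.
by case: pselect.
Qed.

HB.instance Definition _ := GRing.ComNzRing_hasMulInverse.Build (fps R)
  fps_mulVf fps_unitP fps_inv_out.

Lemma unit_1subX : 1 - fpsX \is a GRing.unit.
Proof.
apply: (@fps_unitP _ (Fps (fun=> 1))); rewrite mulrC; apply: fpsP => n /=.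
rewrite big_ord_recl /= mulr1 subr0; case: n => [|n]; first by rewrite big_ord0 addr0.
rewrite big_ord_recl big1 ?addr0 /= => [|k _]; last by rewrite subr0 mulr1.
by rewrite mulr1 add0r subrr.
Qed.

End FpsRing.

(* Trivariate series over the integers; [F n i j] is the coefficient of
   q^n u^i v^j. *)
Notation fps3 := (fps (fps (fps int))).

Definition q : fps3 := fpsX _.
Definition u : fps3 := fpsC (fpsX _).
Definition v : fps3 := fpsC (fpsC (fpsX _)).

Lemma unit_1subq : 1 - q \is a GRing.unit.
Proof. exact: unit_1subX. Qed.

(* F(q,a,b), for a and b without constant term: then q^n a^i b^j only has terms
   of total degree at least n + i + j, so that the sum over all n, i, j can be
   truncated when extracting a coefficient. *)
Definition subst (F : fps3) (a b : fps3) : fps3 :=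
  Fps (fun N => Fps (fun I => Fps (fun J =>
    let D := (N + I + J).+1 in
    \sum_(n < D) \sum_(i < D) \sum_(j < D)
       F n i j * (q ^+ n * a ^+ i * b ^+ j) N I J))).

Notation "F '@[' a , b ]" := (subst F a b)
  (at level 2, left associativity, format "F @[ a ,  b ]") : ring_scope.

(* F(q,1,1), when each F n has finite support. *)
Definition at11 (F : fps3) : fps int :=
  Fps (fun n => \sum_(ij \in [set: nat * nat]) F n ij.1 ij.2).

Definition site := (int * int)%type.

Definition adjacent (p p' : site) : bool :=
  p' - p \in [:: (1, 0); (0, 1); (-1, 0); (0, -1)].

(* The walk visiting the origin, then successively the elements of [w]. *)
Definition walk := seq site.
Definition sites (w : walk) : seq site := (0, 0) :: w.
Definition endpoint (w : walk) : site := last (0, 0) w.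

Definition is_walk (w : walk) : bool := path adjacent (0, 0) w.

Definition prudent (w : walk) : Prop :=
  [/\ is_walk w, uniq (sites w) &
    forall m, (m < size w)%N ->
      let p := nth 0 (sites w) m in
      let d := nth 0 (sites w) m.+1 - p in
      forall k, (1 <= k)%N -> p + d *+ k \notin take m.+1 (sites w)].

Definition prudent_polygon (w : walk) : Prop :=
  [/\ prudent w, (1 < size w)%N & adjacent (endpoint w) (0, 0)].

(* The site [c] also stands for the unit cell with lower left corner [c]. *)
Definition left_cell (p p' : site) : site :=
  if p' - p == (1, 0) then p
  else if p' - p == (0, 1) then p - (1, 0)
  else if p' - p == (-1, 0) then p - (1, 1)
  else p - (0, 1).
Definition right_cell (p p' : site) : site := left_cell p' p.

(* [next (sites w)] is cyclic, hence also accounts for the closing edge. *)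
Definition edge_cells (w : walk) (p : site) : site * site :=
  let p' := next (sites w) p in (left_cell p p', right_cell p p').

Definition separated (w : walk) (c c' : site) : bool :=
  has (fun p => edge_cells w p \in [:: (c, c'); (c', c)]) (sites w).

Definition communicating (w : walk) (c c' : site) : bool :=
  adjacent c c' && ~~ separated w c c'.

Definition component (w : walk) (c : site) : set site :=
  [set c' | exists2 s, path (communicating w) c s & last c s = c'].

Definition enclosed (w : walk) : set site :=
  [set c | finite_set (component w c)].

(* The number of elements of a finite set; 0 for an infinite one. *)
Definition card {T : choiceType} (A : set T) : nat := #|` fset_set A|.

Definition area (w : walk) : nat := card (enclosed w).

Definition counterclockwise (w : walk) : Prop :=
  forall p, p \in sites w -> enclosed w (left_cell p (next (sites w) p)).

Definition columns (A : set site) : set int :=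
  [set x | exists a b, [/\ A a, A b & a.1 <= x <= b.1]].
Definition rows (A : set site) : set int :=
  [set y | exists a b, [/\ A a, A b & a.2 <= y <= b.2]].

Definition width (A : set site) : nat := card (columns A).
Definition height (A : set site) : nat := card (rows A).

Definition top_row (A : set site) : set site :=
  [set c | A c /\ forall c', A c' -> c'.2 <= c.2].
Definition right_column (A : set site) : set site :=
  [set c | A c /\ forall c', A c' -> c'.1 <= c.1].

(* At most one piece: the empty set is connected. *)
Definition connected (A : set site) : Prop :=
  forall c c', A c -> A c' ->
    exists s, [/\ path adjacent c s, last c s = c' & forall d, d \in s -> A d].

Definition base_class (w : walk) : Prop :=
  [/\ prudent_polygon w, endpoint w = (-1, 0) & counterclockwise w].

Definition unit_square : walk := [:: (0, 1); (-1, 1); (-1, 0)].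

Definition classX (w : walk) : Prop :=
  base_class w /\
  let A := enclosed w in
  let B := A `\` top_row A in
  width B = width A /\ connected B.

Definition classY (w : walk) : Prop :=
  w = unit_square \/
  [/\ base_class w, ~ classX w &
    let A := enclosed w in
    let B := A `\` right_column A in
    height B = height A /\ connected B].

Definition classZ (w : walk) : Prop :=
  [/\ base_class w, ~ classX w & ~ classY w].

Definition gf3 (K : nat -> nat -> nat -> set walk) : fps3 :=
  Fps (fun n => Fps (fun i => Fps (fun j => (card (K n i j))%:Z))).

Definition X : fps3 := gf3 (fun n i j => [set w | [/\ classX w,
  area w = n, width (enclosed w) = i & height (enclosed w) = j]]).

Definition Y : fps3 := gf3 (fun n i j => [set w | [/\ classY w,
  area w = n, height (enclosed w) = i & width (enclosed w) = j]]).

Definition Z : fps3 := gf3 (fun n i j => [set w | [/\ classZ w,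
  area w = n, width (enclosed w) = i.+1 & height (enclosed w) = j]]).

Definition polygons_of_area (n : nat) : set walk :=
  [set w | prudent_polygon w /\ area w = n].

Definition PA4 : fps int := Fps (fun n => (card (polygons_of_area n))%:Z).

(* Main.v *)
(* A prudent polygon that ends at (-1, 0) and turns counter-clockwise is a
   prudent walk in the half plane x >= 0 that ends on top of its bounding box,
   followed by a run west to x = -1 and a run south to the endpoint. The
   endpoint of a prudent walk is always on a side of the bounding box, so such a
   walk slides along the sides and turns at corners, and is determined by its
   inflating steps. It therefore amounts to a polygon built from the unit square
   by adding, one at a time, a top row of at most width + 1 cells starting at the
   left, a right column of at most height + 1 cells starting at the top, or a
   bottom row of fewer than width cells ending at the right; the second operation
   requires that the walk can still slide to the right side of the box, and the
   third one that it can slide on to the bottom side.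
   The class X, Y or Z of a polygon is read off its last operation, and summing
   over that operation gives the functional equations.

   That the cells added in this way are the enclosed ones is proved with signed
   crossing numbers of the boundary, whose increment under each operation
   telescopes to that of the boundary of the added cells, and with explicit escape
   paths for the other cells. The factor 8 comes from the symmetries of the square. *)

Require Import Defs.
From HB Require Import structures.
From mathcomp Require Import all_boot all_order all_algebra.
From mathcomp Require Import finmap boolp classical_sets cardinality fsbigop.
From mathcomp Require Import zify.

Set Implicit Arguments.
Unset Strict Implicit.
Unset Printing Implicit Defensive.

Import Order.TTheory GRing.Theory Num.Theory.
Local Open Scope classical_set_scope.
Local Open Scope ring_scope.

(** [enclosed] is defined by finite components, so the cells of a code have to be recognised without
    a Jordan curve theorem: the boundary is the discrete gradient of their indicator, hence a step
    between adjacent cells changes the indicator exactly when it crosses the boundary. That the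
    class can be read off the last operation is not a local fact. A row one cell longer than the
    width has two effects: the walk gets past the corner to the right side, and what lies under that
    row can reach the last column only through the top row. Later right columns and bottom rows
    never repair this. So the condition that allows further operations is the very one that keeps
    the polygon out of X. A column one cell longer than the height does the same for the bottom side
    and Y. The equations are proved on coefficients. Once the quotients by 1 - q are replaced by
    finite geometric sums, each one is a recurrence for the number of codes of given kind, area,
    width and height. *)

Lemma siteE (p p' : site) : (p == p') = (p.1 == p'.1) && (p.2 == p'.2).
Proof. by case: p p' => a b [c d]. Qed.

Lemma siteP (p p' : site) : p.1 = p'.1 -> p.2 = p'.2 -> p = p'.
Proof. by case: p p' => a b [c d] /= -> ->. Qed.

Lemma site_mulrn (d : site) k : d *+ k = (d.1 * k%:Z, d.2 * k%:Z).
Proof.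
elim: k => [|k IH]; first by rewrite mulr0n !mulr0.
by rewrite mulrSr IH; apply: siteP => /=; lia.
Qed.

(** * Steps, rays and straight runs *)

Definition dist (p p' : site) : nat := (absz (p'.1 - p.1)%R + absz (p'.2 - p.2)%R)%N.

Lemma adjacentE p p' : adjacent p p' = (dist p p' == 1)%N.
Proof.
rewrite /adjacent /dist !inE !siteE /=.
by case: p p' => a b [c d] /=; lia.
Qed.

Lemma adjacentC p p' : adjacent p p' = adjacent p' p.
Proof. by rewrite !adjacentE /dist; lia. Qed.

(* The site [s] lies on the open ray from [p] through [p'], for an
   axis-parallel segment from [p] to [p']. *)
Definition ahead (p p' s : site) : bool :=
  [|| [&& p.1 < p'.1, p.1 < s.1 & s.2 == p.2],
      [&& p'.1 < p.1, s.1 < p.1 & s.2 == p.2],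
      [&& p.2 < p'.2, p.2 < s.2 & s.1 == p.1] |
      [&& p'.2 < p.2, s.2 < p.2 & s.1 == p.1]].

Lemma aheadP p p' s : adjacent p p' ->
  (exists2 k, (1 <= k)%N & s = p + (p' - p) *+ k) <-> ahead p p' s.
Proof.
case: p p' s => a b [c d] [x y]; rewrite adjacentE /dist /ahead /= => adj.
have adjs : [\/ c = a + 1 /\ d = b, c = a - 1 /\ d = b,
             c = a /\ d = b + 1 | c = a /\ d = b - 1].
  have [?|ne1] := eqVneq c (a + 1); first by constructor 1; lia.
  have [?|ne2] := eqVneq c (a - 1); first by constructor 2; lia.
  have [?|ne3] := eqVneq d (b + 1); first by constructor 3; lia.
  by constructor 4; lia.
split.
  case=> k k1; rewrite site_mulrn /= => -[-> ->] /=.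
  by case: adjs => -[-> ->]; nia.
move=> h; exists (absz (x - a) + absz (y - b))%N; first lia.
rewrite site_mulrn; apply: siteP => /=; case: adjs => -[? ?]; subst c d; nia.
Qed.

(** Turns prudence into a condition on each appended step, the form used by all inductions on walks.
    The ray condition also covers self-avoidance, since the new site is the first point of the
    ray. *)
Lemma prudent_rcons w p : prudent (rcons w p) <->
  [/\ prudent w, adjacent (endpoint w) p &
      forall s : site, s \in sites w -> ~~ ahead (endpoint w) p s].
Proof.
have lastE : nth 0 (sites w) (size w) = endpoint w by rewrite /sites nth_last.
have nthE m : (m <= size w)%N -> nth 0 (sites (rcons w p)) m = nth 0 (sites w) m.
  by move=> mw; rewrite /sites -rcons_cons nth_rcons /= ltnS mw.
have nthp : nth 0 (sites (rcons w p)) (size w).+1 = p.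
  by rewrite /sites -rcons_cons nth_rcons /= ltnn eqxx.
have takeE m : (m <= size w)%N ->
    take m.+1 (sites (rcons w p)) = take m.+1 (sites w).
  by move=> mw; rewrite /sites -rcons_cons -cats1 takel_cat //= ltnS.
split.
  case; rewrite /is_walk rcons_path => /andP[walkw adj] uq pr.
  have uw : uniq (sites w).
    by move: uq; rewrite /sites -rcons_cons rcons_uniq => /andP[].
  split=> //.
    split=> // m mw p0 d k k1; have := pr m; rewrite size_rcons ltnS (ltnW mw).
    by rewrite nthE ?(ltnW mw)// nthE// takeE ?(ltnW mw)//; apply.
  move=> s sw; apply/negP => /(aheadP _ adj)[k k1 sE].
  have := pr (size w); rewrite size_rcons ltnSn => /(_ isT).
  rewrite nthE// nthp takeE// lastE /= => /(_ k k1).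
  by rewrite -sE /sites /= take_size sw.
case=> -[walkw uw pr] adj free; split.
- by rewrite /is_walk rcons_path; apply/andP.
- rewrite /sites -rcons_cons rcons_uniq uw andbT.
  apply/negP => /free /negP; apply; apply/(aheadP _ adj); exists 1%N => //.
  by rewrite mulr1n addrC subrK.
move=> m; rewrite size_rcons ltnS leq_eqVlt => /orP[/eqP ->|mw].
  rewrite nthE// nthp takeE// lastE /= take_size => k k1.
  by apply/negP => /free /negP; apply; apply/(aheadP _ adj); exists k.
by rewrite nthE ?(ltnW mw)// nthE// takeE ?(ltnW mw)//; apply: pr.
Qed.

Lemma prudent_nil : prudent [::].
Proof. by split. Qed.

Lemma sites_rcons w p : sites (rcons w p) = rcons (sites w) p.
Proof. by []. Qed.

Lemma endpoint_rcons w p : endpoint (rcons w p) = p.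
Proof. exact: last_rcons. Qed.

Lemma prudent_catl w1 w2 : prudent (w1 ++ w2) -> prudent w1.
Proof.
elim/last_ind: w2 => [|w2 p IH]; first by rewrite cats0.
by rewrite -rcons_cat => /prudent_rcons[/IH].
Qed.

(* The lattice sites of an axis-parallel segment, without its first site. *)
Definition seg (p p' : site) : seq site :=
  [seq (p.1 + sgz (p'.1 - p.1) * i%:Z, p.2 + sgz (p'.2 - p.2) * i%:Z)
    | i <- iota 1 (dist p p')].

Definition aligned (p p' : site) : bool := (p.1 == p'.1) || (p.2 == p'.2).

Lemma segpp p : seg p p = [::].
Proof. by rewrite /seg /dist !subrr. Qed.

(** The last but one site of [seg p p']. Runs are taken apart from their far end, so that [seg_ind]
    can keep [p] fixed. *)
Definition before (p p' : site) : site :=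
  (p'.1 - sgz (p'.1 - p.1), p'.2 - sgz (p'.2 - p.2)).

Lemma aligned_before p p' : aligned p p' -> aligned p (before p p').
Proof.
rewrite /aligned /before /= => /orP[/eqP->|/eqP->].
  by rewrite subrr sgz0 subr0 eqxx.
by rewrite subrr sgz0 subr0 eqxx orbT.
Qed.

Lemma dist_before p p' : aligned p p' -> p != p' ->
  dist p p' = (dist p (before p p')).+1.
Proof.
rewrite /aligned siteE /dist /before /=.
case: p p' => a b [c d] /=.
by case: (sgzP (c - a)); case: (sgzP (d - b)) => /=; lia.
Qed.

Lemma seg_rcons p p' : aligned p p' -> p != p' ->
  seg p p' = rcons (seg p (before p p')) p'.
Proof.
move=> al ne; have dE := dist_before al ne.
rewrite /seg dE -[in LHS](addn1 (dist _ _)) (iotaD 1 _ 1) map_cat -cats1; congr (_ ++ _).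
  case dE' : (dist p (before p p')) => [//|n]; apply/eq_in_map => i _ /=.
  move: al ne dE' {dE}; rewrite /aligned siteE /dist /before /=.
  case: p p' => a b [c d] /=.
  by case: (sgzP (c - a)) => /=; case: (sgzP (d - b)) => /= *; congr pair;
     rewrite /= ?subr0; case: sgzP; lia.
congr [:: _]; rewrite add1n -dE.
apply: siteP; move: al ne {dE}; rewrite /aligned siteE /dist /=;
  case: p p' => a b [c d] /=; case: (sgzP (c - a)); case: (sgzP (d - b)); lia.
Qed.

Lemma seg_ind (P : site -> Prop) p p' : aligned p p' ->
  P p -> (forall p'', aligned p p'' -> p != p'' -> P (before p p'') -> P p'') ->
  P p'.
Proof.
move=> + P0 IH; have [n] := ubnP (dist p p').
elim: n p' => // n IHn p' lt al; have [<-//|ne] := eqVneq p p'.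
apply: IH => //; apply: IHn; last exact: aligned_before.
by move: lt; rewrite (dist_before al ne).
Qed.

Lemma last_seg p p' : aligned p p' -> last p (seg p p') = p'.
Proof.
move=> al; apply: (seg_ind (P := fun x => last p (seg p x) = x) al).
  by rewrite segpp.
by move=> p'' al' ne _; rewrite seg_rcons// last_rcons.
Qed.

Definition between (a b x : int) : bool := (a <= x <= b) || (b <= x <= a).

Lemma mem_seg p p' (s : site) : aligned p p' ->
  (s \in seg p p') = [&& s != p, between p.1 p'.1 s.1 & between p.2 p'.2 s.2].
Proof.
move=> al; apply: (seg_ind (P := fun p' => (s \in seg p p') = _) al).
  by rewrite segpp in_nil siteE /between; lia.
move=> p'' al' ne IH; rewrite seg_rcons// mem_rcons inE IH.
move: al' ne; rewrite /aligned !siteE /between /before.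
case: p p'' s {IH al} => a b [c d] [x y] /=.
by case: (sgzP (c - a)); case: (sgzP (d - b)); lia.
Qed.

Lemma endpoint_cat w p p' : endpoint w = p -> aligned p p' ->
  endpoint (w ++ seg p p') = p'.
Proof. by move=> <- al; rewrite /endpoint last_cat last_seg. Qed.

Lemma adjacent_before p p' : aligned p p' -> p != p' -> adjacent (before p p') p'.
Proof.
rewrite adjacentE /aligned siteE /dist /before /=; case: p p' => a b [c d] /=.
by case: (sgzP (c - a)); case: (sgzP (d - b)); lia.
Qed.

Lemma mem_sites_seg w p p' (s : site) : endpoint w = p -> aligned p p' ->
  (s \in sites (w ++ seg p p')) =
  (s \in sites w) || between p.1 p'.1 s.1 && between p.2 p'.2 s.2.
Proof.
move=> ep al; rewrite /sites -cat_cons mem_cat mem_seg//.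
have [->|//] := eqVneq s p; rewrite /= orbF.
suff -> : p \in (0, 0) :: w by [].
by rewrite -ep /endpoint mem_last.
Qed.

(** The rays ahead of the later sites of the run are contained in the ray ahead of [p], and the run
    stays behind its current end, so one check at [p] suffices. *)
Lemma prudent_seg w p p' : prudent w -> endpoint w = p -> aligned p p' ->
  (forall s : site, s \in sites w -> ~~ ahead p p' s) -> prudent (w ++ seg p p').
Proof.
move=> pw ep al; apply: (seg_ind (P := fun p' => _ -> prudent (w ++ seg p p')) al).
  by rewrite segpp cats0.
move=> p'' al' ne IH free; rewrite seg_rcons// -rcons_cat; apply/prudent_rcons.
rewrite endpoint_cat ?aligned_before//; split; last 2 first.
- exact: adjacent_before.
- move=> s; rewrite mem_sites_seg// ?aligned_before// => /orP[/free|].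
    move: al' ne; rewrite /aligned siteE /ahead /before /=.
    by case: p p'' s {ep al IH free} => a b [c d] [x y] /=;
     case: (sgzP (c - a)); case: (sgzP (d - b)); lia.
  move: al' ne; rewrite /aligned siteE /ahead /before /between /=.
  by case: p p'' s {ep al IH free} => a b [c d] [x y] /=;
     case: (sgzP (c - a)); case: (sgzP (d - b)); lia.
apply: IH => s /free; move: al' ne; rewrite /aligned siteE /ahead /before /=.
by case: p p'' s {ep al free} => a b [c d] [x y] /=;
   case: (sgzP (c - a)); case: (sgzP (d - b)); lia.
Qed.

(** Discrete intermediate value theorem: a unit step changes a coordinate by at most 1. *)
Lemma walk_hits1 (p : site) w x : path adjacent p w ->
  between p.1 (last p w).1 x -> exists2 s, s \in p :: w & s.1 = x.
Proof.
elim: w p => [|p' w IH] p /=.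
  by move=> _; rewrite /between => h; exists p; rewrite ?inE //; lia.
case/andP; rewrite adjacentE /dist => adj pw h.
have [->|ne] := eqVneq x p.1; first by exists p; rewrite ?inE ?eqxx.
have [|s sw sx] := IH _ pw; last by exists s => //; rewrite inE sw orbT.
by move: h; rewrite /between; lia.
Qed.

Lemma walk_hits2 (p : site) w y : path adjacent p w ->
  between p.2 (last p w).2 y -> exists2 s, s \in p :: w & s.2 = y.
Proof.
elim: w p => [|p' w IH] p /=.
  by move=> _; rewrite /between => h; exists p; rewrite ?inE //; lia.
case/andP; rewrite adjacentE /dist => adj pw h.
have [->|ne] := eqVneq y p.2; first by exists p; rewrite ?inE ?eqxx.
have [|s sw sy] := IH _ pw; last by exists s => //; rewrite inE sw orbT.
by move: h; rewrite /between; lia.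
Qed.

(** * Boundary chains and enclosed cells *)

Fixpoint chain (f : site -> site -> int) (p : site) (l : seq site) : int :=
  if l is p' :: l' then f p p' + chain f p' l' else 0.

Lemma chain_cat f p l1 l2 :
  chain f p (l1 ++ l2) = chain f p l1 + chain f (last p l1) l2.
Proof. by elim: l1 p => [|p' l1 IH] p /=; rewrite ?add0r // IH addrA. Qed.

Lemma chain_rcons f p l p' : chain f p (rcons l p') = chain f p l + f (last p l) p'.
Proof. by rewrite -cats1 chain_cat /= addr0. Qed.

(* Signed number of times the segment from [p] to [p'] runs along the unit edge
   going up from (x, y), resp. going right from (x, y). *)
Definition crossV (x y : int) (p p' : site) : int :=
  if p.1 == x then (p.2 <= y)%R%:Z - (p'.2 <= y)%R%:Z else 0.
Definition crossH (x y : int) (p p' : site) : int :=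
  if p.2 == y then (p.1 <= x)%R%:Z - (p'.1 <= x)%R%:Z else 0.

(** The difference of two threshold indicators telescopes, so a straight run of any length costs a
    single evaluation of [crossV]. *)
Lemma chain_segV x y p p' : aligned p p' ->
  chain (crossV x y) p (seg p p') = crossV x y p p'.
Proof.
move=> al; apply: (seg_ind (P := fun z => chain _ p (seg p z) = crossV x y p z) al).
  by rewrite segpp /= /crossV subrr if_same.
move=> p'' al' ne IH; rewrite seg_rcons// chain_rcons IH.
rewrite last_seg ?aligned_before//.
move: al'; rewrite /aligned /crossV /before; case: p p'' {al ne IH} => a b [c d] /=.
case/orP => /eqP ->; rewrite subrr sgz0 subr0; last by do 2?case: ifP => _; lia.
by case: eqP => _; lia.
Qed.

Lemma chain_segH x y p p' : aligned p p' ->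
  chain (crossH x y) p (seg p p') = crossH x y p p'.
Proof.
move=> al; apply: (seg_ind (P := fun z => chain _ p (seg p z) = crossH x y p z) al).
  by rewrite segpp /= /crossH subrr if_same.
move=> p'' al' ne IH; rewrite seg_rcons// chain_rcons IH.
rewrite last_seg ?aligned_before//.
move: al'; rewrite /aligned /crossH /before; case: p p'' {al ne IH} => a b [c d] /=.
case/orP => /eqP ->; rewrite subrr sgz0 subr0; first by do 2?case: ifP => _; lia.
by case: eqP => _; lia.
Qed.

Lemma crossV_unit x y p p' : adjacent p p' -> crossV x y p p' =
  ((p == (x, y)) && (p' == (x, y + 1)))%:Z
  - ((p == (x, y + 1)) && (p' == (x, y)))%:Z.
Proof.
rewrite adjacentE /dist /crossV !siteE; case: p p' => a b [c d] /=.
by case: (a =P x) => ?; lia.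
Qed.

Lemma crossH_unit x y p p' : adjacent p p' -> crossH x y p p' =
  ((p == (x, y)) && (p' == (x + 1, y)))%:Z
  - ((p == (x + 1, y)) && (p' == (x, y)))%:Z.
Proof.
rewrite adjacentE /dist /crossH !siteE; case: p p' => a b [c d] /=.
by case: (b =P y) => ?; lia.
Qed.

Lemma map_next (T : eqType) (x : T) s : uniq (x :: s) ->
  map (next (x :: s)) (x :: s) = rcons s x.
Proof.
move=> us; apply: (@eq_from_nth _ x); first by rewrite size_map size_rcons.
move=> i; rewrite size_map => lt.
rewrite (nth_map x)// next_nth mem_nth// index_uniq//.
by rewrite nth_rcons; case: ifP => // ge; rewrite nth_default ?if_same // leqNgt ge.
Qed.

(** Passes from the walk closed by a step to the origin, on which the operations on codes are easy
    to follow, to the cyclic successors that [edge_cells] speaks of. *)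
Lemma chain_next f w : uniq (sites w) ->
  chain f (0, 0) (rcons w (0, 0)) = \sum_(p <- sites w) f p (next (sites w) p).
Proof.
have zipE (g : site -> site) s :
    \sum_(p <- s) f p (g p) = \sum_(pp <- zip s (map g s)) f pp.1 pp.2.
  by elim: s => [|p s IH]; rewrite ?big_nil //= !big_cons IH.
move=> us; rewrite zipE map_next// /sites.
have gen z z' : chain f z (rcons w z') =
    \sum_(pp <- zip (z :: w) (rcons w z')) f pp.1 pp.2.
  elim: w z {us} => [|p' w' IH] z /=; rewrite big_cons ?big_nil //=.
  by rewrite -IH.
exact: gen.
Qed.

Lemma sum_pred1 (s : seq site) a (P : pred site) : uniq s ->
  \sum_(p <- s) ((p == a) && P p)%:Z = ((a \in s) && P a)%:Z.
Proof.
elim: s => [|b s IH] /=; first by rewrite big_nil.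
case/andP => bs us; rewrite big_cons IH// inE.
have [<-|ne] := eqVneq b a; first by rewrite (negbTE bs) /= addr0.
by rewrite add0r.
Qed.

Definition dedge (w : walk) (a b : site) := (a \in sites w) && (next (sites w) a == b).

(** In a cycle of at least three sites no edge is run along in both directions; a cycle of two sites
    would go back along its only edge. *)
Lemma next_next (T : eqType) (s : seq T) a : uniq s -> (2 < size s)%N ->
  a \in s -> next s (next s a) != a.
Proof.
move=> us sz sa; have [i s' sE] := rot_to sa.
rewrite -!(next_rot i us) sE.
have: uniq (a :: s') by rewrite -sE rot_uniq.
have: (2 < size (a :: s'))%N by rewrite -sE size_rot.
case: s' {sE} => [|b [|c s']] //= _; rewrite !inE !negb_or eqxx.
rewrite -!andbA => /and5P[ab ac _ _ _].
by rewrite [b == a]eq_sym (negbTE ab) eqxx [c == a]eq_sym ac.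
Qed.

Lemma left_cellE (x y : int) : left_cell (x, y) (x + 1, y) = (x, y).
Proof.
by rewrite /left_cell (_ : _ - _ = (1, 0)) //; apply: siteP => /=; lia.
Qed.

Lemma left_cellN (x y : int) : left_cell (x, y) (x, y + 1) = (x - 1, y).
Proof.
rewrite /left_cell (_ : (_, _ + 1) - _ = (0, 1)) /=; last by apply: siteP => /=; lia.
by apply: siteP => /=; lia.
Qed.

Lemma left_cellW (x y : int) : left_cell (x + 1, y) (x, y) = (x, y - 1).
Proof.
rewrite /left_cell (_ : (x, y) - _ = (-1, 0)) /=; last by apply: siteP => /=; lia.
by apply: siteP => /=; lia.
Qed.

Lemma left_cellS (x y : int) : left_cell (x, y + 1) (x, y) = (x, y).
Proof.
rewrite /left_cell (_ : (x, y) - _ = (0, -1)) /=; last by apply: siteP => /=; lia.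
by apply: siteP => /=; lia.
Qed.

Definition left_cell_unit := (left_cellE, left_cellN, left_cellW, left_cellS).

Lemma adjacent_cases (P : site -> site -> Prop) :
  (forall x y, P (x, y) (x + 1, y)) -> (forall x y, P (x + 1, y) (x, y)) ->
  (forall x y, P (x, y) (x, y + 1)) -> (forall x y, P (x, y + 1) (x, y)) ->
  forall p p', adjacent p p' -> P p p'.
Proof.
move=> PE PW PN PS [x y] [x' y']; rewrite adjacentE /dist /= => adj.
have [e|ne1] := eqVneq x' (x + 1).
  by have -> : y' = y by [lia]; rewrite e.
have [e|ne2] := eqVneq x (x' + 1).
  by have -> : y' = y by [lia]; rewrite e.
have [e|ne3] := eqVneq y' (y + 1).
  by have -> : x' = x by [lia]; rewrite e.
by have -> : y = y' + 1 by [lia]; have -> : x' = x by lia.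
Qed.

(** * Crossing numbers decide which cells communicate *)

Section Boundary.
Variables (w : walk) (A : pred site).
Hypothesis walkw : is_walk w.
Hypothesis uniqw : uniq (sites w).
Hypothesis sizew : (1 < size w)%N.
Hypothesis closew : adjacent (endpoint w) (0, 0).
Hypothesis AV : forall x y, chain (crossV x y) (0, 0) (rcons w (0, 0)) =
  (A (x - 1, y))%:Z - (A (x, y))%:Z.
Hypothesis AH : forall x y, chain (crossH x y) (0, 0) (rcons w (0, 0)) =
  (A (x, y))%:Z - (A (x, y - 1))%:Z.

Lemma adjacent_next p : p \in sites w -> adjacent p (next (sites w) p).
Proof.
apply: next_cycle; rewrite /sites /=.
by rewrite rcons_path; apply/andP.
Qed.

Lemma sum_dedge a b : (dedge w a b)%:Z =
  \sum_(p <- sites w) ((p == a) && (next (sites w) p == b))%:Z.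
Proof. by rewrite (sum_pred1 a (fun p => next (sites w) p == b) uniqw). Qed.

Lemma dedgeV x y : (A (x - 1, y))%:Z - (A (x, y))%:Z =
  (dedge w (x, y) (x, y + 1))%:Z - (dedge w (x, y + 1) (x, y))%:Z.
Proof.
rewrite -AV chain_next// !sum_dedge -sumrB.
by apply: eq_big_seq => p /adjacent_next /crossV_unit.
Qed.

Lemma dedgeH x y : (A (x, y))%:Z - (A (x, y - 1))%:Z =
  (dedge w (x, y) (x + 1, y))%:Z - (dedge w (x + 1, y) (x, y))%:Z.
Proof.
rewrite -AH chain_next// !sum_dedge -sumrB.
by apply: eq_big_seq => p /adjacent_next /crossH_unit.
Qed.

Lemma dedge_asym a b : dedge w a b -> ~~ dedge w b a.
Proof.
case/andP => sa /eqP <-; apply/negP => /andP[_ /eqP].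
by apply/eqP/next_next.
Qed.

(** The edge is used in one direction only, so the indicators of its two cells differ by exactly 1,
    with a known sign; this fixes both values. *)
Lemma dedge_cells p p' : adjacent p p' -> dedge w p p' ->
  A (left_cell p p') /\ ~~ A (right_cell p p').
Proof.
apply: (adjacent_cases (P := fun p p' => dedge w p p' -> _ /\ _)) => x y d;
  have nd := dedge_asym d; rewrite /right_cell !left_cell_unit.
- by have := dedgeH x y; rewrite d (negbTE nd); case: (A _); case: (A _).
- by have := dedgeH x y; rewrite d (negbTE nd); case: (A _); case: (A _).
- by have := dedgeV x y; rewrite d (negbTE nd); case: (A _); case: (A _).
- by have := dedgeV x y; rewrite d (negbTE nd); case: (A _); case: (A _).
Qed.

Lemma edge_cells_in p : p \in sites w ->
  A (edge_cells w p).1 /\ ~~ A (edge_cells w p).2.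
Proof.
move=> sp; apply: dedge_cells; first exact: adjacent_next.
by rewrite /dedge sp eqxx.
Qed.

Lemma separated_diff c c' : separated w c c' -> A c != A c'.
Proof.
case/hasP => p /edge_cells_in; case: (edge_cells w p) => a b /= [Aa Ab].
by rewrite !inE => /orP[] /eqP[<- <-]; rewrite Aa (negbTE Ab).
Qed.

Lemma dedge_separated p p' c c' : dedge w p p' ->
  left_cell p p' = c -> right_cell p p' = c' -> separated w c c' /\ separated w c' c.
Proof.
case/andP => sp /eqP np <- <-; split; apply/hasP; exists p => //;
by rewrite /edge_cells np !inE eqxx ?orbT.
Qed.

Lemma diff_separated c c' : adjacent c c' -> A c -> ~~ A c' -> separated w c c'.
Proof.
apply: (adjacent_cases (P := fun c c' => A c -> ~~ A c' -> separated w c c')).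
- move=> x y Ac nAc; have := dedgeV (x + 1) y; rewrite addrK Ac (negbTE nAc).
  case d : (dedge _ _ _); last by case: (dedge _ _ _).
  by move=> _; apply: (dedge_separated d _ _).1; rewrite /right_cell left_cell_unit ?addrK.
- move=> x y Ac nAc; have := dedgeV (x + 1) y; rewrite addrK Ac (negbTE nAc).
  case d : (dedge _ (_, _ + 1) _); last by case: (dedge _ _ _).
  by move=> _; apply: (dedge_separated d _ _).1; rewrite /right_cell left_cell_unit ?addrK.
- move=> x y Ac nAc; have := dedgeH x (y + 1); rewrite addrK Ac (negbTE nAc).
  case d : (dedge _ (_ + 1, _) _); last by case: (dedge _ _ _).
  by move=> _; apply: (dedge_separated d _ _).1; rewrite /right_cell left_cell_unit ?addrK.
- move=> x y Ac nAc; have := dedgeH x (y + 1); rewrite addrK Ac (negbTE nAc).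
  case d : (dedge _ (x, _) _); last by case: (dedge _ _ _).
  by move=> _; apply: (dedge_separated d _ _).1; rewrite /right_cell left_cell_unit ?addrK.
Qed.

(** Crossing the boundary and changing membership in [A] are the same event, so [A] is constant on
    components. *)
Lemma communicatingE c c' : communicating w c c' = adjacent c c' && (A c == A c').
Proof.
rewrite /communicating; have [adj|//] := boolP (adjacent c c'); rewrite /=.
have [e|ne] := eqVneq (A c) (A c').
  by apply/negP => /separated_diff; rewrite e eqxx.
apply/negbTE; rewrite negbK; move: ne.
case Ac: (A c); case Ac': (A c') => // _.
  by apply: diff_separated => //; rewrite Ac'.
rewrite (_ : separated w c c' = separated w c' c).
  by apply: diff_separated; rewrite ?Ac// adjacentC.
by apply: eq_has => p; rewrite !inE orbC.
Qed.

End Boundary.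

Definition linked (P : pred site) (c c' : site) : Prop :=
  exists s, [/\ path adjacent c s, last c s = c' & all P s].

Lemma linked_refl P c : linked P c c.
Proof. by exists [::]. Qed.

Lemma linked_trans P c1 c2 c3 : linked P c1 c2 -> linked P c2 c3 -> linked P c1 c3.
Proof.
case=> s [ps ls Ps] [t [pt lt Pt]]; exists (s ++ t).
by rewrite cat_path ps last_cat all_cat ls Ps.
Qed.

Lemma linked_step (P : pred site) c c' : adjacent c c' -> P c' -> linked P c c'.
Proof. by move=> adj Pc'; exists [:: c']; rewrite /= adj Pc'. Qed.

Lemma linked_sub (P Q : pred site) c c' : (forall a, P a -> Q a) ->
  linked P c c' -> linked Q c c'.
Proof.
by move=> PQ [s [ps ls Ps]]; exists s; split=> //; apply: sub_all Ps.
Qed.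

Lemma linked_sym (P : pred site) c c' : P c -> linked P c c' -> linked P c' c.
Proof.
move=> + [s [+ <- +]]; elim: s c => [|d s IH] c Pc /=; first by move=> *; exact: linked_refl.
case/andP => adj ps /andP[Pd Ps]; apply: linked_trans (IH _ Pd ps Ps) _.
by apply: linked_step; rewrite // adjacentC.
Qed.

(** * Enclosed cells from escape paths *)

Section Enclosed.
Variables (w : walk) (cs : seq site).
Hypothesis comm : forall c c', communicating w c c' =
  adjacent c c' && ((c \in cs) == (c' \in cs)).
Hypothesis escape : forall c, c \notin cs -> exists c' (f : nat -> site),
  [/\ linked (fun d => d \notin cs) c c', f 0%N = c', injective f,
     forall n, adjacent (f n) (f n.+1) & forall n, f n \notin cs].

Lemma path_comm c s : path (communicating w) c s ->
  path adjacent c s /\ all (fun d => (d \in cs) == (c \in cs)) s.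
Proof.
elim: s c => [//|d s IH] c /=; rewrite comm => /andP[/andP[-> /eqP ->]] /IH[-> ->].
by rewrite eqxx.
Qed.

Lemma comm_path c s : path adjacent c s -> c \notin cs ->
  all (fun d => d \notin cs) s -> path (communicating w) c s.
Proof.
elim: s c => [//|d s IH] c /= /andP[adj ps] ccs /andP[dcs scs].
by rewrite comm adj (negbTE ccs) (negbTE dcs) eqxx IH.
Qed.

(** The component of a cell of [cs] stays in the finite list [cs]; the component of any other cell
    contains the whole injective sequence [f], hence is infinite. *)
Lemma enclosedE : enclosed w = [set` cs].
Proof.
apply/seteqP; split=> c /=; rewrite /enclosed /=; last first.
  move=> ccs; apply: (sub_finite_set _ (finite_seq cs)) => d /= [s /path_comm[_ sc] <-].
  have : all (mem cs) (c :: s).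
    by rewrite /= ccs; apply: sub_all sc => e /eqP; rewrite ccs.
  by move/allP; apply; apply: mem_last.
move=> fin; apply: contrapT => /negP ccs.
have [c' [f [[s [ps ls scs]] f0 finj fadj fcs]]] := escape ccs.
have pathf m k : path adjacent (f m) [seq f i | i <- iota m.+1 k].
  by elim: k m => [//|k IH] m /=; rewrite fadj IH.
have pf n : path (communicating w) (f 0%N) [seq f i | i <- iota 1 n].
  by apply: comm_path; [|exact: fcs|apply/allP => _ /mapP[i _ ->]; apply: fcs].
suff : finite_set (range f).
  by rewrite (eq_finite_set (inj_card_eq _)) => [/infinite_nat|? ? _ _ /finj].
apply: sub_finite_set fin => _ [n _ <-] /=.
exists (s ++ [seq f i | i <- iota 1 n]).
  by rewrite cat_path comm_path //= ls -f0 pf.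
rewrite last_cat ls -f0 (last_map f); congr f.
have lastE m k : last m (iota m.+1 k) = (m + k)%N.
  by elim: k m => [|k IH] m /=; rewrite ?addn0 // IH addSnnS.
exact: lastE.
Qed.
End Enclosed.

(** * Codes of polygons *)

(* The successive operations: in [Top c k], [Right c k] and [Bottom c k], a row or
   column of [k] cells is added to [c]. The box of [c] extends horizontally from
   x = -1 to x = wd c - 1 and vertically from y = bt c to y = tp c. *)
Inductive code :=
  Unit | Top of code & nat | Right of code & nat | Bottom of code & nat.

Fixpoint wd (c : code) : nat :=
  match c with
  | Unit => 1
  | Top c k => maxn (wd c) k
  | Right c _ => (wd c).+1
  | Bottom c _ => wd c
  end.

Fixpoint ht (c : code) : nat :=
  match c with
  | Unit => 1
  | Top c _ => (ht c).+1
  | Right c k => maxn (ht c) k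
  | Bottom c _ => (ht c).+1
  end.

Fixpoint tp (c : code) : nat :=
  match c with
  | Unit => 1
  | Top c _ => (tp c).+1
  | Right c _ | Bottom c _ => tp c
  end.

(* 0, 1 or 2 for the classes X, Y and Z. It is positive when the walk, after its
   last inflating step, can reach the right side of the box, and 2 when it can
   also reach the bottom side from there. *)
Definition kind (c : code) : nat :=
  match c with
  | Unit => 1
  | Top c k => (wd c < k)%N
  | Right c k => (ht c < k)%N.+1
  | Bottom c _ => 2
  end.

Fixpoint valid (c : code) : bool :=
  match c with
  | Unit => true
  | Top c k => [&& valid c, (0 < k)%N & (k <= (wd c).+1)%N]
  | Right c k => [&& valid c, (0 < kind c)%N, (0 < k)%N & (k <= (ht c).+1)%N]
  | Bottom c k => [&& valid c, (1 < kind c)%N, (0 < k)%N & (k < wd c)%N]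
  end.

Definition bt (c : code) : int := (tp c)%:Z - (ht c)%:Z.

Fixpoint cell (c : code) (a : site) : bool :=
  match c with
  | Unit => a == (-1, 0)
  | Top c k => (a.2 == tp c) && (-1 <= a.1 < k%:Z - 1) || cell c a
  | Right c k =>
      (a.1 == (wd c)%:Z - 1) && ((tp c)%:Z - k%:Z <= a.2 < (tp c)%:Z) || cell c a
  | Bottom c k =>
      (a.2 == bt c - 1) && ((wd c)%:Z - 1 - k%:Z <= a.1 < (wd c)%:Z - 1) || cell c a
  end.

(* The sites where the walk first gets to the top, right and bottom sides of the
   box, after its last inflating step; meaningful for the right side when
   [0 < kind c], and for the bottom side when [1 < kind c]. *)
Definition endT (c : code) : site :=
  if c is Top c k then (k%:Z - 1, (tp c)%:Z + 1) else ((wd c)%:Z - 1, (tp c)%:Z).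
Definition endR (c : code) : site :=
  match c with
  | Unit => (0, 0)
  | Top c k => (k%:Z - 1, (tp c)%:Z)
  | Right c k => ((wd c)%:Z, (tp c)%:Z - k%:Z)
  | Bottom c _ => ((wd c)%:Z - 1, bt c - 1)
  end.
Definition endB (c : code) : site :=
  match c with
  | Unit => (0, 0)
  | Top c _ => endT c
  | Right c k => ((wd c)%:Z - 1, (tp c)%:Z - k%:Z)
  | Bottom c k => ((wd c)%:Z - 1 - k%:Z, bt c - 1)
  end.

(** Below kind 2 the bottom side is not reached, and [endB] is merely the start of the last run to
    [endR]; the stages B, R and T can thus be concatenated in the same way for every code. *)
Fixpoint walkB (c : code) : walk :=
  match c with
  | Unit => [::]
  | Top c k => walkB c ++ seg (endB c) (endR c) ++ seg (endR c) (endT c)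
  | Right c k => (walkB c ++ seg (endB c) (endR c)) ++
      seg (endR c) ((wd c)%:Z - 1, (tp c)%:Z - k%:Z)
  | Bottom c k => (walkB c ++ seg (endB c) ((wd c)%:Z - 1 - k%:Z, bt c)) ++
      seg ((wd c)%:Z - 1 - k%:Z, bt c) ((wd c)%:Z - 1 - k%:Z, bt c - 1)
  end.

Definition walkR c := walkB c ++ seg (endB c) (endR c).
Definition walkT c := walkR c ++ seg (endR c) (endT c).
Definition full c :=
  (walkT c ++ seg (endT c) (-1, (tp c)%:Z)) ++ seg (-1, (tp c)%:Z) (-1, 0).

(** * Coded walks are prudent *)

Lemma kind_le2 c : (kind c <= 2)%N.
Proof. by case: c => [|c k|c k|c k] //=; lia. Qed.

Lemma valid_dims c : valid c ->
  [/\ (0 < wd c)%N, (0 < tp c)%N, (tp c <= ht c)%N & (1 < kind c)%N -> (1 < wd c)%N].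
Proof.
elim: c => [|c IH k|c IH k|c IH k] /=; first by split.
- by case/andP => /IH[] *; split; lia.
- by case/andP => /IH[] *; split; lia.
- by case/andP => /IH[] *; split; lia.
Qed.

Lemma endT2 c : (endT c).2 = (tp c)%:Z.
Proof. by case: c => //= c k; lia. Qed.

Lemma endT1 c : valid c -> (0 < kind c)%N -> (endT c).1 = (wd c)%:Z - 1.
Proof. by case: c => //= c k; lia. Qed.

Lemma endR1 c : valid c -> (0 < kind c)%N -> (endR c).1 = (wd c)%:Z - 1.
Proof. by case: c => //= c k; lia. Qed.

Lemma endR2 c : valid c -> (1 < kind c)%N -> (endR c).2 = bt c.
Proof. by rewrite /bt; case: c => //= c k; rewrite /bt; lia. Qed.

Lemma endB2 c : valid c -> (1 < kind c)%N -> (endB c).2 = bt c.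
Proof. by rewrite /bt; case: c => //= c k; rewrite /bt; lia. Qed.

Lemma aligned_BR c : aligned (endB c) (endR c).
Proof.
by rewrite /aligned; case: c => //= c k; rewrite ?endT2 eqxx ?orbT.
Qed.

Lemma aligned_RT c : aligned (endR c) (endT c).
Proof. by rewrite /aligned; case: c => //= c k; apply/orP; left; lia. Qed.

Lemma walkB_end c : valid c -> endpoint (walkB c) = endB c.
Proof.
elim: c => [|c IH k|c IH k|c IH k] //=.
- case/and3P => vc _ _; rewrite catA.
  by rewrite (endpoint_cat _ (aligned_RT c))// (endpoint_cat _ (aligned_BR c))// IH.
- case/and4P => vc kc _ _; rewrite (@endpoint_cat _ (endR c))//.
    by rewrite (endpoint_cat _ (aligned_BR c))// IH.
  by rewrite /aligned endR1// eqxx.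
- case/and4P => vc kc _ _; rewrite (@endpoint_cat _ ((wd c)%:Z - 1 - k%:Z, bt c))//.
    by apply: endpoint_cat (IH vc) _; rewrite /aligned endB2// eqxx orbT.
  by rewrite /aligned /= eqxx.
Qed.

Lemma walkR_end c : valid c -> endpoint (walkR c) = endR c.
Proof. by move=> vc; apply: endpoint_cat (walkB_end vc) (aligned_BR c). Qed.

Lemma walkT_end c : valid c -> endpoint (walkT c) = endT c.
Proof. by move=> vc; apply: endpoint_cat (walkR_end vc) (aligned_RT c). Qed.

Lemma walkB_Top c k : walkB (Top c k) = walkT c.
Proof. by rewrite /= /walkT /walkR catA. Qed.

(** A bounding box is too weak for the induction: the end must be the only visited site on the side
    just reached, so that this side is free for the next slide. Each box also leaves out the sides
    that are reached later. *)
Definition inB c (s : site) := [&& 0 <= s.1 <= (wd c)%:Z - 2,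
  bt c <= s.2 <= (tp c)%:Z - 1 & (s.2 == bt c) ==> (s == endB c)].
Definition inR c (s : site) := [&& 0 <= s.1 <= (wd c)%:Z - 1,
  bt c <= s.2 <= (tp c)%:Z - 1 & (s.1 == (wd c)%:Z - 1) ==> (s == endR c)].
Definition inT c (s : site) := [&& 0 <= s.1 <= (wd c)%:Z - 1,
  bt c <= s.2 <= (tp c)%:Z & (s.2 == (tp c)%:Z) ==> (s == endT c)].

Definition sound c := [/\
  prudent (walkT c) /\ (forall s : site, s \in sites (walkT c) -> inT c s),
  (0 < kind c)%N -> prudent (walkR c) /\ (forall s : site, s \in sites (walkR c) -> inR c s) &
  (1 < kind c)%N -> prudent (walkB c) /\ (forall s : site, s \in sites (walkB c) -> inB c s)].

(** The run up from [endR] is common to all codes. It is free because in its column the walk has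
    stayed at or below [endR]. *)
Lemma sound_T c : valid c -> prudent (walkR c) ->
  (forall s : site, s \in sites (walkR c) -> [&& 0 <= s.1 <= (wd c)%:Z - 1,
     bt c <= s.2 <= (tp c)%:Z - 1 & (s.1 == (endR c).1) ==> (s.2 <= (endR c).2)]) ->
  (endR c).2 < (tp c)%:Z ->
  prudent (walkT c) /\ (forall s : site, s \in sites (walkT c) -> inT c s).
Proof.
move=> vc pR box lt.
have al := aligned_RT c; have eT := endT2 c.
have eR : (endR c).1 = (endT c).1 by move: al eT lt; rewrite /aligned; lia.
have eRin : endR c \in sites (walkR c) by rewrite -walkR_end// /endpoint mem_last.
split.
  apply: prudent_seg => //; first exact: walkR_end.
  by case=> x y /box; rewrite /ahead /=; lia.
case=> x y; rewrite mem_sites_seg ?walkR_end// /inT siteE /=.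
have := box _ eRin.
by move=> bR /orP[/box|]; rewrite /between /=; lia.
Qed.

Lemma soundP c : valid c -> sound c.
Proof.
elim: c => [|c IH k|c IH k|c IH k] vc; have vc' := vc; move: vc => /=.
- move=> _.
  have RE : walkR Unit = [::] by rewrite /walkR /= segpp.
  have box (s : site) : s \in sites (walkR Unit) -> s = (0, 0).
    by rewrite RE inE => /eqP.
  have pR : prudent (walkR Unit) by rewrite RE; apply: prudent_nil.
  split=> // [|_]; last by split=> // s /box ->.
  by apply: sound_T => // s /box ->.
- case/and3P => vc k0 kw; have [[pT bT] _ _] := IH vc.
  have [w0 t0 th0 _] := valid_dims vc; have eT := endT2 c.
  have eTin : endT c \in sites (walkT c) by rewrite -walkT_end// /endpoint mem_last.
  have bE := bT _ eTin.
  have pR : prudent (walkR (Top c k)).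
    rewrite /walkR walkB_Top; apply: prudent_seg => //; first exact: walkT_end.
      exact: (aligned_BR (Top c k)).
    by case=> x y /bT; rewrite /inT /ahead !siteE /=; lia.
  have mR (s : site) : s \in sites (walkR (Top c k)) -> inT c s ||
      (s.2 == (tp c)%:Z) && between (endT c).1 (k%:Z - 1) s.1.
    rewrite /walkR walkB_Top mem_sites_seg ?walkT_end ?(aligned_BR (Top c k))//=.
    case/orP => [/bT->//|]; rewrite eT /between; lia.
  (* Column [wd c] is outside the previous box; only the end of a slide with [k = wd c + 1] can be
     on it. *)
  have bR (s : site) : s \in sites (walkR (Top c k)) ->
      [&& 0 <= s.1 <= (wd (Top c k))%:Z - 1, bt (Top c k) <= s.2 <= (tp c)%:Z &
      (s.1 == (wd c)%:Z) ==> (s == (k%:Z - 1, (tp c)%:Z))].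
    move/mR; rewrite /bt /inT /between !siteE /=; move: bE; rewrite /inT /bt /=.
    by rewrite !siteE; lia.
  split=> //; first (apply: sound_T => //=; last lia).
    by move=> s /bR; rewrite /bt /=; lia.
    by move=> /= kk; split=> // -[x y] /bR; rewrite /inR /bt !siteE /=; lia.
  by move=> /= kk; lia.
- case/and4P => vc kc k0 kw; have [_ /(_ kc)[pR bR] _] := IH vc.
  have [w0 t0 th0 _] := valid_dims vc; have eR := endR1 vc kc.
  have eRin : endR c \in sites (walkR c) by rewrite -walkR_end// /endpoint mem_last.
  have bE := bR _ eRin.
  have al : aligned (endR c) ((wd c)%:Z - 1, (tp c)%:Z - k%:Z).
    by rewrite /aligned eR eqxx.
  have alB := aligned_BR (Right c k).
  have pB : prudent (walkB (Right c k)).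
    apply: prudent_seg => //; first exact: walkR_end.
    by case=> x y /bR; rewrite /inR /ahead !siteE /=; lia.
  have mB (s : site) : s \in sites (walkB (Right c k)) -> inR c s ||
      (s.1 == (wd c)%:Z - 1) && between (endR c).2 ((tp c)%:Z - k%:Z) s.2.
    rewrite mem_sites_seg ?walkR_end//.
    by case/orP => [/bR->//|] /=; rewrite eR /between; lia.
  have bB (s : site) : s \in sites (walkB (Right c k)) ->
      [&& 0 <= s.1 <= (wd c)%:Z - 1, bt (Right c k) <= s.2 <= (tp c)%:Z - 1 &
      (s.2 == bt c - 1) ==> (s == ((wd c)%:Z - 1, (tp c)%:Z - k%:Z))].
    move/mB; rewrite /bt /inR /between !siteE /=; move: bE; rewrite /inR /bt /=.
    by rewrite !siteE; lia.
  have pR' : prudent (walkR (Right c k)).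
    apply: prudent_seg => //; first exact: walkB_end.
    by case=> x y /bB; rewrite /bt /ahead !siteE /=; lia.
  have bR' (s : site) : s \in sites (walkR (Right c k)) -> inR (Right c k) s.
    rewrite mem_sites_seg ?walkB_end// /inR !siteE.
    by case/orP => [/bB|]; rewrite /between /bt /=; lia.
  split=> //; first (apply: sound_T => //=; last lia).
    by move=> s /bR'; rewrite /inR !siteE /=; lia.
  move=> kk; split=> // -[x y] /bB; rewrite /inB !siteE /bt /=.
  by move: kk => /=; lia.
- case/and4P => vc kc k0 kw; have [_ _ /(_ kc)[pB bB]] := IH vc.
  have [w0 t0 th0 _] := valid_dims vc; have eB := endB2 vc kc.
  have eBin : endB c \in sites (walkB c) by rewrite -walkB_end// /endpoint mem_last.
  have bE := bB _ eBin.
  have al : aligned (endB c) ((wd c)%:Z - 1 - k%:Z, bt c).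
    by rewrite /aligned eB eqxx orbT.
  have alB := aligned_BR (Bottom c k).
  have pB1 : prudent (walkB c ++ seg (endB c) ((wd c)%:Z - 1 - k%:Z, bt c)).
    apply: prudent_seg => //; first exact: walkB_end.
    by case=> x y /bB; rewrite /inB /ahead !siteE /=; lia.
  have eB1 := endpoint_cat (walkB_end vc) al.
  have mB (s : site) :
      s \in sites (walkB c ++ seg (endB c) ((wd c)%:Z - 1 - k%:Z, bt c)) ->
      inB c s || (s.2 == bt c) && between (endB c).1 ((wd c)%:Z - 1 - k%:Z) s.1.
    rewrite mem_sites_seg ?walkB_end//.
    by case/orP => [/bB->//|] /=; rewrite eB /between; lia.
  have bB1 (s : site) :
      s \in sites (walkB c ++ seg (endB c) ((wd c)%:Z - 1 - k%:Z, bt c)) ->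
      [&& 0 <= s.1 <= (wd c)%:Z - 2 & bt c <= s.2 <= (tp c)%:Z - 1].
    move/mB; rewrite /bt /inB /between !siteE /=; move: bE; rewrite /inB /bt /=.
    by rewrite !siteE; lia.
  have alv : aligned ((wd c)%:Z - 1 - k%:Z, bt c) ((wd c)%:Z - 1 - k%:Z, bt c - 1).
    by rewrite /aligned eqxx.
  have pB' : prudent (walkB (Bottom c k)).
    apply: prudent_seg => //.
    by case=> x y /bB1; rewrite /bt /ahead ?siteE /=; lia.
  have bB' (s : site) : s \in sites (walkB (Bottom c k)) -> inB (Bottom c k) s.
    rewrite mem_sites_seg// /inB !siteE.
    by case/orP => [/bB1|]; rewrite /between /= /bt /=; lia.
  have pR' : prudent (walkR (Bottom c k)).
    apply: prudent_seg => //; first exact: walkB_end.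
    by case=> x y /bB'; rewrite /inB /ahead !siteE /= /bt /=; lia.
  have bR' (s : site) : s \in sites (walkR (Bottom c k)) -> inR (Bottom c k) s.
    rewrite mem_sites_seg ?walkB_end// /inR !siteE.
    by case/orP => [/bB'|]; rewrite /inB /between ?siteE /= /bt /=; lia.
  split=> //; apply: sound_T => //=; last by rewrite /bt; lia.
  by move=> s /bR'; rewrite /inR !siteE /=; lia.
Qed.

Lemma prudent_full c : valid c -> [/\ prudent (full c), (1 < size (full c))%N &
  endpoint (full c) = (-1, 0)].
Proof.
move=> vc; have [[pT bT] _ _] := soundP vc.
have [w0 t0 _ _] := valid_dims vc; have eT := endT2 c.
have eTin : endT c \in sites (walkT c) by rewrite -walkT_end// /endpoint mem_last.
have bE := bT _ eTin.
have al1 : aligned (endT c) (-1, (tp c)%:Z) by rewrite /aligned eT eqxx orbT.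
have al2 : aligned (-1, (tp c)%:Z) (-1, 0) by rewrite /aligned eqxx.
have e1 := endpoint_cat (walkT_end vc) al1.
have p1 : prudent (walkT c ++ seg (endT c) (-1, (tp c)%:Z)).
  apply: prudent_seg => //; first exact: walkT_end.
  by case=> x y /bT; rewrite /inT /ahead !siteE /=; lia.
split; last exact: endpoint_cat.
  apply: prudent_seg => // -[x y].
  rewrite mem_sites_seg ?walkT_end// /ahead /=; move: bE; rewrite /inT.
  by move=> bE /orP[/bT|]; rewrite /inT /between /=; lia.
rewrite !size_cat !size_map !size_iota /dist /=; move: bE; rewrite /inT.
by rewrite -subn_gt0; lia.
Qed.

(** * The cells of a code *)

Fixpoint ar (c : code) : nat :=
  match c with
  | Unit => 1
  | Top c k | Right c k | Bottom c k => ar c + k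
  end.

Fixpoint cells (c : code) : seq site :=
  match c with
  | Unit => [:: (-1, 0)]
  | Top c k => [seq (i%:Z - 1, (tp c)%:Z) | i <- iota 0 k] ++ cells c
  | Right c k =>
      [seq ((wd c)%:Z - 1, (tp c)%:Z - k%:Z + i%:Z) | i <- iota 0 k] ++ cells c
  | Bottom c k =>
      [seq ((wd c)%:Z - 1 - k%:Z + i%:Z, bt c - 1) | i <- iota 0 k] ++ cells c
  end.

Lemma mem_map_iota (f : nat -> site) k (P : pred site) a :
  (forall i, (i < k)%N -> P (f i)) -> (P a -> exists2 i, (i < k)%N & a = f i) ->
  (a \in [seq f i | i <- iota 0 k]) = P a.
Proof.
move=> fP Pf; apply/mapP/idP => [[i]|/Pf[i ik ->]].
  by rewrite mem_iota => /andP[_ ik] ->; apply: fP.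
by exists i; rewrite // mem_iota.
Qed.

Lemma mem_cells c (a : site) : (a \in cells c) = cell c a.
Proof.
elim: c => [|c IH k|c IH k|c IH k] /=; first by rewrite inE.
- rewrite mem_cat IH; congr (_ || _).
  rewrite (@mem_map_iota _ _ (fun a => (a.2 == tp c) && (-1 <= a.1 < k%:Z - 1)))//.
    by move=> i ik /=; lia.
  case: a {IH} => x y /= h; exists (absz (x + 1)%R); first lia.
  by apply: siteP => /=; lia.
- rewrite mem_cat IH; congr (_ || _).
  rewrite (@mem_map_iota _ _ (fun a => (a.1 == (wd c)%:Z - 1) &&
    ((tp c)%:Z - k%:Z <= a.2 < (tp c)%:Z)))//.
    by move=> i ik /=; lia.
  case: a {IH} => x y /= h; exists (absz (y - ((tp c)%:Z - k%:Z))%R); first lia.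
  by apply: siteP => /=; lia.
- rewrite mem_cat IH; congr (_ || _).
  rewrite (@mem_map_iota _ _ (fun a => (a.2 == bt c - 1) &&
    ((wd c)%:Z - 1 - k%:Z <= a.1 < (wd c)%:Z - 1)))//.
    by move=> i ik /=; lia.
  case: a {IH} => x y /= h; exists (absz (x - ((wd c)%:Z - 1 - k%:Z))%R); first lia.
  by apply: siteP => /=; lia.
Qed.

Lemma size_cells c : size (cells c) = ar c.
Proof.
by elim: c => //= c IH k; rewrite size_cat size_map size_iota IH addnC.
Qed.

Lemma cell_box c (a : site) : valid c -> cell c a ->
  (-1 <= a.1 < (wd c)%:Z - 1) && (bt c <= a.2 < (tp c)%:Z).
Proof.
case: a => x y; elim: c => [|c IH k|c IH k|c IH k] /=.
- by move=> _ /eqP[-> ->].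
- case/and3P => vc k0 kw; have [w0 t0 th0 _] := valid_dims vc.
  by case/orP => [|/(IH vc)]; rewrite /bt /=; lia.
- case/and4P => vc kc k0 kw; have [w0 t0 th0 _] := valid_dims vc.
  by case/orP => [|/(IH vc)]; rewrite /bt /=; lia.
- case/and4P => vc kc k0 kw; have [w0 t0 th0 _] := valid_dims vc.
  by case/orP => [|/(IH vc)]; rewrite /bt /=; lia.
Qed.

Lemma uniq_cells c : valid c -> uniq (cells c).
Proof.
elim: c => [//|c IH k|c IH k|c IH k] /=.
- case/and3P => vc k0 kw; rewrite cat_uniq IH// andbT map_inj_in_uniq ?iota_uniq//=.
    by apply/hasPn => a; rewrite mem_cells => /(cell_box vc) ab; apply/mapP => -[i _] e;
       move: ab; rewrite e /=; lia.
  by move=> i j _ _ [] ; lia.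
- case/and4P => vc kc k0 kw; rewrite cat_uniq IH// andbT map_inj_in_uniq ?iota_uniq//=.
    by apply/hasPn => a; rewrite mem_cells => /(cell_box vc) ab; apply/mapP => -[i _] e;
       move: ab; rewrite e /=; lia.
  by move=> i j _ _ [] ; lia.
- case/and4P => vc kc k0 kw; rewrite cat_uniq IH// andbT map_inj_in_uniq ?iota_uniq//=.
    by apply/hasPn => a; rewrite mem_cells => /(cell_box vc) ab; apply/mapP => -[i _] e;
       move: ab; rewrite e /=; lia.
  by move=> i j _ _ [] ; lia.
Qed.

(** The left column grows only with a top row: a right column has abscissa at least 0, and a bottom
    row, having fewer than [wd] cells, stops short of it. *)
Lemma cell_left c y : valid c -> cell c (-1, y) = (0 <= y < (tp c)%:Z).
Proof.
elim: c => [|c IH k|c IH k|c IH k] /=.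
- by move=> _; rewrite siteE /=; lia.
- by case/and3P => vc k0 kw; rewrite IH//; have := valid_dims vc; lia.
- by case/and4P => vc kc k0 kw; rewrite IH//; have [*] := valid_dims vc; lia.
- by case/and4P => vc kc k0 kw; rewrite IH//; have [*] := valid_dims vc; lia.
Qed.

(** A new right column starts beside the last cell of this row, as a new bottom row starts under the
    full column of [cell_right]; both attachments rely on the kind that [valid] requires. *)
Lemma cell_top c x : valid c -> (0 < kind c)%N -> -1 <= x < (wd c)%:Z - 1 ->
  cell c (x, (tp c)%:Z - 1).
Proof.
elim: c => [|c IH k|c IH k|c IH k] /=.
- by move=> _ _; rewrite siteE /=; lia.
- by case/and3P => vc k0 kw ? h; apply/orP; left; lia.
- case/and4P => vc kc k0 kw _ h; have [*] := valid_dims vc.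
  have [e|ne] := eqVneq x ((wd c)%:Z - 1); first by apply/orP; left; lia.
  by rewrite IH ?orbT//; lia.
- case/and4P => vc kc k0 kw _ h; have [*] := valid_dims vc.
  by rewrite IH ?orbT//; lia.
Qed.

Lemma cell_right c y : valid c -> (1 < kind c)%N -> bt c <= y < (tp c)%:Z ->
  cell c ((wd c)%:Z - 2, y).
Proof.
elim: c => [|c IH k|c IH k|c IH k] //=.
- by move=> _ ?; lia.
- case/and4P => vc kc k0 kw ?; rewrite /bt /= => h; have [*] := valid_dims vc.
  by apply/orP; left; lia.
- case/and4P => vc kc k0 kw _; rewrite {1}/bt /= => h; have [*] := valid_dims vc.
  have [e|ne] := eqVneq y (bt c - 1); first by apply/orP; left; lia.
  by rewrite IH ?orbT//; move: ne h; rewrite /bt; lia.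
Qed.

(** * Crossing numbers of coded polygons *)

Section ChainFull.
Variable f : site -> site -> int.
Hypothesis fseg : forall p p', aligned p p' -> chain f p (seg p p') = f p p'.
Let ch w := chain f (0, 0) w.

Lemma chain_walk_seg w p p' : endpoint w = p -> aligned p p' ->
  ch (w ++ seg p p') = ch w + f p p'.
Proof. by move=> e al; rewrite /ch chain_cat -fseg// -e. Qed.

Lemma chain_walkT c : valid c ->
  ch (walkT c) = ch (walkR c) + f (endR c) (endT c).
Proof. by move=> vc; rewrite chain_walk_seg ?walkR_end ?aligned_RT. Qed.

Lemma chain_walkR c : valid c ->
  ch (walkR c) = ch (walkB c) + f (endB c) (endR c).
Proof. by move=> vc; rewrite chain_walk_seg ?walkB_end ?aligned_BR. Qed.

Lemma chain_full c : valid c -> ch (rcons (full c) (0, 0)) =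
  ch (walkT c) + f (endT c) (-1, (tp c)%:Z) + f (-1, (tp c)%:Z) (-1, 0)
  + f (-1, 0) (0, 0).
Proof.
move=> vc; have al1 : aligned (endT c) (-1, (tp c)%:Z).
  by rewrite /aligned endT2 eqxx orbT.
have al2 : aligned (-1, (tp c)%:Z) (-1, 0) by rewrite /aligned eqxx.
rewrite /ch chain_rcons -/(endpoint _).
have [_ _ ->] := prudent_full vc; rewrite -/(ch _) /full.
rewrite chain_walk_seg//; last exact: endpoint_cat (walkT_end vc) al1.
by rewrite chain_walk_seg//; exact: walkT_end.
Qed.
End ChainFull.

Lemma cell_Top c k a : cell (Top c k) a =
  (a.2 == tp c) && (-1 <= a.1 < k%:Z - 1) || cell c a.
Proof. by []. Qed.

Lemma cell_Right c k a : cell (Right c k) a =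
  (a.1 == (wd c)%:Z - 1) && ((tp c)%:Z - k%:Z <= a.2 < (tp c)%:Z) || cell c a.
Proof. by []. Qed.

Lemma cell_Bottom c k a : cell (Bottom c k) a =
  (a.2 == bt c - 1) && ((wd c)%:Z - 1 - k%:Z <= a.1 < (wd c)%:Z - 1) || cell c a.
Proof. by []. Qed.

Lemma cell_boxb c x y : valid c -> cell c (x, y) ==>
  [&& -1 <= x, x < (wd c)%:Z - 1, bt c <= y & y < (tp c)%:Z].
Proof. by move=> vc; apply/implyP => /(cell_box vc) /=; lia. Qed.

Lemma crossV_along (x y : int) (p p' : site) : p.1 = p'.1 ->
  crossV x y p p' = ((p.1 == x) && (p.2 <= y))%:Z
    - ((p.1 == x) && (p'.2 <= y))%:Z.
Proof. by rewrite /crossV => _; case: eqP. Qed.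

Lemma crossV_across (x y : int) (p p' : site) : p.2 = p'.2 ->
  crossV x y p p' = 0.
Proof. by rewrite /crossV => ->; rewrite subrr if_same. Qed.

Ltac crossV_simp :=
  repeat match goal with
  | |- context [crossV ?x ?y ?p ?p'] =>
    first [ rewrite (@crossV_across x y p p'); [|rewrite /=; lia]
          | rewrite (@crossV_along x y p p'); [|rewrite /=; lia] ]
  end.

Lemma chain_fullV c x y : valid c ->
  chain (crossV x y) (0, 0) (rcons (full c) (0, 0)) = 
  (cell c (x - 1, y))%:Z - (cell c (x, y))%:Z.
Proof.
have fs := @chain_segV x y.
elim: c => [|c IH k|c IH k|c IH k] vc.
- rewrite (chain_full fs)// (chain_walkT fs)// (chain_walkR fs)//.
  by rewrite /crossV /= !siteE /=; do ?[case: ifP => ? /=]; lia.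
- have /= /and3P[vc0 k0 kw] := vc; have [w0 t0 th0 _] := valid_dims vc0.
  (* The box of [c] shows that the cells of the added row are not already cells of [c], so that no
     indicator is counted twice. *)
  have := cell_boxb x y vc0; have := cell_boxb (x - 1) y vc0.
  move: (IH vc0); rewrite !(chain_full fs)// [in X in _ -> X](chain_walkT fs)//.
  rewrite (chain_walkR fs (c := Top c k))// walkB_Top.
  (* The chain of the common part becomes an unknown [P], which the induction hypothesis
     eliminates. *)
  move: (endT2 c) (chain _ _ (walkT c)) => /= eT P.
  case: (endT c) eT => a b /= eT; rewrite {fs IH vc vc0}/bt.
  crossV_simp; case: (cell c _); case: (cell c _) => /=; rewrite ?orbT ?orbF;
  by do ?[case: (_ =P x) => ? /=]; lia.
- have /= /and4P[vc0 kc k0 kw] := vc; have [w0 t0 th0 _] := valid_dims vc0.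
  have := cell_boxb x y vc0; have := cell_boxb (x - 1) y vc0.
  move: (IH vc0); rewrite !(chain_full fs)// !(chain_walkT fs)//.
  rewrite (chain_walkR fs (c := Right c k))// -/(walkR c).
  have eR := endR1 vc0 kc.
  rewrite (chain_walk_seg fs (walkR_end vc0)); last by rewrite /aligned eR eqxx.
  move: (endT2 c) (endT1 vc0 kc) (chain _ _ (walkR c)) eR => /= eT eT1 P.
  case: (endT c) eT eT1 => a b /= -> ->; case: (endR c) => a' b' /= -> {a b a'}.
  rewrite {fs IH vc vc0}/bt.
  (* [tp] is unchanged here, so the final run south and the closing edge are the same before and
     after, and can stay opaque. *)
  move: (crossV x y (-1, 0) _) (crossV x y (-1, _) _) => C1 C2.
  crossV_simp; case: (cell c _); case: (cell c _) => /=; rewrite ?orbT ?orbF;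
  by do ?[case: (_ =P x) => ? /=]; lia.
- have /= /and4P[vc0 kc k0 kw] := vc; have [w0 t0 th0 _] := valid_dims vc0.
  have := cell_boxb x y vc0; have := cell_boxb (x - 1) y vc0.
  move: (IH vc0); rewrite !(chain_full fs)// !(chain_walkT fs)// !(chain_walkR fs)//.
  have kc' := ltnW kc; have eB := endB2 vc0 kc.
  have al : aligned (endB c) ((wd c)%:Z - 1 - k%:Z, bt c).
    by rewrite /aligned eB eqxx orbT.
  rewrite (chain_walk_seg fs (endpoint_cat (walkB_end vc0) al)); last first.
    by rewrite /aligned eqxx.
  rewrite (chain_walk_seg fs (walkB_end vc0) al).
  move: (endR2 vc0 kc) (endT2 c) (endT1 vc0 kc') (endR1 vc0 kc').
  move: (chain _ _ (walkB c)) eB {al} => P /=.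
  case: (endT c) => a b; case: (endR c) => a' b'; case: (endB c) => a1 b1 /=.
  rewrite {fs IH vc vc0}/bt => -> -> -> -> -> {a b a' b' b1}.
  move: (crossV x y (-1, 0) _) (crossV x y (-1, _) _) => C1 C2.
  move: (crossV x y (_, (tp c)%:Z) (-1, _)) => C3.
  crossV_simp; case: (cell c _); case: (cell c _) => /=; rewrite ?orbT ?orbF;
  by do ?[case: (_ =P x) => ? /=]; lia.
Qed.

Lemma crossH_along (x y : int) (p p' : site) : p.2 = p'.2 ->
  crossH x y p p' = ((p.2 == y) && (p.1 <= x))%:Z
    - ((p.2 == y) && (p'.1 <= x))%:Z.
Proof. by rewrite /crossH => _; case: eqP. Qed.

Lemma crossH_across (x y : int) (p p' : site) : p.1 = p'.1 ->
  crossH x y p p' = 0.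
Proof. by rewrite /crossH => ->; rewrite subrr if_same. Qed.

Ltac crossH_simp :=
  repeat match goal with
  | |- context [crossH ?x ?y ?p ?p'] =>
    first [ rewrite (@crossH_across x y p p'); [|rewrite /=; lia]
          | rewrite (@crossH_along x y p p'); [|rewrite /=; lia] ]
  end.

Lemma chain_fullH c x y : valid c ->
  chain (crossH x y) (0, 0) (rcons (full c) (0, 0)) = 
  (cell c (x, y))%:Z - (cell c (x, y - 1))%:Z.
Proof.
have fs := @chain_segH x y.
elim: c => [|c IH k|c IH k|c IH k] vc.
- rewrite (chain_full fs)// (chain_walkT fs)// (chain_walkR fs)//.
  by rewrite /crossH /= !siteE /=; do ?[case: ifP => ? /=]; lia.
- have /= /and3P[vc0 k0 kw] := vc; have [w0 t0 th0 _] := valid_dims vc0.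
  have := cell_boxb x y vc0; have := cell_boxb x (y - 1) vc0.
  move: (IH vc0); rewrite !(chain_full fs)// [in X in _ -> X](chain_walkT fs)//.
  rewrite (chain_walkR fs (c := Top c k))// walkB_Top.
  move: (endT2 c) (chain _ _ (walkT c)) => /= eT P.
  case: (endT c) eT => a b /= eT; rewrite {fs IH vc vc0}/bt.
  crossH_simp; case: (cell c _); case: (cell c _) => /=; rewrite ?orbT ?orbF;
  by do ?[case: (_ =P y) => ? /=]; lia.
- have /= /and4P[vc0 kc k0 kw] := vc; have [w0 t0 th0 _] := valid_dims vc0.
  have := cell_boxb x y vc0; have := cell_boxb x (y - 1) vc0.
  move: (IH vc0); rewrite !(chain_full fs)// !(chain_walkT fs)//.
  rewrite (chain_walkR fs (c := Right c k))// -/(walkR c).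
  have eR := endR1 vc0 kc.
  rewrite (chain_walk_seg fs (walkR_end vc0)); last by rewrite /aligned eR eqxx.
  move: (endT2 c) (endT1 vc0 kc) (chain _ _ (walkR c)) eR => /= eT eT1 P.
  case: (endT c) eT eT1 => a b /= -> ->; case: (endR c) => a' b' /= -> {a b a'}.
  rewrite {fs IH vc vc0}/bt.
  move: (crossH x y (-1, 0) _) (crossH x y (-1, _) _) => C1 C2.
  crossH_simp; case: (cell c _); case: (cell c _) => /=; rewrite ?orbT ?orbF;
  by do ?[case: (_ =P y) => ? /=]; lia.
- have /= /and4P[vc0 kc k0 kw] := vc; have [w0 t0 th0 _] := valid_dims vc0.
  have := cell_boxb x y vc0; have := cell_boxb x (y - 1) vc0.
  move: (IH vc0); rewrite !(chain_full fs)// !(chain_walkT fs)// !(chain_walkR fs)//.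
  have kc' := ltnW kc; have eB := endB2 vc0 kc.
  have al : aligned (endB c) ((wd c)%:Z - 1 - k%:Z, bt c).
    by rewrite /aligned eB eqxx orbT.
  rewrite (chain_walk_seg fs (endpoint_cat (walkB_end vc0) al)); last first.
    by rewrite /aligned eqxx.
  rewrite (chain_walk_seg fs (walkB_end vc0) al).
  move: (endR2 vc0 kc) (endT2 c) (endT1 vc0 kc') (endR1 vc0 kc').
  move: (chain _ _ (walkB c)) eB {al} => P /=.
  case: (endT c) => a b; case: (endR c) => a' b'; case: (endB c) => a1 b1 /=.
  rewrite {fs IH vc vc0}/bt => -> -> -> -> -> {a b a' b' b1}.
  move: (crossH x y (-1, 0) _) (crossH x y (-1, _) _) => C1 C2.
  move: (crossH x y (_, (tp c)%:Z) (-1, _)) => C3.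
  crossH_simp; case: (cell c _); case: (cell c _) => /=; rewrite ?orbT ?orbF;
  by do ?[case: (_ =P y) => ? /=]; lia.
Qed.

(** * Escape paths *)

Inductive leaves (P E : pred site) : site -> Prop :=
| leaves_exit a of E a : leaves P E a
| leaves_step a b of P a & adjacent a b & leaves P E b : leaves P E a.

Lemma leaves_sub (P P' E E' : pred site) a : (forall a, P a -> P' a) ->
  (forall a, E a -> leaves P' E' a) -> leaves P E a -> leaves P' E' a.
Proof.
move=> PP EE; elim=> [b /EE//|b d /PP Pb adj _ IH].
exact: leaves_step IH.
Qed.

Lemma leaves_line (P E : pred site) (f : nat -> site) n :
  (forall i, adjacent (f i) (f i.+1)) -> (forall i, (i < n)%N -> P (f i)) ->
  E (f n) -> leaves P E (f 0%N).
Proof.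
elim: n f => [|n IH] f adj Pf Ef; first exact: leaves_exit.
apply: leaves_step (Pf 0%N isT) (adj 0%N) _.
by apply: (IH (f \o succn)) => [i|i lt|]; rewrite /=; [exact: adj|exact: Pf|exact: Ef].
Qed.

Definition line (a d : site) (i : nat) : site := (a.1 + d.1 * i%:Z, a.2 + d.2 * i%:Z).

Lemma line0 a d : line a d 0 = a.
Proof. by rewrite /line !mulr0 !addr0; case: a. Qed.

Lemma adjacent_line a d i : d \in [:: (1, 0); (0, 1); (-1, 0); (0, -1)] ->
  adjacent (line a d i) (line a d i.+1).
Proof.
rewrite adjacentE /dist /line !inE !siteE; case: d => x y /=.
by case/or4P => /andP[/eqP -> /eqP ->]; lia.
Qed.

Lemma line_inj a d : d \in [:: (1, 0); (0, 1); (-1, 0); (0, -1)] ->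
  injective (line a d).
Proof.
rewrite !inE !siteE /line; case: d => x y /=.
by case/or4P => /andP[/eqP -> /eqP ->] i j e; move: (congr1 fst e) (congr1 snd e) => /=; lia.
Qed.

(* The free cells of the bounding box, and the cells just outside of it through
   which the former can be left, depending on the kind of the code: in a spiral
   of inflating steps the top side has always been closed last. *)
Definition hole c (a : site) :=
  [&& -1 <= a.1 < (wd c)%:Z - 1, bt c <= a.2 < (tp c)%:Z & ~~ cell c a].
Definition exit c (a : site) :=
  [|| a.1 == -2,
      [&& (kind c <= 1)%N, a.2 == bt c - 1 & -1 <= a.1 < (wd c)%:Z - 1] |
      [&& (kind c == 0)%N, a.1 == (wd c)%:Z - 1 & bt c <= a.2 < (tp c)%:Z]].

Lemma leaves_left (P E : pred site) (x y : int) : -2 <= x ->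
  (forall z, -1 <= z <= x -> P (z, y)) -> E (-2, y) -> leaves P E (x, y).
Proof.
move=> x2 Pz Ez; rewrite -[(x, y)](line0 _ (-1, 0)).
apply: (@leaves_line _ _ (line (x, y) (-1, 0)) (absz (x + 2))).
- by move=> i; exact: adjacent_line.
- by move=> i ix; rewrite /line /= mul0r addr0; apply: Pz; lia.
- by rewrite /line /= mul0r addr0 (_ : x + _ = -2)//; lia.
Qed.

Lemma leaves_right (P E : pred site) (x y w : int) : x <= w ->
  (forall z, x <= z < w -> P (z, y)) -> E (w, y) -> leaves P E (x, y).
Proof.
move=> xw Pz Ez; rewrite -[(x, y)](line0 _ (1, 0)).
apply: (@leaves_line _ _ (line (x, y) (1, 0)) (absz (w - x))).
- by move=> i; exact: adjacent_line.
- by move=> i ix; rewrite /line /= mul0r addr0; apply: Pz; lia.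
- by rewrite /line /= mul0r addr0 (_ : x + _ = w)//; lia.
Qed.

Lemma leaves_down (P E : pred site) (x y b : int) : b <= y ->
  (forall z, b < z <= y -> P (x, z)) -> E (x, b) -> leaves P E (x, y).
Proof.
move=> yb Pz Ez; rewrite -[(x, y)](line0 _ (0, -1)).
apply: (@leaves_line _ _ (line (x, y) (0, -1)) (absz (y - b))).
- by move=> i; exact: adjacent_line.
- by move=> i ix; rewrite /line /= mul0r addr0; apply: Pz; lia.
- by rewrite /line /= mul0r addr0 (_ : y + _ = b)//; lia.
Qed.

Lemma cell_boxN c (x y : int) : valid c ->
  ~~ [&& -1 <= x, x < (wd c)%:Z - 1, bt c <= y & y < (tp c)%:Z] ->
  cell c (x, y) = false.
Proof. by move=> vc; apply: contraNF => /(cell_box vc) /=; lia. Qed.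

(** Holes of the old box keep their way to an old exit. An operation that closes a side swallows old
    exits into the new box; from there the way goes on along the new strip to a side that is still
    open. *)
Lemma hole_leaves c a : valid c -> hole c a -> leaves (hole c) (exit c) a.
Proof.
elim: c a => [|c IH k|c IH k|c IH k] [x y] vc.
- by rewrite /hole /= siteE /= /bt /=; lia.
- have /= /and3P[vc0 k0 kw] := vc; have [w0 t0 th0 _] := valid_dims vc0.
  have Hh b : hole c b -> hole (Top c k) b.
    by case: b => x' y'; rewrite /hole /= /bt /=; case: (cell c _); lia.
  (* An exit is lost only on the right side, when the row has [wd c + 1] cells; the way out then
     goes down the new column. *)
  have He (b : site) : exit c b -> leaves (hole (Top c k)) (exit (Top c k)) b.
    case: b => x' y' eb; have [ex|nex] := boolP (exit (Top c k) (x', y')).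
      exact: leaves_exit.
    move: eb nex; rewrite /exit /= /bt /= => eb nex.
    apply: (@leaves_down _ _ _ _ (bt c - 1)).
    + by rewrite /bt; lia.
    + move=> z zy; rewrite /hole /= cell_boxN//; rewrite /bt /= in zy *; lia.
    + by rewrite /exit /= /bt /=; lia.
  move=> h; have [hc|nhc] := boolP (hole c (x, y)).
    by apply: leaves_sub (IH _ vc0 hc).
  have [xw|xw] := eqVneq x ((wd c)%:Z - 1).
    apply: (@leaves_down _ _ _ _ (bt c - 1)); move: h nhc; rewrite /hole /exit /= /bt /=.
    + by case: (cell c _) => /=; lia.
    + move=> h nhc z zx; rewrite cell_boxN//; rewrite /bt /=; case: (cell c _) h nhc => /=; lia.
    + by case: (cell c _) => /=; lia.
  apply: (@leaves_right _ _ _ _ ((wd c)%:Z - 1)); move: h nhc; rewrite /hole /exit /= /bt /=.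
  + by case: (cell c _) => /=; lia.
  + move=> h nhc z zx; rewrite cell_boxN//; rewrite /bt /=; case: (cell c _) h nhc => /=; lia.
  + by case: (cell c _) => /=; lia.
- have /= /and4P[vc0 kc k0 kw] := vc; have [w0 t0 th0 _] := valid_dims vc0.
  have Hh b : hole c b -> hole (Right c k) b.
    by case: b => x' y'; rewrite /hole /= /bt /=; case: (cell c _); lia.
  (* An exit is lost only below the box, when the column has [ht c + 1] cells; the way out then goes
     left along the new bottom row. *)
  have He (b : site) : exit c b -> leaves (hole (Right c k)) (exit (Right c k)) b.
    case: b => x' y' eb; have [ex|nex] := boolP (exit (Right c k) (x', y')).
      exact: leaves_exit.
    move: eb nex; rewrite /exit /= /bt /= => eb nex.
    apply: leaves_left.
    + by lia.
    + move=> z zy; rewrite /hole /= cell_boxN//; rewrite /bt /=; lia.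
    + by rewrite /exit /= /bt /=; lia.
  move=> h; have [hc|nhc] := boolP (hole c (x, y)).
    by apply: leaves_sub (IH _ vc0 hc).
  have [xw|xw] := eqVneq x ((wd c)%:Z - 1).
    apply: (@leaves_down _ _ _ _ (bt c - 1)); move: h nhc; rewrite /hole /exit /= /bt /=.
    + by case: (cell c _) => /=; lia.
    + move=> h nhc z zx; rewrite cell_boxN//; rewrite /bt /=; case: (cell c _) h nhc => /=; lia.
    + by case: (cell c _) => /=; lia.
  apply: leaves_left; move: h nhc; rewrite /hole /exit /= /bt /=.
  + by case: (cell c _) => /=; lia.
  + move=> h nhc z zx; rewrite cell_boxN//; rewrite /bt /=; case: (cell c _) h nhc => /=; lia.
  + by case: (cell c _) => /=; lia.
- have /= /and4P[vc0 kc k0 kw] := vc; have [w0 t0 th0 _] := valid_dims vc0.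
  have Hh b : hole c b -> hole (Bottom c k) b.
    by case: b => x' y'; rewrite /hole /= /bt /=; case: (cell c _); lia.
  (* At kind 2 the left side is the only way out, and a bottom row does not close it. *)
  have He (b : site) : exit c b -> leaves (hole (Bottom c k)) (exit (Bottom c k)) b.
    by move=> eb; apply: leaves_exit; move: eb; rewrite /exit /=; lia.
  move=> h; have [hc|nhc] := boolP (hole c (x, y)).
    by apply: leaves_sub (IH _ vc0 hc).
  apply: leaves_left; move: h nhc; rewrite /hole /exit /= /bt /=.
  + by case: (cell c _) => /=; lia.
  + move=> h nhc z zx; rewrite cell_boxN//; rewrite /bt /=; case: (cell c _) h nhc => /=; lia.
  + by case: (cell c _) => /=; lia.
Qed.

Lemma linked_leaves (P E Q : pred site) a : (forall b, P b -> Q b) ->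
  (forall b, E b -> Q b) -> leaves P E a -> exists2 b, linked Q a b & E b.
Proof.
move=> PQ EQ; elim=> [b Eb|b d Pb adj h [e le Ee]].
  by exists b => //; exact: linked_refl.
exists e => //; apply: linked_trans le; apply: linked_step => //.
by case: h => [? /EQ|? ? /PQ].
Qed.

Lemma cell_out c (a : site) : valid c ->
  ~~ [&& -1 <= a.1 < (wd c)%:Z - 1 & bt c <= a.2 < (tp c)%:Z] -> exists d,
  d \in [:: (1, 0); (0, 1); (-1, 0); (0, -1)] /\ forall n, ~~ cell c (line a d n).
Proof.
case: a => x y vc /= out.
have [lx|lx] := ltP x (-1).
  exists (-1, 0); split=> // n; rewrite /line /= cell_boxN//; lia.
have [rx|rx] := leP ((wd c)%:Z - 1) x.
  exists (1, 0); split=> // n; rewrite /line /= cell_boxN//; lia.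
have [by_|by_] := ltP y (bt c).
  exists (0, -1); split=> // n; rewrite /line /= cell_boxN//; lia.
exists (0, 1); split=> // n; rewrite /line /= cell_boxN//; lia.
Qed.

Lemma exit_out c (a : site) : exit c a ->
  ~~ [&& -1 <= a.1 < (wd c)%:Z - 1 & bt c <= a.2 < (tp c)%:Z].
Proof. by case: a => x y; rewrite /exit /=; lia. Qed.

(** * The polygon of a code *)

Section FullWalk.
Variable c : code.
Hypothesis vc : valid c.

Let pF : prudent (full c). Proof. by case: (prudent_full vc). Qed.
Let wF : is_walk (full c). Proof. by case: pF. Qed.
Let uF : uniq (sites (full c)). Proof. by case: pF. Qed.
Let sF : (1 < size (full c))%N. Proof. by case: (prudent_full vc). Qed.
Let eF : endpoint (full c) = (-1, 0). Proof. by case: (prudent_full vc). Qed.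
Let aF : adjacent (endpoint (full c)) (0, 0). Proof. by rewrite eF. Qed.

Lemma prudent_polygon_full : prudent_polygon (full c).
Proof. by split. Qed.

Lemma enclosed_full : enclosed (full c) = [set` cells c].
Proof.
apply: enclosedE => [a b|a].
  rewrite !mem_cells (communicatingE (A := cell c) wF uF sF aF)//.
    by move=> x y; exact: chain_fullV.
  by move=> x y; exact: chain_fullH.
rewrite mem_cells => na.
suff [b [lb outb]] : exists b, linked (fun d => d \notin cells c) a b /\
    ~~ [&& -1 <= b.1 < (wd c)%:Z - 1 & bt c <= b.2 < (tp c)%:Z].
  have [d [dd nd]] := cell_out vc outb; exists b, (line b d); split=> //.
  - exact: line0.
  - exact: line_inj.
  - by move=> n; exact: adjacent_line.
  - by move=> n; rewrite mem_cells.
have [ina|outa] := boolP [&& -1 <= a.1 < (wd c)%:Z - 1 & bt c <= a.2 < (tp c)%:Z]; last first.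
  by exists a; split=> //; exact: linked_refl.
have ha : hole c a by move: ina; rewrite /hole na; case: a {na} => x y /=; lia.
have hQ b : hole c b -> b \notin cells c by rewrite mem_cells => /and3P[].
have eQ b : exit c b -> b \notin cells c.
  by move=> /exit_out; rewrite mem_cells; apply: contra => /(cell_box vc).
have [b lb eb] := linked_leaves (Q := fun d => d \notin cells c) hQ eQ (hole_leaves vc ha).
by exists b; split=> //; exact: exit_out eb.
Qed.

Lemma counterclockwise_full : counterclockwise (full c).
Proof.
move=> p /(edge_cells_in wF uF sF aF (A := cell c)) [||].
- by move=> x y; exact: chain_fullV.
- by move=> x y; exact: chain_fullH.
- by rewrite enclosed_full /= mem_cells.
Qed.

Lemma base_class_full : base_class (full c).
Proof.
split; [exact: prudent_polygon_full|exact: eF|exact: counterclockwise_full].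
Qed.
End FullWalk.

(** * Area, width, height and connectedness *)

Lemma card_seq (T : choiceType) (s : seq T) : uniq s -> Defs.card [set` s] = size s.
Proof.
move=> us; rewrite /Defs.card (_ : [set` s] = [set` [fset x in s]%fset]).
  by rewrite set_fsetK card_fseq undup_id.
by apply/seteqP; split=> x /=; rewrite inE.
Qed.

Lemma area_full c : valid c -> area (full c) = ar c.
Proof. by move=> vc; rewrite /area enclosed_full// card_seq ?size_cells// uniq_cells. Qed.

Lemma card_interval (m : int) n : Defs.card [set x : int | m <= x < m + n%:Z] = n.
Proof.
rewrite (_ : [set x | _] = [set` [seq m + i%:Z | i <- iota 0 n]]).
  rewrite card_seq ?size_map ?size_iota// map_inj_in_uniq ?iota_uniq// => i j _ _; lia.
apply/seteqP; split=> x /=.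
  by move=> h; apply/mapP; exists (absz (x - m)%R); rewrite ?mem_iota; lia.
by case/mapP => i; rewrite mem_iota => ? ->; lia.
Qed.

Lemma finite_interval (m : int) n : finite_set [set x : int | m <= x < m + n%:Z].
Proof.
apply: sub_finite_set (finite_seq [seq m + i%:Z | i <- iota 0 n]) => x /= h.
by apply/mapP; exists (absz (x - m)%R); rewrite ?mem_iota; lia.
Qed.

Lemma cell_bottom c : valid c -> exists x, cell c (x, bt c).
Proof.
elim: c => [|c IH k|c IH k|c IH k] /=; rewrite /bt /=.
- by move=> _; exists (-1).
- case/and3P => vc k0 kw; have [x] := IH vc; rewrite /bt => cx; exists x.
  by rewrite (_ : (tp c).+1%:Z - _ = (tp c)%:Z - (ht c)%:Z) ?cx ?orbT//; lia.
- case/and4P => vc kc k0 kw; have [e|ne] := leqP k (ht c).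
    have [x cx] := IH vc; exists x.
    by rewrite -/(bt c) cx orbT.
  by exists ((wd c)%:Z - 1); apply/orP; left; lia.
- case/and4P => vc kc k0 kw; exists ((wd c)%:Z - 2); apply/orP; left; lia.
Qed.

Lemma cell_rightmost c : valid c -> exists y, cell c ((wd c)%:Z - 2, y).
Proof.
elim: c => [|c IH k|c IH k|c IH k] /=.
- by move=> _; exists 0.
- case/and3P => vc k0 kw; have [e|ne] := leqP k (wd c).
    by have [y cy] := IH vc; exists y; rewrite cy orbT.
  by exists (tp c); apply/orP; left; lia.
- by case/and4P => vc kc k0 kw; exists ((tp c)%:Z - 1); apply/orP; left; lia.
- by case/and4P => vc kc k0 kw; have [y cy] := IH vc; exists y; rewrite cy orbT.
Qed.

Lemma columns_cells c : valid c ->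
  columns [set` cells c] = [set x | -1 <= x < -1 + (wd c)%:Z].
Proof.
move=> vc; apply/seteqP; split=> x /=.
  case=> a [b [/=]]; rewrite !mem_cells => /(cell_box vc) + /(cell_box vc).
  by case: a b => a1 a2 [b1 b2] /=; lia.
have [y cy] := cell_rightmost vc; have [w0 t0 th0 _] := valid_dims vc => h.
exists (-1, 0), ((wd c)%:Z - 2, y); rewrite /= !mem_cells; split=> //=; last lia.
by rewrite cell_left//; lia.
Qed.

Lemma rows_cells c : valid c ->
  rows [set` cells c] = [set y | bt c <= y < bt c + (ht c)%:Z].
Proof.
move=> vc; apply/seteqP; split=> x /=.
  case=> a [b [/=]]; rewrite !mem_cells => /(cell_box vc) + /(cell_box vc).
  by case: a b => a1 a2 [b1 b2] /=; rewrite /bt; lia.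
have [y cy] := cell_bottom vc; have [w0 t0 th0 _] := valid_dims vc => h.
exists (y, bt c), (-1, (tp c)%:Z - 1); rewrite /= !mem_cells; split=> //=.
  by rewrite cell_left//; lia.
by move: h; rewrite /bt; lia.
Qed.

Lemma width_cells c : valid c -> width [set` cells c] = wd c.
Proof. by move=> vc; rewrite /width columns_cells// card_interval. Qed.

Lemma height_cells c : valid c -> height [set` cells c] = ht c.
Proof. by move=> vc; rewrite /height rows_cells// card_interval. Qed.

Lemma linked_line (P : pred site) (f : nat -> site) n :
  (forall i, adjacent (f i) (f i.+1)) -> (forall i, (i < n)%N -> P (f i.+1)) ->
  linked P (f 0%N) (f n).
Proof.
move=> adj Pf; elim: n Pf => [|n IH] Pf; first exact: linked_refl.
apply: linked_trans (IH _) _ => [i ni|]; first exact/Pf/ltnW.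
by apply: linked_step; rewrite // Pf.
Qed.

Lemma cells_linked c a : valid c -> cell c a -> linked (cell c) a (-1, 0).
Proof.
have lineto (P : pred site) (d p p' : site) n :
    d \in [:: (1, 0); (0, 1); (-1, 0); (0, -1)] -> line p d n = p' ->
    (forall i, (i <= n)%N -> P (line p d i)) -> linked P p p'.
  move=> dd <- Pl; rewrite -[X in linked _ X](line0 p d).
  apply: linked_line => [i|i ni]; first exact: adjacent_line.
  exact: Pl.
elim: c a => [|c IH k|c IH k|c IH k] [x y] vc.
- by move=> /eqP ->; exact: linked_refl.
- have /= /and3P[vc0 k0 kw] := vc; have [w0 t0 th0 _] := valid_dims vc0.
  have old b : cell c b -> linked (cell (Top c k)) b (-1, 0).
    by move=> /(IH _ vc0); apply: linked_sub => d; rewrite cell_Top orbC => ->.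
  case/orP => [h|]; last exact: old.
  have old1 : cell c (-1, (tp c)%:Z - 1) by rewrite cell_left//; lia.
  apply: linked_trans (old _ old1).
  apply: (@linked_trans _ _ (-1, (tp c)%:Z)); last first.
    by apply: linked_step; rewrite ?adjacentE ?cell_Top ?old1 ?orbT// /dist /=; lia.
  apply: (lineto _ (-1, 0) _ _ (absz (x + 1)%R)) => // [|i ix].
    by apply: siteP; rewrite /line /=; lia.
  by rewrite cell_Top /line /=; apply/orP; left; move: h => /=; lia.
- have /= /and4P[vc0 kc k0 kw] := vc; have [w0 t0 th0 _] := valid_dims vc0.
  have old b : cell c b -> linked (cell (Right c k)) b (-1, 0).
    by move=> /(IH _ vc0); apply: linked_sub => d; rewrite cell_Right orbC => ->.
  case/orP => [h|]; last exact: old.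
  have old1 : cell c ((wd c)%:Z - 2, (tp c)%:Z - 1) by apply: cell_top; lia.
  apply: linked_trans (old _ old1).
  apply: (@linked_trans _ _ ((wd c)%:Z - 1, (tp c)%:Z - 1)); last first.
    by apply: linked_step; rewrite ?adjacentE ?cell_Right ?old1 ?orbT// /dist /=; lia.
  apply: (lineto _ (0, 1) _ _ (absz ((tp c)%:Z - 1 - y)%R)) => // [|i ix].
    by apply: siteP; rewrite /line /=; move: h => /=; lia.
  by rewrite cell_Right /line /=; apply/orP; left; move: h => /=; lia.
- have /= /and4P[vc0 kc k0 kw] := vc; have [w0 t0 th0 _] := valid_dims vc0.
  have old b : cell c b -> linked (cell (Bottom c k)) b (-1, 0).
    by move=> /(IH _ vc0); apply: linked_sub => d; rewrite cell_Bottom orbC => ->.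
  case/orP => [h|]; last exact: old.
  have old1 : cell c ((wd c)%:Z - 2, bt c) by apply: cell_right => //; rewrite /bt; lia.
  apply: linked_trans (old _ old1).
  apply: (@linked_trans _ _ ((wd c)%:Z - 2, bt c - 1)); last first.
    by apply: linked_step; rewrite ?adjacentE ?cell_Bottom ?old1 ?orbT// /dist /=; lia.
  apply: (lineto _ (1, 0) _ _ (absz ((wd c)%:Z - 2 - x)%R)) => // [|i ix].
    by apply: siteP; rewrite /line /=; move: h => /=; lia.
  by rewrite cell_Bottom /line /=; apply/orP; left; move: h => /=; lia.
Qed.

Lemma connected_linked (P : pred site) (A : set site) : A = [set a | P a] ->
  connected A <-> (forall a b, P a -> P b -> linked P a b).
Proof.
move=> ->; split=> h a b Pa Pb.
  by have [s [ps ls Ps]] := h a b Pa Pb; exists s; split=> //; apply/allP.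
by have [s [ps ls /allP Ps]] := h a b Pa Pb; exists s.
Qed.

Lemma connected_cells c : valid c -> connected [set` cells c].
Proof.
move=> vc; apply/(@connected_linked (cell c)).
  by apply/seteqP; split=> a /=; rewrite mem_cells.
move=> a b ca cb; apply: linked_trans (cells_linked vc ca) _.
by apply: linked_sym => //; exact: cells_linked.
Qed.

(** * Reading the class off the code *)

Definition below_top c := [set` cells c] `\` top_row [set` cells c].
Definition before_right c := [set` cells c] `\` right_column [set` cells c].

Lemma below_topE c : valid c ->
  below_top c = [set a | cell c a && (a.2 < (tp c)%:Z - 1)].
Proof.
move=> vc; have [w0 t0 th0 _] := valid_dims vc.
have top1 : cell c (-1, (tp c)%:Z - 1) by rewrite cell_left//; lia.
apply/seteqP; split=> -[x y]; rewrite /below_top /top_row /= mem_cells.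
  case=> cxy nt; rewrite cxy /= ltNge; apply/negP => le; apply: nt; split=> // -[a b].
  by rewrite mem_cells => /(cell_box vc) /=; lia.
case/andP => -> lt; split=> // -[_ /(_ (-1, (tp c)%:Z - 1))].
by rewrite mem_cells => /(_ top1) /=; lia.
Qed.

Lemma before_rightE c : valid c ->
  before_right c = [set a | cell c a && (a.1 < (wd c)%:Z - 2)].
Proof.
move=> vc; have [y0 top1] := cell_rightmost vc.
apply/seteqP; split=> -[x y]; rewrite /before_right /right_column /= mem_cells.
  case=> cxy nt; rewrite cxy /= ltNge; apply/negP => le; apply: nt; split=> // -[a b].
  by rewrite mem_cells => /(cell_box vc) /=; lia.
case/andP => -> lt; split=> // -[_ /(_ ((wd c)%:Z - 2, y0))].
by rewrite mem_cells => /(_ top1) /=; lia.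
Qed.

Lemma columns_sub (A B : set site) : A `<=` B -> columns A `<=` columns B.
Proof. by move=> AB x [a [b [Aa Ab h]]]; exists a, b; split=> //; exact: AB. Qed.

Lemma rows_sub (A B : set site) : A `<=` B -> rows A `<=` rows B.
Proof. by move=> AB x [a [b [Aa Ab h]]]; exists a, b; split=> //; exact: AB. Qed.

Lemma card_sub_eq (T : choiceType) (A B : set T) : finite_set B -> A `<=` B ->
  Defs.card A = Defs.card B -> A = B.
Proof.
move=> fB AB cAB; have fA := sub_finite_set AB fB.
have e : fset_set A = fset_set B.
  apply/eqP; rewrite eqEfcard -[X in _ && (_ <= X)%N]/(Defs.card A) cAB leqnn andbT.
  by rewrite -fset_set_sub.
by rewrite -(fset_setK fA) e fset_setK.
Qed.

Lemma width_spans c (B : set site) : valid c -> B `<=` [set` cells c] ->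
  width B = wd c ->
  (exists2 a, B a & a.1 <= -1) /\ (exists2 a, B a & (wd c)%:Z - 2 <= a.1).
Proof.
move=> vc Bc wB; have [w0 t0 th0 _] := valid_dims vc.
have colB : columns B = [set x | -1 <= x < -1 + (wd c)%:Z].
  rewrite -columns_cells//; apply: card_sub_eq; last by rewrite -!/(width _) width_cells.
    by rewrite columns_cells//; exact: finite_interval.
  exact: columns_sub.
have : columns B (-1) by rewrite colB /=; lia.
case=> a [b [Ba Bb /andP[am _]]].
have : columns B ((wd c)%:Z - 2) by rewrite colB /=; lia.
by case=> a' [b' [Ba' Bb' /andP[_ bm]]]; split; [exists a|exists b'].
Qed.

Lemma height_spans c (B : set site) : valid c -> B `<=` [set` cells c] ->
  height B = ht c ->
  (exists2 a, B a & a.2 <= bt c) /\ (exists2 a, B a & (tp c)%:Z - 1 <= a.2).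
Proof.
move=> vc Bc wB; have [w0 t0 th0 _] := valid_dims vc.
have rowB : rows B = [set y | bt c <= y < bt c + (ht c)%:Z].
  rewrite -rows_cells//; apply: card_sub_eq; last by rewrite -!/(height _) height_cells.
    by rewrite rows_cells//; exact: finite_interval.
  exact: rows_sub.
have : rows B (bt c) by rewrite rowB /=; lia.
case=> a [b [Ba Bb /andP[am _]]].
have : rows B ((tp c)%:Z - 1) by rewrite rowB /bt /=; lia.
by case=> a' [b' [Ba' Bb' /andP[_ bm]]]; split; [exists a|exists b'].
Qed.

Lemma linked_closed (P S : pred site) a b :
  (forall d e, S d -> P e -> adjacent d e -> S e) -> S a -> linked P a b -> S b.
Proof.
move=> cl Sa [s [+ <- +]]; elim: s a Sa => [//|d s IH] a Sa /=.
by case/andP => adj ps /andP[Pd Ps]; apply: IH Ps => //; apply: cl adj.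
Qed.

(** [S] consists of the cells that were present before the last top row of [wd + 1] cells, and is
    empty if there was none. Below the top row it is never joined to the last column: right columns
    start too far to the right, and a bottom row comes only after a column that reaches below
    [S]. *)
Lemma top_cut c : valid c -> (0 < kind c)%N -> exists S : pred site, [/\
  forall a, S a -> [&& cell c a, a.1 <= (wd c)%:Z - 3, a.2 <= (tp c)%:Z - 2 &
     (1 < kind c)%N ==> (bt c < a.2)],
  forall y, cell c (-1, y) -> y <= (tp c)%:Z - 2 -> S (-1, y) &
  forall a b, S a -> cell c b -> b.2 <= (tp c)%:Z - 2 -> adjacent a b -> S b].
Proof.
elim: c => [|c IH k|c IH k|c IH k] vc kc'.
- by exists pred0; split=> // y /eqP[->].
- have /= /and3P[vc0 k0 kw] := vc; have [w0 t0 th0 _] := valid_dims vc0.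
  exists (cell c); split.
  + by move=> [x y] cxy; have /= := cell_box vc0 cxy; rewrite cxy; move: kc' => /=; lia.
  + by move=> y; rewrite /=; case: (cell c _); lia.
  + by move=> a [x y] _; rewrite /=; case: (cell c _); lia.
- have /= /and4P[vc0 kc k0 kw] := vc; have [w0 t0 th0 _] := valid_dims vc0.
  have [S [Sc Sl Scl]] := IH vc0 kc; exists S; split.
  + move=> [x y] /Sc /and4P[cxy /= ? ? ?]; rewrite cxy orbT /=.
    by have /= := cell_box vc0 cxy; rewrite /bt /=; lia.
  + by move=> y; rewrite /= => cy; apply: Sl; move: cy; case: (cell c _); lia.
  + move=> [x y] [x' y'] Sa cb /= le adj; apply: (Scl _ _ Sa _ _ adj) => //.
    have := Sc _ Sa; move: cb adj; rewrite ?cell_Right adjacentE /dist /=.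
    by case: (cell c (x', y')) => //=; lia.
- have /= /and4P[vc0 kc k0 kw] := vc; have [w0 t0 th0 _] := valid_dims vc0.
  have [S [Sc Sl Scl]] := IH vc0 (ltnW kc); exists S; split.
  + move=> [x y] /Sc /and4P[cxy /= ? ? ?]; rewrite cxy orbT /=.
    by have /= := cell_box vc0 cxy; rewrite /bt /=; lia.
  + by move=> y; rewrite /= => cy; apply: Sl; move: cy; case: (cell c _); lia.
  + move=> [x y] [x' y'] Sa cb /= le adj; apply: (Scl _ _ Sa _ _ adj) => //.
    have := Sc _ Sa; move: cb adj; rewrite ?cell_Bottom adjacentE /dist /= kc /=.
    by case: (cell c (x', y')) => //=; lia.
Qed.

(** The same cut for the right column: [S] consists of the cells present before the last column of
    [ht + 1] cells, and later bottom rows lie too low to touch it. *)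
Lemma right_cut c : valid c -> (1 < kind c)%N -> exists S : pred site, [/\
  forall a, S a -> [&& cell c a, a.1 <= (wd c)%:Z - 3 & bt c < a.2],
  forall x, cell c (x, (tp c)%:Z - 1) -> x <= (wd c)%:Z - 3 -> S (x, (tp c)%:Z - 1) &
  forall a b, S a -> cell c b -> b.1 <= (wd c)%:Z - 3 -> adjacent a b -> S b].
Proof.
elim: c => [|c IH k|c IH k|c IH k] vc kc' //.
- by move: kc' => /=; lia.
- have /= /and4P[vc0 kc k0 kw] := vc; have [w0 t0 th0 _] := valid_dims vc0.
  exists (cell c); split.
  + move=> [x y] cxy; have /= := cell_box vc0 cxy; rewrite cxy; move: kc' => /=.
    by rewrite /bt /=; lia.
  + by move=> x; rewrite /=; case: (cell c _); lia.
  + by move=> a [x y] _; rewrite /=; case: (cell c _); lia.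
- have /= /and4P[vc0 kc k0 kw] := vc; have [w0 t0 th0 _] := valid_dims vc0.
  have [S [Sc Sl Scl]] := IH vc0 kc; exists S; split.
  + move=> [x y] /Sc /and3P[cxy /= ? ?]; rewrite cxy orbT /=.
    by have /= := cell_box vc0 cxy; rewrite /bt /=; lia.
  + move=> x; rewrite /= => cy; apply: Sl; move: cy.
    by rewrite /bt; case: (cell c _); lia.
  + move=> [x y] [x' y'] Sa cb /= le adj; apply: (Scl _ _ Sa _ _ adj) => //.
    have := Sc _ Sa; move: cb adj; rewrite ?cell_Bottom adjacentE /dist /=.
    by case: (cell c (x', y')) => //=; lia.
Qed.

(** If the width survived, the remaining cells would join the first column to the last one; but
    their first column lies in [S], and [S] does not get to the last column. *)
Lemma not_classX_full c : valid c -> (0 < kind c)%N -> ~ classX (full c).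
Proof.
move=> vc kc; have [w0 t0 th0 _] := valid_dims vc.
rewrite /classX enclosed_full// -/(below_top c) width_cells// => -[_ [wB conB]].
have BE := below_topE vc.
have Bc : below_top c `<=` [set` cells c] by move=> a [].
have [[a Ba al] [b Bb br]] := width_spans vc Bc wB.
move/(connected_linked BE): conB => conB.
have [S [Sc Sl Scl]] := top_cut vc kc.
move: Ba Bb; rewrite BE /= => Ba Bb.
have Sa : S a.
  case: a Ba al => x y /= /andP[cxy yt] xl; have /= bx := cell_box vc cxy.
  have e : x = -1 by lia.
  by subst x; apply: Sl => //; lia.
have /Sc : S b.
  apply: linked_closed (conB a b Ba Bb) => // d e Sd /andP[ce le]; apply: Scl => //.
  by move: le; lia.
by case: b Bb br => x y /= *; lia.
Qed.

Lemma not_classY_full c : valid c -> (1 < kind c)%N -> ~ classY (full c).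
Proof.
move=> vc kc; have [w0 t0 th0 w1] := valid_dims vc; case.
  have e : unit_square = full Unit by [].
  rewrite e => /(congr1 enclosed); rewrite !enclosed_full// => /(congr1 width).
  by rewrite !width_cells// => w1'; move: (w1 kc); rewrite w1'.
rewrite enclosed_full//= -/(before_right c) height_cells// => -[_ _ [hB conB]].
have BE := before_rightE vc.
have Bc : before_right c `<=` [set` cells c] by move=> a [].
have [[b Bb bb] [a Ba at_]] := height_spans vc Bc hB.
move/(connected_linked BE): conB => conB.
have [S [Sc Sl Scl]] := right_cut vc kc.
move: Ba Bb; rewrite BE /= => Ba Bb.
have Sa : S a.
  case: a Ba at_ => x y /= /andP[cxy yt] xl; have /= bx := cell_box vc cxy.
  have e : y = (tp c)%:Z - 1 by lia.
  by subst y; apply: Sl => //; lia.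
have /Sc : S b.
  apply: linked_closed (conB a b Ba Bb) => // d e Sd /andP[ce le]; apply: Scl => //.
  by move: le; lia.
by case: b Bb bb => x y /= *; lia.
Qed.

Lemma below_top_Top c k : valid (Top c k) -> below_top (Top c k) = [set` cells c].
Proof.
move=> vc; have /= /and3P[vc0 k0 kw] := vc.
rewrite below_topE//; apply/seteqP; split=> -[x y]; rewrite /= mem_cells.
  by case: (cell c _) => //=; lia.
by move=> cxy; have /= := cell_box vc0 cxy; rewrite cxy orbT /=; lia.
Qed.

Lemma before_right_Right c k : valid (Right c k) ->
  before_right (Right c k) = [set` cells c].
Proof.
move=> vc; have /= /and4P[vc0 kc k0 kw] := vc.
rewrite before_rightE//; apply/seteqP; split=> -[x y]; rewrite /= mem_cells.
  by case: (cell c _) => //=; lia.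
by move=> cxy; have /= := cell_box vc0 cxy; rewrite cxy orbT /=; lia.
Qed.

(** A row of [wd + 1] cells overhangs by one cell, and this cell is the whole last column. *)
Lemma before_right_Top c : valid c ->
  before_right (Top c (wd c).+1) = [set` cells (Top c (wd c))].
Proof.
move=> vc; have [w0 t0 th0 w1] := valid_dims vc.
have -> : [set` cells (Top c (wd c))] = [set a | cell (Top c (wd c)) a].
  by apply/seteqP; split=> a; rewrite /mkset /= (mem_cells (Top c (wd c))).
rewrite before_rightE; last by rewrite /= vc /= leqnn.
apply/seteqP; split=> -[x y] /=; case cxy : (cell c (x, y)) => /=; try lia.
by have /= := cell_box vc cxy; lia.
Qed.

Lemma classX_full c : valid c -> kind c = 0%N -> classX (full c).
Proof.
move=> vc k0; split; first exact: base_class_full.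
rewrite enclosed_full//= -/(below_top c) width_cells//.
case: c vc k0 => [||c k|] //= c k vc k0; rewrite below_top_Top//.
have /and3P[vc0 _ _] := vc; rewrite width_cells//; split; last exact: connected_cells.
by move: k0; rewrite /= /maxn; case: ltnP.
Qed.

Lemma classY_full c : valid c -> kind c = 1%N -> classY (full c).
Proof.
move=> vc k1; have : c = Unit \/ c <> Unit by case: (c) => [|? ?|? ?|? ?]; by [left|right].
case=> [->|nU]; first by left.
right; split; [exact: base_class_full|by apply: not_classX_full; rewrite ?k1|].
rewrite enclosed_full//= -/(before_right c) height_cells//.
case: c vc k1 nU => [|c k|c k|c k] //= vc k1 _.
  have /and3P[vc0 k0 kw] := vc.
  have -> : k = (wd c).+1 by move: k1 kw; lia.
  rewrite before_right_Top//; have [w0 _ _ _] := valid_dims vc0.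
  have vc' : valid (Top c (wd c)) by rewrite /= vc0 w0 leqnSn.
  by rewrite height_cells//; split=> //; exact: connected_cells.
rewrite before_right_Right//; have /and4P[vc0 kc k0 kw] := vc.
rewrite height_cells//; split; last exact: connected_cells.
by move: k1; rewrite /= /maxn; case: ltnP.
Qed.

Lemma classXE c : valid c -> classX (full c) <-> kind c = 0%N.
Proof.
move=> vc; split; last exact: classX_full.
by case: (posnP (kind c)) => // kc /(not_classX_full vc kc).
Qed.

Lemma classYE c : valid c -> classY (full c) <-> kind c = 1%N.
Proof.
move=> vc; split; last exact: classY_full.
move=> cY; have := kind_le2 c; rewrite leq_eqVlt => /orP[/eqP k2|].
  by case: (not_classY_full vc _ cY); rewrite k2.
rewrite ltnS leq_eqVlt => /orP[/eqP//|]; rewrite ltnS leqn0 => /eqP k0.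
case: cY => [|[_ nX _]]; last by case: nX; exact: classX_full.
have e : unit_square = full Unit by [].
move=> e'; have := classX_full vc k0; rewrite e' e => /not_classX_full.
by case.
Qed.

Lemma classZE c : valid c -> classZ (full c) <-> kind c = 2%N.
Proof.
move=> vc; split=> [[_ nX nY]|k2]; last first.
  split; first exact: base_class_full.
    by apply: not_classX_full; rewrite ?k2.
  by apply: not_classY_full; rewrite ?k2.
have := kind_le2 c; case k : (kind c) => [|[|[|n]]] // _.
  by case: nX; exact: classX_full.
by case: nY; exact: classY_full.
Qed.

(** * Decomposition of prudent walks *)

Lemma sites_catl (w w' : walk) s : s \in sites w -> s \in sites (w ++ w').
Proof. by rewrite /sites -cat_cons mem_cat => ->. Qed.

Lemma end_in w : endpoint w \in sites w.
Proof. exact: mem_last. Qed.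

Lemma hits_col w (s : site) x : is_walk w -> s \in sites w -> between 0 s.1 x ->
  exists2 s' : site, s' \in sites w & s'.1 = x.
Proof.
rewrite /is_walk /sites => ww sw; case/splitPl: sw ww => w1 w2 lw1.
rewrite cat_path => /andP[ww1 _] btw.
have [|s' s'w <-] := @walk_hits1 (0, 0) w1 x ww1; first by rewrite lw1.
by exists s' => //; move: s'w; rewrite -cat_cons mem_cat => ->.
Qed.

Lemma hits_row w (s : site) y : is_walk w -> s \in sites w -> between 0 s.2 y ->
  exists2 s' : site, s' \in sites w & s'.2 = y.
Proof.
rewrite /is_walk /sites => ww sw; case/splitPl: sw ww => w1 w2 lw1.
rewrite cat_path => /andP[ww1 _] btw.
have [|s' s'w <-] := @walk_hits2 (0, 0) w1 y ww1; first by rewrite lw1.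
by exists s' => //; move: s'w; rewrite -cat_cons mem_cat => ->.
Qed.

Lemma seg_adjacent p p' : adjacent p p' -> seg p p' = [:: p'].
Proof.
move=> adj; have al : aligned p p'.
  by move: adj; rewrite adjacentE /dist /aligned; case: p p' => a b [c d] /=; lia.
have ne : p != p' by move: adj; rewrite adjacentE /dist siteE; case: p p' {al} => a b [c d] /=; lia.
rewrite seg_rcons// (_ : before p p' = p) ?segpp//.
move: adj al ne; rewrite adjacentE /aligned siteE /dist /before.
by case: p p' => a b [c d] /= *; congr pair; case: sgzP; lia.
Qed.

Lemma seg_extend e p p' : aligned e p -> adjacent p p' -> aligned e p' ->
  ~~ (between e.1 p.1 p'.1 && between e.2 p.2 p'.2) ->
  seg e p ++ [:: p'] = seg e p'.
Proof.
move=> al adj al' nb; have ne : e != p'.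
  by move: nb; rewrite siteE /between; case: e p p' {al adj al'} => a b [c d] [x y] /=; lia.
rewrite cats1 [RHS]seg_rcons//; congr (rcons (seg e _) _).
move: al adj al' nb ne; rewrite adjacentE /aligned siteE /dist /before /between.
case: e p p' => a b [c d] [x y] /= al adj al' nb ne; congr pair.
  by case: (sgzP (x - a)); lia.
by case: (sgzP (y - b)); lia.
Qed.

(** The sides of the box are really attained; with the intermediate value lemmas this provides the
    visited sites that forbid inward steps. *)
Lemma reach c : valid c -> [/\
  exists2 s : site, s \in sites (walkT c) & s.1 = (wd c)%:Z - 1,
  exists2 s : site, s \in sites (walkT c) & s.2 = bt c,
  (0 < kind c)%N ->
    (exists2 s : site, s \in sites (walkR c) & s.2 = bt c) /\
    (exists2 s : site, s \in sites (walkR c) & s.2 = (tp c)%:Z - 1) &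
  (1 < kind c)%N ->
    (exists2 s : site, s \in sites (walkB c) & s.1 = (wd c)%:Z - 2) /\
    (exists2 s : site, s \in sites (walkB c) & s.2 = (tp c)%:Z - 1)].
Proof.
have TofR c' s : s \in sites (walkR c') -> s \in sites (walkT c').
  exact: sites_catl.
have RofB c' s : s \in sites (walkB c') -> s \in sites (walkR c').
  exact: sites_catl.
elim: c => [|c IH k|c IH k|c IH k] vc.
- by split=> //; [exists (0, 0)|exists (0, 0)|move=> _; split; exists (0, 0)].
- have /= /and3P[vc0 k0 kw] := vc; have [[s1 s1w e1] [s2 s2w e2] _ _] := IH vc0.
  have RT s : s \in sites (walkT c) -> s \in sites (walkR (Top c k)).
    by rewrite -(walkB_Top c k); apply: RofB.
  have eR : (k%:Z - 1, (tp c)%:Z) \in sites (walkR (Top c k)).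
    by rewrite -[X in X \in _]/(endR (Top c k)) -walkR_end// end_in.
  have e2' : s2.2 = bt (Top c k) by rewrite e2 /bt /=; lia.
  split.
  + have [kk|kk] := leqP k (wd c).
      by exists s1; [exact/TofR/RT|rewrite e1 /=; lia].
    by exists (k%:Z - 1, (tp c)%:Z); [exact: TofR|rewrite /=; lia].
  + by exists s2 => //; exact/TofR/RT.
  + move=> /= kk; split; first by exists s2 => //; exact: RT.
    by exists (k%:Z - 1, (tp c)%:Z) => //=; lia.
  + by move=> /=; lia.
- have /= /and4P[vc0 kc k0 kw] := vc.
  have [_ _ /(_ kc)[[s1 s1w e1] [s2 s2w e2]] _] := IH vc0.
  have BR s : s \in sites (walkR c) -> s \in sites (walkB (Right c k)).
    exact: sites_catl.
  have eR := walkR_end vc; have eB := walkB_end vc.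
  have eR' := end_in (walkR (Right c k)); rewrite eR in eR'.
  have eB' := end_in (walkB (Right c k)); rewrite eB in eB'.
  have [s3 s3w e3] : exists2 s : site, s \in sites (walkR (Right c k)) &
      s.2 = bt (Right c k).
    have [kk|kk] := leqP k (ht c).
      by exists s1; [exact/RofB/BR|rewrite e1 /bt /=; lia].
    by exists (endR (Right c k)) => //; rewrite /bt /=; lia.
  split.
  + by exists (endR (Right c k)); [exact: TofR|rewrite /=; lia].
  + by exists s3 => //; exact: TofR.
  + by move=> _; split; [exists s3|exists s2 => //; exact/RofB/BR].
  + move=> _; split; last by exists s2 => //; exact: BR.
    by exists (endB (Right c k)); rewrite //=; lia.
- have /= /and4P[vc0 kc k0 kw] := vc.
  have [_ _ _ /(_ kc)[[s1 s1w e1] [s2 s2w e2]]] := IH vc0.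
  have BB s : s \in sites (walkB c) -> s \in sites (walkB (Bottom c k)).
    by move=> sw; do 2!apply: sites_catl.
  have eR := walkR_end vc; have eB := walkB_end vc.
  have eR' := end_in (walkR (Bottom c k)); rewrite eR in eR'.
  have eB' := end_in (walkB (Bottom c k)); rewrite eB in eB'.
  have b1 : (endB (Bottom c k)).2 = bt (Bottom c k) by rewrite /bt /= /bt; lia.
  split.
  + by exists (endR (Bottom c k)); [exact: TofR|rewrite /=; lia].
  + by exists (endB (Bottom c k)) => //; exact/TofR/RofB.
  + move=> _; split; first by exists (endB (Bottom c k)) => //; exact/RofB.
    by exists s2 => //; exact/RofB/BB.
  + by move=> _; split; [exists s1 => //; exact: BB|exists s2 => //; exact: BB].
Qed.

(* The levels 0, 1 and 2 stand for the top, right and bottom sides of the box. *)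
Definition walkL (l : nat) := if l is 0%N then walkT else if l is 1%N then walkR else walkB.
Definition endL (l : nat) := if l is 0%N then endT else if l is 1%N then endR else endB.
(** Each corner belongs to one side only, the top right one to the top and the bottom right one to
    the right side; hence the bounds [tp - 1] and [wd - 2]. *)
Definition side (l : nat) (c : code) (p : site) : bool :=
  match l with
  | 0 => (p.2 == (tp c)%:Z) && (0 <= p.1 <= (wd c)%:Z - 1)
  | 1 => (p.1 == (wd c)%:Z - 1) && (bt c <= p.2 <= (tp c)%:Z - 1)
  | _ => (p.2 == bt c) && (0 <= p.1 <= (wd c)%:Z - 2)
  end.
Definition decomposed (w : walk) := exists c l, [/\ valid c, (l <= kind c)%N,
  w = walkL l c ++ seg (endL l c) (endpoint w) & side l c (endpoint w)].

(** Blocks inward steps from the top side. The column contains [endR], under the last run up, or it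
    is crossed by the walk at a site that cannot be on the top side, where only [endT] is.
    [block_left] and [block_up] do the same for the other sides. *)
Lemma block_down c x : valid c -> 0 <= x <= (wd c)%:Z - 1 ->
  exists s : site, [/\ s \in sites (walkT c), s.1 = x & s.2 < (tp c)%:Z].
Proof.
move=> vc xb; have [[pT bT] _ _] := soundP vc; have [wT _ _] := pT.
have [w0 t0 th0 _] := valid_dims vc.
have [e|ne] := eqVneq x (endT c).1.
  exists (endR c); split.
  - by apply: sites_catl; rewrite -walkR_end// end_in.
  - by rewrite e; case: (c) => //= c' k; lia.
  - by case: (c) vc => //= c' k; rewrite /bt; have := @valid_dims c'; lia.
have [[s0 s0w e0] _ _ _] := reach vc.
have [|s sw e] := hits_col (x := x) wT s0w; first by rewrite e0 /between; lia.
by exists s; split=> //; have := bT _ sw; rewrite /inT siteE; move: ne; rewrite -e; lia.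
Qed.

Lemma block_left c y : valid c -> (0 < kind c)%N -> (1 < wd c)%N ->
  bt c <= y <= (tp c)%:Z - 1 ->
  exists s : site, [/\ s \in sites (walkR c), s.2 = y & s.1 < (wd c)%:Z - 1].
Proof.
move=> vc kc w1 yb; have [_ /(_ kc)[pR bR] _] := soundP vc; have [wR _ _] := pR.
have [e|ne] := eqVneq y (endR c).2.
  exists (endB c); split.
  - by apply: sites_catl; rewrite -walkB_end// end_in.
  - by rewrite e; case: (c) => //= c' k; rewrite endT2.
  - case: (c) vc kc w1 => //= [c' k vc kc _|c' k|c' k]; try lia.
    have /andP[vc' _] := vc; have [[_ bT] _ _] := soundP vc'.
    have := bT (endT c'); rewrite -{1}walkT_end// end_in => /(_ isT); rewrite /inT.
    by move: kc; lia.
have [_ _ /(_ kc)[[s1 s1w e1] [s2 s2w e2]] _] := reach vc.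
have [s sw e] : exists2 s : site, s \in sites (walkR c) & s.2 = y.
  have [y0|y0] := leP 0 y.
    by apply: hits_row wR s2w _; rewrite e2 /between; lia.
  by apply: hits_row wR s1w _; rewrite e1 /between; lia.
by exists s; split=> //; have := bR _ sw; rewrite /inR siteE; move: ne; rewrite -e; lia.
Qed.

Lemma block_up c x : valid c -> (1 < kind c)%N -> 0 <= x <= (wd c)%:Z - 2 ->
  exists s : site, [/\ s \in sites (walkB c), s.1 = x & bt c < s.2].
Proof.
move=> vc kc xb; have [_ _ /(_ kc)[pB bB]] := soundP vc; have [wB _ _] := pB.
have [e|ne] := eqVneq x (endB c).1.
  case: (c) vc kc e => [||c' k|c' k] //; first by move=> c1 k1 _ /=; lia.
    move=> vc kc e; have /= /and4P[vc' kc' k0 kw] := vc.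
    exists (endR c'); split.
    - by apply: (@sites_catl (walkR c')); rewrite -walkR_end// end_in.
    - by rewrite e /= endR1.
    - have [_ /(_ kc')[_ bR] _] := soundP vc'.
      have := bR (endR c'); rewrite -{1}walkR_end// end_in => /(_ isT); rewrite /inR.
      by move: kc => /=; rewrite /bt /=; lia.
  move=> vc kc e; have /= /and4P[vc' kc' k0 kw] := vc.
  exists ((wd c')%:Z - 1 - k%:Z, bt c'); split.
  - apply: sites_catl; rewrite -[X in X \in _](endpoint_cat (walkB_end vc') (p' := ((wd c')%:Z - 1 - k%:Z, bt c'))) ?end_in//.
    by rewrite /aligned endB2// eqxx orbT.
  - by rewrite e.
  - by rewrite /bt /=; lia.
have [_ _ _ /(_ kc)[[s0 s0w e0] _]] := reach vc.
have [|s sw e] := hits_col (x := x) wB s0w; first by rewrite e0 /between; lia.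
by exists s; split=> //; have := bB _ sw; rewrite /inB siteE; move: ne; rewrite -e; lia.
Qed.

Lemma adjacent_dir (p p' : site) : adjacent p p' ->
  [\/ p' = (p.1 + 1, p.2), p' = (p.1 - 1, p.2), p' = (p.1, p.2 + 1) |
      p' = (p.1, p.2 - 1)].
Proof.
rewrite adjacentE /dist; case: p p' => a b [c d] /= adj.
have [e|?] := eqVneq c (a + 1).
  by constructor 1; congr pair; lia.
have [e|?] := eqVneq c (a - 1).
  by constructor 2; congr pair; lia.
have [e|?] := eqVneq d (b + 1).
  by constructor 3; congr pair; lia.
by constructor 4; congr pair; lia.
Qed.

Lemma walkL_end l c : valid c -> endpoint (walkL l c) = endL l c.
Proof.
by move=> vc; case: l => [|[|l]]; [exact: walkT_end|exact: walkR_end|exact: walkB_end].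
Qed.

Lemma decomposed_new c l w p : valid c -> (l <= kind c)%N -> endL l c = p ->
  side l c p -> w = walkL l c -> decomposed w.
Proof.
move=> vc lk ep sp ->; exists c, l; rewrite walkL_end//.
by split; rewrite // ?ep// segpp cats0.
Qed.

(** Three sides times four directions: the step slides, turns at a corner, inflates the box, or is
    excluded by a blocking site or by the half plane. *)
Lemma half_plane_decomposed w : prudent w -> (forall s : site, s \in sites w -> 0 <= s.1) ->
  decomposed w.
Proof.
elim/last_ind: w => [_ _|w p' IH /prudent_rcons[pw adj free] pos].
  (* The origin is on the right side of the unit box, hence level 1. *)
  by exists Unit, 1%N; split; rewrite //= /walkR /= segpp.
have [|c [l [vc lk wE sp]]] := IH pw.
  by move=> s sw; apply: pos; rewrite sites_rcons mem_rcons inE sw orbT.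
have p'0 : 0 <= p'.1 by apply: pos; rewrite sites_rcons mem_rcons inE eqxx.
have wsub s : s \in sites (walkL l c) -> s \in sites w by rewrite wE; apply: sites_catl.
have p'w : p' \notin sites w.
  by apply/negP => /free/negP; apply; apply/(aheadP _ adj); exists 1%N; rewrite // addrC subrK.
move: adj free wE sp; move: (endpoint w) => [x y] adj free wE sp.
have [w0 t0 th0 w1] := valid_dims vc.
have viaE : rcons w p' = w ++ seg (x, y) p' by rewrite seg_adjacent// cats1.
have wE' : rcons w p' = walkL l c ++ (seg (endL l c) (x, y) ++ [:: p']).
  by rewrite catA -wE cats1.
have al : aligned (endL l c) (x, y).
  case: l lk sp {wsub wE wE'} => [|[|l]] lk /=; rewrite /aligned.
  - by rewrite endT2 /=; lia.
  - by rewrite endR1 /=; lia.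
  - by rewrite endB2 /=; lia.
have nb : ~~ (between (endL l c).1 x p'.1 && between (endL l c).2 y p'.2).
  by move: p'w; rewrite {1}wE mem_sites_seg ?walkL_end// negb_or => /andP[].
have ext : aligned (endL l c) p' -> rcons w p' = walkL l c ++ seg (endL l c) p'.
  by move=> al'; rewrite wE' seg_extend.
have slide : aligned (endL l c) p' -> side l c p' -> decomposed (rcons w p').
  by move=> al' sp'; exists c, l; rewrite endpoint_rcons; split=> //; exact: ext.
have turn (c' : code) (l' : nat) : valid c' -> (l' <= kind c')%N -> endL l' c' = p' ->
    side l' c' p' -> rcons w p' = walkL l' c' -> decomposed (rcons w p').
  exact: decomposed_new.
have nofree (s : site) : s \in sites (walkL l c) -> ahead (x, y) p' s -> False.
  by move=> /wsub /free /negP.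
case: l lk sp wE al ext slide nofree {wsub nb wE' free p'w IH}
  => [|[|l]] lk /= sp wE al ext slide nofree; case: (adjacent_dir adj) => /= e.
- have [xw|xw] := leP (x + 1) ((wd c)%:Z - 1).
    by apply: slide; rewrite e /aligned ?endT2 /=; lia.
  (* A step east past the corner already counts as a full top row of [wd c + 1] cells: the walk has
     to come back over it to close the polygon. *)
  have e' : p' = endR (Top c (wd c).+1) by rewrite e; congr pair; lia.
  apply: (turn (Top c (wd c).+1) 1%N) => //=.
  + by rewrite vc leqnn.
  + by rewrite ltnSn.
  + by rewrite e /bt /=; lia.
  + rewrite ext; last by rewrite e /aligned endT2 /=; lia.
    by rewrite /walkR walkB_Top e'.
- by apply: slide; rewrite e ?endT2 /aligned ?endT2 /=; move: p'0; rewrite e /=; lia.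
- have xk : (absz (x + 1)%R)%:Z - 1 = x by lia.
  have yt : y = (tp c)%:Z by lia.
  apply: (turn (Top c (absz (x + 1)%R)) 0%N) => //=.
  + by rewrite vc; lia.
  + by rewrite e xk yt.
  + by rewrite e /=; lia.
  + rewrite viaE /walkT /walkR walkB_Top wE /= xk yt e.
    by rewrite yt.
- have [|s [sw s1 s2]] := block_down (x := x) vc; first lia.
  by case: (nofree s sw); rewrite e /ahead /=; lia.
- have yk : (tp c)%:Z - (absz ((tp c)%:Z - y)%R)%:Z = y by lia.
  have xt : x = (wd c)%:Z - 1 by lia.
  apply: (turn (Right c (absz ((tp c)%:Z - y)%R)) 1%N) => //=.
  + by rewrite vc lk; move: sp; rewrite /bt; lia.
  + by rewrite e yk xt; congr pair; lia.
  + by rewrite e /bt /=; lia.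
  + by rewrite viaE /walkR wE /= yk xt e xt subrK.
- have [p1|wd1] := leqP (wd c) 1; first by move: p'0; rewrite e /=; lia.
  have [|s [sw s1 s2]] := block_left (y := y) vc lk wd1; first lia.
  by case: (nofree s sw); rewrite e /ahead /=; lia.
- have [yt|yt] := leP (y + 1) ((tp c)%:Z - 1).
    by apply: slide; rewrite e /aligned ?endR1 /=; lia.
  have e' : p' = endT c.
    by rewrite e; apply: siteP; rewrite /= ?endT1 ?endT2; lia.
  apply: (turn c 0%N) => //=.
  + by rewrite e /=; lia.
  + by rewrite ext e' ?aligned_RT.
- have [yb|yb] := leP (bt c) (y - 1).
    by apply: slide; rewrite e /aligned ?endR1 /=; lia.
  have e' : p' = endB (Right c (ht c).+1).
    by rewrite e; apply: siteP; move: sp yb; rewrite /bt /=; lia.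
  apply: (turn (Right c (ht c).+1) 2%N) => //=.
  + by rewrite vc lk leqnn.
  + by rewrite ltnSn.
  + by rewrite e /bt /=; move: sp yb; rewrite /bt /=; lia.
  + by rewrite ext ?e' //= /aligned endR1 //= eqxx.
- have [xw|xw] := leP (x + 1) ((wd c)%:Z - 2).
    by apply: slide; rewrite e /aligned ?endB2 /=; lia.
  have e' : p' = endR c.
    by rewrite e; apply: siteP; rewrite /= ?endR1 ?endR2; lia.
  apply: (turn c 1%N) => //=.
  + by lia.
  + by rewrite e /bt /=; move: sp; rewrite /bt; lia.
  + by rewrite ext e' ?aligned_BR.
- by apply: slide; rewrite e /aligned ?endB2 /=; move: p'0; rewrite e /=; lia.
- have kc : (1 < kind c)%N by lia.
  have [|s [sw s1 s2]] := block_up (x := x) vc kc; first lia.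
  by case: (nofree s sw); rewrite e /ahead /=; lia.
- have xk : (wd c)%:Z - 1 - (absz ((wd c)%:Z - 1 - x)%R)%:Z = x by lia.
  have yt : y = bt c by lia.
  have kc : (1 < kind c)%N by lia.
  apply: (turn (Bottom c (absz ((wd c)%:Z - 1 - x)%R)) 2%N) => //=.
  + by rewrite vc kc; lia.
  + by rewrite e xk yt.
  + by rewrite e /bt /=; move: yt; rewrite /bt; lia.
  + by rewrite viaE wE /= xk yt e yt.
Qed.

(** The sides are numbered east, west, north, south; side [i] is where [heightof i] is largest, and
    [across i] is the coordinate along it. *)
Definition heightof (i : nat) (s : site) : int :=
  match i with 0 => s.1 | 1 => - s.1 | 2 => s.2 | _ => - s.2 end.
Definition across (i : nat) (s : site) : int := match i with 0 | 1 => s.2 | _ => s.1 end.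

Lemma hits_col2 w (s s' : site) x : is_walk w -> s \in sites w -> s' \in sites w ->
  between s.1 s'.1 x -> exists2 r : site, r \in sites w & r.1 = x.
Proof.
move=> ww sw sw' btw; have [h|h] := boolP (between 0 s.1 x).
  exact: hits_col h.
by apply: hits_col ww sw' _; move: btw h; rewrite /between; lia.
Qed.

Lemma hits_row2 w (s s' : site) y : is_walk w -> s \in sites w -> s' \in sites w ->
  between s.2 s'.2 y -> exists2 r : site, r \in sites w & r.2 = y.
Proof.
move=> ww sw sw' btw; have [h|h] := boolP (between 0 s.2 y).
  exact: hits_row h.
by apply: hits_row ww sw' _; move: btw h; rewrite /between; lia.
Qed.

(* The endpoint lies on side [i] of the bounding box, and the step that first
   reached this side, or the sites preceding it, block the way back. *)
Lemma prudent_side w : prudent w -> w != [::] -> exists i,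
  (forall s, s \in sites w -> heightof i s <= heightof i (endpoint w)) /\
  exists s, [/\ s \in sites w, across i s = across i (endpoint w) &
    heightof i s < heightof i (endpoint w)].
Proof.
elim/last_ind: w => [//|w p' IH] /prudent_rcons[pw adj free] _.
rewrite endpoint_rcons; have [ww _ _] := pw.
have p'w : p' \notin sites w.
  by apply/negP => /free/negP; apply; apply/(aheadP _ adj); exists 1%N; rewrite // addrC subrK.
have eww := end_in w.
have inw s : s \in sites w -> s \in sites (rcons w p').
  by rewrite sites_rcons mem_rcons inE orbC => ->.
have beyond i : across i (endpoint w) = across i p' ->
    (forall s, s \in sites w -> heightof i s < heightof i p') -> exists i,
    (forall s, s \in sites (rcons w p') -> heightof i s <= heightof i p') /\
    exists s, [/\ s \in sites (rcons w p'), across i s = across i p' &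
      heightof i s < heightof i p'].
  move=> ac hi; exists i; split=> [s|].
    by rewrite sites_rcons mem_rcons inE => /predU1P[->//|/hi/ltW].
  by exists (endpoint w); split=> //; [exact: inw|exact: hi].
have dir : exists2 j, heightof j p' = heightof j (endpoint w) + 1 &
    across j (endpoint w) = across j p'.
  by case: (adjacent_dir adj) => ->;
    [exists 0%N|exists 1%N|exists 2%N|exists 3%N]; rewrite /=; lia.
have {dir} [j hj aj] := dir.
(* Either the step goes beyond everything visited in its direction [j], which becomes the new side,
   or the old side [i] persists. *)
have [/allP hall|/allPn[s1 s1w]] :=
    boolP (all (fun s => heightof j s < heightof j p') (sites w)).
  exact: (beyond j).
rewrite -leNgt => s1h.
have [we|wn] := eqVneq w [::].
  by move: s1w s1h hj; rewrite we inE => /eqP ->; rewrite /endpoint /=; lia.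
have [i [hi [s0 [s0w s0a s0h]]]] := IH pw wn.
have nofree (s : site) : s \in sites w -> ahead (endpoint w) p' s -> False.
  by move=> sw; apply/negP/free.
have {}nofree := nofree s0 s0w.
have his1 := hi s1 s1w.
have keep (r : site) : r \in sites w -> heightof i (endpoint w) = heightof i p' ->
    across i r = across i p' -> exists i,
    (forall s, s \in sites (rcons w p') -> heightof i s <= heightof i p') /\
    exists s, [/\ s \in sites (rcons w p'), across i s = across i p' &
      heightof i s < heightof i p'].
  move=> rw hp ra; exists i; split=> [s|].
    by rewrite sites_rcons mem_rcons inE => /predU1P[->//|/hi]; rewrite hp.
  exists r; split=> //; first exact: inw.
  rewrite lt_neqAle -hp hi// andbT; apply: contra p'w => /eqP hr.
  suff -> : p' = r by [].
  apply: siteP; move: ra hp hr; case: (i) => [|[|[|i']]] /=; lia.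
move: (endpoint w) eww hj aj hi s0a s0h s1h nofree his1 keep {free IH adj beyond}.
move=> [x y] eww hj aj hi s0a s0h s1h nofree his1 keep.
have [i2|i2] := ltnP i 2; have [j2|j2] := ltnP j 2.
- have [ij|ij] := eqVneq i j; first by subst j; lia.
  (* A step back from side [i] would be towards [s0]. *)
  exfalso; apply: nofree; move: s0a s0h hj aj; rewrite /ahead.
  by case: i j i2 j2 ij {hi s1h his1 keep} => [|[|i]] [|[|j]] //= _ _ _; lia.
(* The step goes along side [i] within the visited range, so some visited [r] is in the row of [p'];
   being different from [p'], it lies strictly behind it. *)
- have [|r rw rx] := hits_row2 (y := p'.2) ww eww s1w.
    by move: hj s1h aj; rewrite /between /=; case: j j2 => [|[|[|j]]] //= _; lia.
  apply: (keep r rw); move: aj rx {hi s0a s0h his1 keep hj s1h};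
    by case: i j i2 j2 => [|[|i]] [|[|j]] //= _ _; lia.
- have [|r rw rx] := hits_col2 (x := p'.1) ww eww s1w.
    by move: hj s1h aj; rewrite /between /=; case: j j2 => [|[|j]] //= _; lia.
  apply: (keep r rw); move: aj rx {hi s0a s0h his1 keep hj s1h};
    by case: i j i2 j2 => [|[|[|i]]] [|[|j]] //= _ _; lia.
- exfalso; apply: nofree; move: s0a s0h hj aj s1h his1; rewrite /ahead /=.
  by case: i j i2 j2 {hi keep} => [|[|[|i]]] [|[|[|j]]] //= _ _; lia.
Qed.

Lemma prudent_extreme w : prudent w -> w != [::] ->
  let p := endpoint w in
  ~ [/\ exists2 s : site, s \in sites w & s.1 < p.1,
     exists2 s : site, s \in sites w & p.1 < s.1,
     exists2 s : site, s \in sites w & s.2 < p.2 &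
     exists2 s : site, s \in sites w & p.2 < s.2].
Proof.
move=> pw wn p [[s1 w1 e1] [s2 w2 e2] [s3 w3 e3] [s4 w4 e4]].
have [i [hi _]] := prudent_side pw wn.
move: (hi _ w1) (hi _ w2) (hi _ w3) (hi _ w4); rewrite -/p.
by case: i {hi} => [|[|[|i]]] /=; lia.
Qed.

(** * Every polygon comes from a code *)

Lemma seg_down x n : seg (x, n.+1%:Z) (x, 0) = (x, n%:Z) :: seg (x, n%:Z) (x, 0).
Proof.
have segE k : seg (x, k%:Z) (x, 0) = [seq (x, k%:Z - i%:Z) | i <- iota 1 k].
  rewrite /seg (_ : dist _ _ = k); last by rewrite /dist /=; lia.
  apply/eq_in_map => i; rewrite mem_iota => ik.
  by apply: siteP; rewrite /= ?subrr ?sgz0 ?mul0r ?addr0//; case: sgzP; lia.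
rewrite !segE /= (iotaDl 1 1) -map_comp; congr cons; first by apply: siteP => //=; lia.
by apply: eq_map => i /=; congr pair; lia.
Qed.

Lemma last_descent w m : (0 < m)%N -> endpoint w = (-1, m%:Z) -> exists w' n,
  [/\ (0 < n)%N, endpoint w' = (-1, n%:Z),
     w ++ seg (-1, m%:Z) (-1, 0) = w' ++ seg (-1, n%:Z) (-1, 0) &
     forall w1, w' = rcons w1 (-1, n%:Z) -> endpoint w1 != (-1, n.+1%:Z)].
Proof.
elim/last_ind: w m => [//|w p IH] m m0; rewrite endpoint_rcons => ->.
have [e|ne] := eqVneq (endpoint w) (-1, m.+1%:Z).
  have [w' [n [n0 en we mx]]] := IH _ (ltn0Sn m) e; exists w', n; split=> //.
  by rewrite -we seg_down cat_rcons.
exists (rcons w (-1, m%:Z)), m; rewrite endpoint_rcons; split=> // w1.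
by move=> /rcons_inj[ww]; rewrite -ww; exact: ne.
Qed.

Lemma prudent_fresh w p : prudent (rcons w p) -> p \notin sites w.
Proof.
by case=> _ + _; rewrite sites_rcons rcons_uniq => /andP[].
Qed.

Lemma kind1_unit c : valid c -> (0 < kind c)%N -> wd c = 1%N -> c = Unit.
Proof.
case: c => //= [c k|c k|c k].
- by case/and3P => vc _ _; have [w0 _ _ _] := valid_dims vc; lia.
- by case/and4P => vc _ _ _; have [w0 _ _ _] := valid_dims vc; lia.
- by case/and4P => vc kc _ _; have [w0 t0 th0 w1] := valid_dims vc; lia.
Qed.

Lemma bt_kind2 c : valid c -> (1 < kind c)%N -> bt c < 0.
Proof.
case: c => //= [c k|c k|c k]; rewrite /bt /=; first by lia.
- by case/and4P => vc _ _ _; have [w0 t0 th0 _] := valid_dims vc; lia.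
- by case/and4P => vc kc _ _; have [w0 t0 th0 w1] := valid_dims vc; lia.
Qed.

(** The walk is cut before its maximal final run south and at its first site of negative abscissa.
    What precedes that site is decomposed, and the claim is that nothing happens between the two
    cuts: a detour would have to return to the column [x = -1] below height [tp c]. *)
Lemma descending_polygon_full w : prudent (rcons (rcons w (-1, 1)) (-1, 0)) ->
  exists2 c, valid c & rcons (rcons w (-1, 1)) (-1, 0) = full c.
Proof.
move=> pw; have e1 : endpoint (rcons w (-1, 1)) = (-1, 1%:Z) by rewrite endpoint_rcons.
have [w' [m [m0 en we mx]]] := last_descent (ltn0Sn 0) e1.
case: m m0 en we mx => // n _ en we mx.
have {}we : rcons (rcons w (-1, 1)) (-1, 0) = w' ++ seg (-1, n.+1%:Z) (-1, 0).
  by rewrite -we seg_down segpp cats1.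
rewrite we in pw *; have pw'n : prudent (rcons w' (-1, n%:Z)).
  by move: pw; rewrite seg_down -cat_rcons; apply: prudent_catl.
have [pw' _ free] := (prudent_rcons _ _).1 pw'n.
(* The final run south needs a free ray, so column [x = -1] is unvisited below its start. *)
have low (y : int) : (-1, y) \in sites w' -> n.+1%:Z <= y.
  by move/free; rewrite en /ahead /=; lia.
have neg : has (fun s : site => s.1 < 0) w'.
  apply/hasP; exists (-1, n.+1%:Z) => //; have := end_in w'.
  by rewrite en /sites inE => /predU1P[].
have [[qx qy] [w1 [w3 [w'E q0 nh]]]] : exists (q : site) w1 w3,
    [/\ rcons w1 q ++ w3 = w', q.1 < 0 & ~~ has (fun s : site => s.1 < 0) w1].
  by case/split_find: neg => q w1 w3 q0 nh; exists q, w1, w3.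
rewrite /= in q0.
have pq : prudent (rcons w1 (qx, qy)) by move: pw'; rewrite -w'E; apply: prudent_catl.
have [pw1 adj _] := (prudent_rcons _ _).1 pq.
have pos (s : site) : s \in sites w1 -> 0 <= s.1.
  rewrite inE => /predU1P[->//|sw]; rewrite leNgt; apply: contra nh => s0.
  by apply/hasP; exists s.
have [c [l [vc lk w1E sp]]] := half_plane_decomposed pw1 pos.
have [w0 t0 th0 _] := valid_dims vc.
have ppos := pos _ (end_in w1).
have [px qE] : (endpoint w1).1 = 0 /\ (qx, qy) = (-1, (endpoint w1).2).
  move: adj ppos q0; rewrite adjacentE /dist; case: (endpoint w1) => x y /= *.
  by split; last congr pair; lia.
have qw' : (-1, (endpoint w1).2) \in sites w'.
  by rewrite -w'E -qE /sites inE mem_cat mem_rcons inE eqxx ?orbT.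
have qlow := low _ qw'.
(* Only the top side is possible: on the other two, the first site of negative abscissa would have
   ordinate 0 or less, against [qlow]. *)
case: l lk w1E sp => [|[|l]] /= lk w1E; rewrite px => sp; first last.
- by have := bt_kind2 vc; lia.
- have cU : c = Unit by apply: kind1_unit => //; lia.
  by move: sp; rewrite cU /=; lia.
have ept : endpoint w1 = (0, (tp c)%:Z) by apply: siteP; rewrite //=; lia.
have AE : rcons w1 (qx, qy) = walkT c ++ seg (endT c) (-1, (tp c)%:Z).
  rewrite -cats1 {1}w1E -catA; congr (_ ++ _); rewrite qE ept /=.
  have : endT c \in sites w1.
    by rewrite w1E; apply: sites_catl; rewrite -walkT_end// end_in.
  move/pos => /= e0; apply: seg_extend.
  - by rewrite /aligned endT2 eqxx orbT.
  - by rewrite adjacentE /dist /=; lia.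
  - by rewrite /aligned endT2 eqxx orbT.
  - by rewrite /between /=; lia.
case/lastP: w3 w'E => [|w3 p] w'E.
  exists c => //; rewrite -w'E cats0 AE /full.
  by move: en; rewrite -w'E cats0 endpoint_rcons qE ept /= => -[->].
exfalso; set A := rcons w1 (qx, qy) in w'E.
have pE : p = (-1, n.+1%:Z) by move: en; rewrite -w'E -rcons_cat endpoint_rcons.
set v := A ++ w3; have w'v : w' = rcons v p by rewrite -w'E -rcons_cat.
have [pv adjp _] := (prudent_rcons v p).1 (eq_ind _ _ pw' _ w'v).
have pnv : p \notin sites v by apply: prudent_fresh; rewrite -w'v.
have qv : (-1, (tp c)%:Z) \in sites v.
  by rewrite /v /A qE ept; apply: sites_catl; rewrite sites_rcons mem_rcons inE eqxx.
have tn : n.+1%:Z < (tp c)%:Z.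
  rewrite lt_neqAle; apply/andP; split; last by move: qlow; rewrite ept.
  by apply: contra pnv => /eqP e; rewrite pE e.
have vw' s : s \in sites v -> s \in sites w'.
  by rewrite w'v sites_rcons mem_rcons inE orbC => ->.
have v0 : v != [::] by rewrite /v /A; case: (w1).
have w'0 : w' != [::] by rewrite w'v; case: (v).
have := mx v; rewrite -pE => /(_ w'v).
move: adjp; rewrite pE; have := end_in v; case ev : (endpoint v) => [x y] ein adjp nmx.
have n0 : 0 < n.+1%:Z by [].
(* Coming from the west, [p] has visited sites strictly on all four sides. From the east, this holds
   for the endpoint of [v], unless that endpoint repeats a site of [w1]. From the south, the column
   would be visited too low; from the north, the final run would not be maximal. *)
case: (adjacent_dir adjp) => /= -[ex ey].
- apply: (prudent_extreme pw' w'0); rewrite en /=; split.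
  + by exists (x, y) => /=; [exact: vw'|move: ex; clear; lia].
  + by exists (0, 0); rewrite ?inE.
  + by exists (0, 0); rewrite ?inE.
  + by exists (-1, (tp c)%:Z) => //=; exact: vw'.
- have x0 : x = 0 by move: ex; clear; lia.
  have [|s sw1 s2] := @hits_row w1 (endpoint w1) y (let: And3 a _ _ := pw1 in a) (end_in w1).
    by rewrite ept /between /=; move: ey tn; clear; lia.
  have sv : s \in sites v by rewrite /v /A -cats1 -catA; apply: sites_catl.
  have [s1|s1] := ltP 0 s.1.
    apply: (prudent_extreme pv v0); rewrite ev /=; split.
    + by exists (-1, (tp c)%:Z) => //=; rewrite x0.
    + by exists s => //; rewrite x0.
    + by exists (0, 0); rewrite ?inE//= -ey.
    + by exists (-1, (tp c)%:Z) => //=; rewrite -ey.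
  have sE : s = (x, y).
    by apply: siteP; rewrite //= x0; apply/eqP; rewrite eq_le s1 pos.
  move: pv ev; rewrite /v; case/lastP: (w3) => [|w4 r].
    by rewrite cats0 endpoint_rcons qE x0 => _ [].
  rewrite -rcons_cat endpoint_rcons => /prudent_fresh + rE.
  rewrite rE -sE => /negP; apply.
  by rewrite /A -cats1 -catA; apply: sites_catl.
- have := low y; rewrite (_ : (-1, y) = (x, y)); last by congr pair; move: ex; clear; lia.
  by move=> /(_ (vw' _ ein)); move: ey; clear; lia.
- by move/eqP: nmx; apply; congr pair; move: ex ey; clear; lia.
Qed.

(** * Decoding *)

(* The state consists of the code of the inflating steps read so far, the side of
   the box the walk is on, and its last site. *)
Definition decode_step (st : code * nat * site) (p' : site) : code * nat * site :=
  let: (c, l, p) := st in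
  (match l with
   | 0 => if (tp c)%:Z < p'.2 then (Top c (absz (p.1 + 1)%R), 0%N)
          else if (wd c)%:Z - 1 < p'.1 then (Top c (wd c).+1, 1%N) else (c, 0%N)
   | 1 => if (wd c)%:Z - 1 < p'.1 then (Right c (absz ((tp c)%:Z - p.2)%R), 1%N)
          else if (tp c)%:Z <= p'.2 then (c, 0%N)
          else if p'.2 < bt c then (Right c (ht c).+1, 2%N) else (c, 1%N)
   | _ => if p'.2 < bt c then (Bottom c (absz ((wd c)%:Z - 1 - p.1)%R), 2%N)
          else if (wd c)%:Z - 2 < p'.1 then (c, 1%N) else (c, 2%N)
   end, p').

Definition decode (w : walk) := foldl decode_step (Unit, 1%N, (0, 0)) w.

Lemma decode_slide c l p p' : (l <= 2)%N -> side l c p -> side l c p' ->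
  foldl decode_step (c, l, p) (seg p p') = (c, l, p').
Proof.
move=> l2 sp; have al x : side l c x -> aligned p x.
  by move: sp; case: l {l2} => [|[|l]]; rewrite /aligned /=; lia.
move=> sp'; move: (sp'); apply: (seg_ind (P := fun x => side l c x -> _) (al _ sp')).
  by rewrite segpp.
move=> x alx ne IH sx; rewrite seg_rcons// foldl_rcons IH /=; last first.
  move: sp sx alx; rewrite /side /aligned /before; case: l {al sp' IH} l2 => [|[|l]] _ /=;
  case: p x {ne} => a b [d e] /=; case: (sgzP (d - a)); case: (sgzP (e - b)); lia.
move: sx; case: l {al sp sp' IH} l2 => [|[|[|l]]] //= _ sx; congr (_, _).
- by do 2![case: ltP => [?|_]; first lia].
- by do 3![case: leP => [?|?] || case: ltP => [?|?]; try lia].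
- by do 2![case: ltP => [?|_]; first lia].
Qed.

(** For a run whose last step, from [p'] to [p''], leaves the side. *)
Lemma decode_turn c l p p' p'' : (l <= 2)%N -> side l c p -> side l c p' ->
  adjacent p' p'' -> aligned p p'' ->
  ~~ (between p.1 p'.1 p''.1 && between p.2 p'.2 p''.2) ->
  foldl decode_step (c, l, p) (seg p p'') = decode_step (c, l, p') p''.
Proof.
move=> l2 sp sp' adj al nb; rewrite -(seg_extend (p := p'))//.
  by rewrite foldl_cat decode_slide.
by move: sp sp'; case: l {l2} => [|[|l]]; rewrite /aligned /=; lia.
Qed.

Lemma side_endL c l : valid c -> (l <= kind c)%N -> side l c (endL l c).
Proof.
move=> vc lk; have [[_ bT] bR bB] := soundP vc.
have := end_in (walkL l c); rewrite walkL_end//.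
case: l lk => [_ /bT|[lk /(bR lk).2|l lk /(bB _).2]]; rewrite /inT /inR /inB /=.
- by have := endT2 c; lia.
- by have := endR1 vc lk; lia.
- by have := endB2 vc; lia.
Qed.

Lemma decode_cat w w' : decode (w ++ w') = foldl decode_step (decode w) w'.
Proof. exact: foldl_cat. Qed.

Lemma decode_walkR c : valid c -> (1 < kind c)%N ->
  decode (walkB c) = (c, 2%N, endB c) -> decode (walkR c) = (c, 1%N, endR c).
Proof.
move=> vc kc dB; have [w0 t0 th0 w1] := valid_dims vc; have {w1} := w1 kc => w1.
have e1 := endR1 vc (ltnW kc); have e2 := endR2 vc kc; have b2 := endB2 vc kc.
have sB : side 2 c (endB c) := side_endL (l := 2) vc kc.
rewrite /walkR decode_cat dB (decode_turn (p' := ((wd c)%:Z - 2, bt c)))//.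
- have eR : endR c = ((wd c)%:Z - 1, bt c) by apply: siteP.
  by rewrite eR /= ltxx ifT//; lia.
- by rewrite /= eqxx /=; lia.
- by rewrite adjacentE /dist /= e1 e2; lia.
- exact: aligned_BR.
- by move: sB; rewrite /between /= e1 e2 b2; lia.
Qed.

Lemma decode_walkT c : valid c -> (0 < kind c)%N ->
  decode (walkR c) = (c, 1%N, endR c) -> decode (walkT c) = (c, 0%N, endT c).
Proof.
move=> vc kc dR; have [w0 t0 th0 _] := valid_dims vc.
have e1 := endT1 vc kc; have e2 := endT2 c; have r1 := endR1 vc kc.
have sR : side 1 c (endR c) := side_endL (l := 1) vc kc.
rewrite /walkT decode_cat dR (decode_turn (p' := ((wd c)%:Z - 1, (tp c)%:Z - 1)))//.
- have eT : endT c = ((wd c)%:Z - 1, (tp c)%:Z) by apply: siteP.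
  by rewrite eT /= ltxx lexx.
- by rewrite /= eqxx /bt /=; lia.
- by rewrite adjacentE /dist /= e1 e2; lia.
- exact: aligned_RT.
- by move: sR; rewrite /between /= e1 e2 r1; lia.
Qed.

(** The walk goes through the levels downwards from [kind c], and each lower level is reached by a
    corner turn that leaves the code unchanged. *)
Lemma decode_lower c : valid c ->
  decode (walkL (kind c) c) = (c, kind c, endL (kind c) c) ->
  forall l, (l <= kind c)%N -> decode (walkL l c) = (c, l, endL l c).
Proof.
move=> vc; have := kind_le2 c.
case kE : (kind c) => [|[|[|k]]] //= _ dk.
- by case.
- by case=> [|[|l]]// _; apply: decode_walkT => //; rewrite kE.
have dR : decode (walkR c) = (c, 1%N, endR c) by apply: decode_walkR => //; rewrite kE.
by case=> [|[|[|l]]]// _; apply: decode_walkT => //; rewrite kE.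
Qed.

Lemma decode_walkL c l : valid c -> (l <= kind c)%N ->
  decode (walkL l c) = (c, l, endL l c).
Proof.
suff top d : valid d -> forall m, m = kind d ->
    decode (walkL m d) = (d, m, endL m d).
  by move=> vc; apply: (decode_lower vc); apply: top.
elim: d => [|d IH k|d IH k|d IH k] vd m mE.
- by rewrite mE /= /walkR /= segpp.
- have /= /and3P[vd0 k0 kw] := vd; have [w0 t0 th0 _] := valid_dims vd0.
  have dT := decode_lower vd0 (IH vd0 _ erefl) (leq0n _).
  have sT : side 0 d (endT d) := side_endL (l := 0) vd0 (leq0n _).
  have [kk|kk] := leqP k (wd d).
    have {mE}-> : m = 0%N by rewrite mE /= ltnNge kk.
    rewrite [walkL _]/= [endL _]/= /walkT /walkR walkB_Top 2!decode_cat [decode _]dT.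
    rewrite decode_slide//; last first.
      by rewrite /= eqxx /=; lia.
    rewrite seg_adjacent /=; last by rewrite adjacentE /dist /=; lia.
    by rewrite ifT; [congr (Top _ _, _, _); lia|lia].
  have {mE}-> : m = 1%N by rewrite mE /= kk.
  rewrite [walkL _]/= [endL _]/= /walkR walkB_Top decode_cat [decode _]dT.
  have -> : k = (wd d).+1 by lia.
  rewrite (decode_turn (p' := ((wd d)%:Z - 1, (tp d)%:Z)))//.
  + by rewrite /= ltxx ifT//; lia.
  + by rewrite /= eqxx /=; lia.
  + by rewrite adjacentE /dist /=; lia.
  + by rewrite /aligned endT2 eqxx orbT.
  + by move: sT; rewrite /between /=; lia.
- have /= /and4P[vd0 kc k0 kw] := vd; have [w0 t0 th0 _] := valid_dims vd0.
  have dR := decode_lower vd0 (IH vd0 _ erefl) kc.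
  have sR : side 1 d (endR d) := side_endL (l := 1) vd0 kc.
  have [kk|kk] := leqP k (ht d).
    have {mE}-> : m = 1%N by rewrite mE /= ltnNge kk.
    rewrite [walkL _]/= [endL _]/= {1}/walkR [walkB _]/= -/(walkR d) 2!decode_cat.
    rewrite [decode _]dR decode_slide//; last first.
      by rewrite /= eqxx /bt /=; lia.
    rewrite seg_adjacent /=; last by rewrite adjacentE /dist /=; lia.
    by rewrite ifT; [congr (Right _ _, _, _); lia|lia].
  have {mE}-> : m = 2%N by rewrite mE /= kk.
  rewrite [walkL _]/= [endL _]/= [walkB _]/= -/(walkR d) decode_cat [decode _]dR.
  have -> : k = (ht d).+1 by lia.
  rewrite (decode_turn (p' := ((wd d)%:Z - 1, bt d)))//.
  + by rewrite /= ltxx /bt ifF ?ifT//; lia.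
  + by rewrite /= eqxx /bt /=; lia.
  + by rewrite adjacentE /dist /bt /=; lia.
  + by rewrite /aligned endR1// eqxx.
  + by move: sR; rewrite /between /= /bt /=; lia.
- have /= /and4P[vd0 kc k0 kw] := vd; have [w0 t0 th0 _] := valid_dims vd0.
  have dB := decode_lower vd0 (IH vd0 _ erefl) kc.
  have sB : side 2 d (endB d) := side_endL (l := 2) vd0 kc.
  rewrite {}mE [walkL _]/= [endL _]/= [walkB _]/= 2!decode_cat [decode _]dB decode_slide//; last first.
    by rewrite /= eqxx /=; lia.
  rewrite seg_adjacent /=; last by rewrite adjacentE /dist /=; lia.
  by rewrite ifT; [congr (Bottom _ _, _, _); lia|lia].
Qed.

Lemma full_split c : valid c -> exists w, full c =
  (walkT c ++ seg (endT c) (0, (tp c)%:Z)) ++ (-1, (tp c)%:Z) :: w.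
Proof.
move=> vc; have sT : side 0 c (endT c) := side_endL (l := 0) vc (leq0n _).
exists (seg (-1, (tp c)%:Z) (-1, 0)).
rewrite /full -cat_rcons -cats1 -[(_ ++ seg (endT c) (0, _)) ++ _]catA seg_extend//.
- by rewrite /aligned endT2 eqxx orbT.
- by rewrite adjacentE /dist /=; lia.
- by rewrite /aligned endT2 eqxx orbT.
- by move: sT; rewrite /between /=; lia.
Qed.

(** [decode] is a left inverse once the walk is cut before its first site of negative abscissa, a
    cut that depends on the walk alone. *)
Lemma full_inj c c' : valid c -> valid c' -> full c = full c' -> c = c'.
Proof.
have firstneg d : valid d -> let w := full d in
    let i := find (fun s : site => s.1 < 0) w in
    decode (take i w) = (d, 0%N, (0, (tp d)%:Z)).
  move=> vd; have [w wE] := full_split vd; rewrite wE /=.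
  have sT : side 0 d (endT d) := side_endL (l := 0) vd (leq0n _).
  have [w0 t0 th0 _] := valid_dims vd.
  have al : aligned (endT d) (0, (tp d)%:Z) by rewrite /aligned endT2 eqxx orbT.
  rewrite find_cat /= ifF.
    rewrite addn0 take_size_cat// decode_cat.
    rewrite [decode _](decode_walkL (l := 0) vd (leq0n _)) decode_slide//.
    by rewrite /= eqxx /=; lia.
  apply/negbTE/hasPn => s; rewrite mem_cat -leNgt.
  have [[_ bT] _ _] := soundP vd.
  case/orP => [sw|]; first by have := bT s; rewrite inE sw orbT => /(_ isT) /and3P[/andP[]].
  by rewrite mem_seg// => /and3P[_ + _]; move: sT; rewrite /between /=; lia.
by move=> vc vc' e; have := firstneg _ vc; rewrite e /= firstneg// => -[->].
Qed.

(** * Symmetries of the square *)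

Definition flip (b : bool) (x : int) : int := if b then - x else x.
Definition sym (g : bool * bool * bool) (p : site) : site :=
  let: (sw, s1, s2) := g in
  if sw then (flip s1 p.2, flip s2 p.1) else (flip s1 p.1, flip s2 p.2).
(* Unit cells are named after their lower left corners, which [sym] need not
   map to lower left corners. *)
Definition flipc (b : bool) (x : int) : int := if b then - x - 1 else x.
Definition symc (g : bool * bool * bool) (p : site) : site :=
  let: (sw, s1, s2) := g in
  if sw then (flipc s1 p.2, flipc s2 p.1) else (flipc s1 p.1, flipc s2 p.2).
Definition symV (g : bool * bool * bool) : bool * bool * bool :=
  let: (sw, s1, s2) := g in if sw then (sw, s2, s1) else g.
(** Determinant -1: such a symmetry exchanges left and right cells. *)
Definition reversing (g : bool * bool * bool) : bool :=
  let: (sw, s1, s2) := g in sw (+) s1 (+) s2.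

Lemma symK g : cancel (sym g) (sym (symV g)).
Proof.
by case: g => [[[] []] []] [x y]; rewrite /sym /flip /= ?opprK.
Qed.

Lemma symVK g : cancel (sym (symV g)) (sym g).
Proof.
by case: g => [[[] []] []] [x y]; rewrite /sym /flip /= ?opprK.
Qed.

Lemma symcK g : cancel (symc g) (symc (symV g)).
Proof.
by case: g => [[[] []] []] [x y]; rewrite /symc /flipc /=; congr pair; lia.
Qed.

Lemma symcVK g : cancel (symc (symV g)) (symc g).
Proof.
by case: g => [[[] []] []] [x y]; rewrite /symc /flipc /=; congr pair; lia.
Qed.

Lemma dist_sym g p p' : dist (sym g p) (sym g p') = dist p p'.
Proof.
by case: g => [[[] []] []]; case: p p' => a b [c d]; rewrite /dist /sym /flip /=; lia.
Qed.

Lemma dist_symc g p p' : dist (symc g p) (symc g p') = dist p p'.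
Proof.
by case: g => [[[] []] []]; case: p p' => a b [c d]; rewrite /dist /symc /flipc /=; lia.
Qed.

Lemma adjacent_sym g p p' : adjacent (sym g p) (sym g p') = adjacent p p'.
Proof. by rewrite !adjacentE dist_sym. Qed.

Lemma adjacent_symc g p p' : adjacent (symc g p) (symc g p') = adjacent p p'.
Proof. by rewrite !adjacentE dist_symc. Qed.

Lemma ahead_sym g p p' s : ahead (sym g p) (sym g p') (sym g s) = ahead p p' s.
Proof.
by case: g => [[[] []] []]; case: p p' s => a b [c d] [x y];
  rewrite /ahead /sym /flip /=; lia.
Qed.

(** Twice the centre of the left cell is the sum of the two sites plus the step turned left. In this
    form the action of the symmetries is linear arithmetic. *)
Lemma left_cell_double p p' : adjacent p p' ->
  (left_cell p p').1 * 2 = p.1 + p'.1 - (p'.2 - p.2) - 1 /\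
  (left_cell p p').2 * 2 = p.2 + p'.2 + (p'.1 - p.1) - 1.
Proof.
by apply: (adjacent_cases (P := fun p p' => _ /\ _)) => x y;
  rewrite left_cell_unit /=; lia.
Qed.

Lemma left_cell_sym g p p' : adjacent p p' -> left_cell (sym g p) (sym g p') =
  symc g (if reversing g then right_cell p p' else left_cell p p').
Proof.
move=> adj; have adjg : adjacent (sym g p) (sym g p') by rewrite adjacent_sym.
have adj' : adjacent p' p by rewrite adjacentC.
have := left_cell_double adj; have := left_cell_double adj'; have := left_cell_double adjg.
rewrite /right_cell; move: (left_cell (sym _ _) _) (left_cell p' p) (left_cell p p').
move=> [a b] [a1 b1] [a2 b2].
case: g {adjg} => [[[] []] []]; case: p p' {adj adj'} => x y [x' y'];
by rewrite /sym /symc /flip /flipc /= => -[? ?] [? ?] [? ?]; congr pair; lia.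
Qed.

Lemma sym0 g : sym g (0, 0) = (0, 0).
Proof. by case: g => [[[] []] []]; rewrite /sym /flip /= ?oppr0. Qed.

Lemma sites_sym g w : sites (map (sym g) w) = map (sym g) (sites w).
Proof. by rewrite /sites map_cons sym0. Qed.

Lemma endpoint_sym g w : endpoint (map (sym g) w) = sym g (endpoint w).
Proof. by rewrite /endpoint -(last_map (sym g)) sym0. Qed.

Lemma prudent_sym g w : prudent w -> prudent (map (sym g) w).
Proof.
elim/last_ind: w => [_|w p IH /prudent_rcons[pw adj free]]; first exact: prudent_nil.
rewrite map_rcons; apply/prudent_rcons; rewrite endpoint_sym adjacent_sym.
split=> //; first exact: IH.
by rewrite sites_sym => _ /mapP[s sw ->]; rewrite ahead_sym; apply: free.
Qed.

Lemma prudent_polygon_sym g w : prudent_polygon w -> prudent_polygon (map (sym g) w).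
Proof.
case=> pw sw aw; split; first exact: prudent_sym.
  by rewrite size_map.
by rewrite endpoint_sym -(sym0 g) adjacent_sym.
Qed.

Section SymmetricCopy.
Variables (g : bool * bool * bool) (w : walk).
Hypothesis pw : prudent_polygon w.

Lemma polygon_next p : p \in sites w -> adjacent p (next (sites w) p).
Proof. by have [[ww _ _] _ cw] := pw; apply: adjacent_next. Qed.

(** A reversing symmetry swaps the two cells of each edge, which [separated] does not see, being
    symmetric in them. *)
Lemma separated_sym c c' :
  separated (map (sym g) w) (symc g c) (symc g c') = separated w c c'.
Proof.
rewrite /separated sites_sym has_map; apply: eq_in_has => p sp /=.
have adj := polygon_next sp; have adj' := adj; rewrite adjacentC in adj'.
rewrite /edge_cells sites_sym (next_map (can_inj (symK g))).
rewrite /right_cell !left_cell_sym// /right_cell !inE !xpair_eqE.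
case: (reversing g); rewrite !(can_eq (symcK g))//.
  by rewrite orbC andbC; congr (_ || _); rewrite andbC.
by have [[_ uw _] _ _] := pw.
Qed.

Lemma communicating_sym c c' :
  communicating (map (sym g) w) (symc g c) (symc g c') = communicating w c c'.
Proof. by rewrite /communicating adjacent_symc separated_sym. Qed.

Lemma component_sym c :
  component (map (sym g) w) (symc g c) = symc g @` component w c.
Proof.
apply/seteqP; split=> d /=.
  case=> s ps ls; exists (symc (symV g) d); last exact: symcVK.
  exists (map (symc (symV g)) s); last by rewrite -(symcK g c) last_map ls.
  rewrite -[c](symcK g); apply: homo_path ps => a b.
  by rewrite -{1}[a](symcVK g) -{1}[b](symcVK g) communicating_sym.
case=> _ [s ps <-] <-; exists (map (symc g) s); last by rewrite last_map.
by apply: homo_path ps => a b; rewrite communicating_sym.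
Qed.

Lemma enclosed_sym c : enclosed (map (sym g) w) (symc g c) <-> enclosed w c.
Proof.
rewrite /enclosed /= component_sym; split; last exact: finite_image.
move=> /(finite_image (symc (symV g))); rewrite image_comp.
rewrite (_ : _ \o _ = id) ?image_id//.
by apply/funext => d /=; rewrite symcK.
Qed.
End SymmetricCopy.

Lemma next_end w : uniq (sites w) -> next (sites w) (endpoint w) = (0, 0).
Proof.
move=> us; have nl : nth (0, 0) (sites w) (size w) = endpoint w.
  by rewrite -[size w]/(size (sites w)).-1 nth_last.
by rewrite -nl -(nth_map _ (0, 0))// map_next// nth_rcons ltnn eqxx.
Qed.

Lemma full_end c : valid c -> exists w, full c = rcons (rcons w (-1, 1)) (-1, 0).
Proof.
move=> vc; have [w0 t0 _ _] := valid_dims vc; rewrite /full; set U := walkT c ++ _.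
have eU : endpoint U = (-1, (tp c)%:Z).
  apply: endpoint_cat; first exact: walkT_end.
  by rewrite /aligned endT2 eqxx orbT.
have al : aligned (-1, (tp c)%:Z) (-1, 0) by rewrite /aligned eqxx.
rewrite seg_rcons//; last by rewrite siteE /=; lia.
rewrite (_ : before _ _ = (-1, 1)); last first.
  by rewrite /before subrr sgz0 subr0; congr pair => /=; case: sgzP; lia.
rewrite -rcons_cat; set V := U ++ _.
have eV : endpoint V = (-1, 1) by apply: endpoint_cat; rewrite /aligned ?eqxx.
case/lastP: V eV => [//|w p]; rewrite endpoint_rcons => ->.
by exists w.
Qed.

Definition syms : seq (bool * bool * bool) :=
  [seq (a, b) | a <- [seq (a, b) | a <- [:: true; false], b <- [:: true; false]],
                b <- [:: true; false]].

Lemma mem_syms g : g \in syms.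
Proof. by case: g => [[[] []] []]. Qed.

(** Only the identity fixes both of the last two sites [(-1, 1)] and [(-1, 0)], so their images
    determine the symmetry. *)
Lemma sym_full_inj g g' c c' : valid c -> valid c' ->
  map (sym g) (full c) = map (sym g') (full c') -> (g, c) = (g', c').
Proof.
move=> vc vc' e; have {vc vc'} [eg inj] : g = g' /\ (g = g' -> c = c').
  split; last first.
    move=> eg; move: e; rewrite -eg => /(inj_map (can_inj (symK g))).
    exact: full_inj.
  have [w we] := full_end vc; have [w' we'] := full_end vc'.
  move: e; rewrite we we' !map_rcons => /rcons_inj[/rcons_inj[_]].
  by case: g => [[[] []] []]; case: g' => [[[] []] []].
by rewrite (inj eg) eg.
Qed.

(** The last step neither points at the origin nor comes from it, so it is perpendicular to the
    closing edge; the eight such configurations are the images of the step from [(-1, 1)] to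
    [(-1, 0)]. *)
Lemma polygon_sym_full w : prudent_polygon w -> exists g c,
  valid c /\ w = map (sym g) (full c).
Proof.
move=> pw; have [pr sw aw] := pw.
case/lastP: w pw pr sw aw => [//|w e] pw pr sw aw.
case/lastP: w pw pr sw aw => [//|w a] pw pr sw aw.
have [pwa adj free] := (prudent_rcons _ _).1 pr; rewrite endpoint_rcons in adj free.
rewrite endpoint_rcons in aw.
have an0 : a != (0, 0).
  by have := prudent_fresh pwa; apply: contra => /eqP ->; rewrite inE eqxx.
have /free nb : (0, 0) \in sites (rcons w a) by rewrite inE eqxx.
have [g [ge ga]] : exists g, sym g (-1, 0) = e /\ sym g (-1, 1) = a.
  move: aw adj nb an0; rewrite !adjacentE /dist /ahead siteE.
  case: a {pw pr pwa free sw} => x y; case: e => x' y' /= aw adj nb an0.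
  have [x'0|x'0] := eqVneq x' 0; have [y'0|y'0] := eqVneq y' 0.
  - by lia.
  - have [yp|yn] := ltP 0 y'; have [xp|xn] := ltP 0 x.
    + by exists (true, false, true); rewrite /sym /flip /=; split; congr pair; lia.
    + by exists (true, true, true); rewrite /sym /flip /=; split; congr pair; lia.
    + by exists (true, false, false); rewrite /sym /flip /=; split; congr pair; lia.
    + by exists (true, true, false); rewrite /sym /flip /=; split; congr pair; lia.
  - have [xp|xn] := ltP 0 x'; have [yp|yn] := ltP 0 y.
    + by exists (false, true, false); rewrite /sym /flip /=; split; congr pair; lia.
    + by exists (false, true, true); rewrite /sym /flip /=; split; congr pair; lia.
    + by exists (false, false, false); rewrite /sym /flip /=; split; congr pair; lia.
    + by exists (false, false, true); rewrite /sym /flip /=; split; congr pair; lia.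
  - by lia.
set w' := map (sym (symV g)) (rcons (rcons w a) e).
have w'E : w' = rcons (rcons (map (sym (symV g)) w) (-1, 1)) (-1, 0).
  by rewrite /w' !map_rcons -ge -ga !symK.
have pw' : prudent w' by apply: prudent_sym.
rewrite w'E in pw'; have [c vc ce] := descending_polygon_full pw'.
exists g, c; split=> //; rewrite -ce -w'E /w' -map_comp.
by rewrite map_id_in// => s _ /=; rewrite symVK.
Qed.

Lemma base_classE w : base_class w <-> exists2 c, valid c & w = full c.
Proof.
split; last by case=> c vc ->; exact: base_class_full.
case=> pw ew ccw; have [g [c [vc wE]]] := polygon_sym_full pw; exists c => //.
have [[_ uw _] _ _] := pw; have pc := prudent_polygon_full vc.
have := ccw (endpoint w) (end_in w); rewrite next_end// ew.
rewrite (_ : left_cell _ _ = (-1, 0)); last exact: (left_cellE (-1) 0).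
move: ew; rewrite wE endpoint_sym; have [_ _ ->] := prudent_full vc.
(* Only the identity and the reflection in the horizontal axis fix [(-1, 0)]. Under the latter, the
   cell left of the closing edge is the image of [(-1, -1)], which is not enclosed. *)
case: g wE => [[[] []] []] wE //=.
  rewrite (_ : (-1, 0) = symc (false, false, true) (-1, -1)) // => _.
  move/(enclosed_sym _ pc); rewrite enclosed_full//= mem_cells cell_left//.
by move=> *; rewrite -[RHS]map_id; apply: eq_map => -[x y].
Qed.

Lemma area_sym g c : valid c -> area (map (sym g) (full c)) = ar c.
Proof.
move=> vc; have pc := prudent_polygon_full vc; rewrite /area.
rewrite (_ : enclosed _ = [set` map (symc g) (cells c)]).
  by rewrite card_seq ?size_map ?size_cells// map_inj_uniq ?uniq_cells//; exact: can_inj (symcK g).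
apply/seteqP; split=> d; rewrite -[d](symcVK g); move: (symc _ d) => e.
  move/(enclosed_sym g pc); rewrite enclosed_full//= => ce.
  by rewrite mem_map//; exact: can_inj (symcK g).
rewrite /= mem_map; last exact: can_inj (symcK g).
by move=> ce; apply/(enclosed_sym g pc); rewrite enclosed_full.
Qed.

(** * Counting codes *)

HB.instance Definition _ := gen_eqMixin code.

Definition children (c : code) (m : nat) : seq code :=
  (if (0 < m <= (wd c).+1)%N then [:: Top c m] else [::]) ++
  (if (0 < kind c)%N && (0 < m <= (ht c).+1)%N then [:: Right c m] else [::]) ++
  (if (1 < kind c)%N && (0 < m < wd c)%N then [:: Bottom c m] else [::]).

(** Every operation adds at least one cell, so [n] units of fuel suffice for area [n], and the
    enumeration can be run. *)
Fixpoint codes_fuel (f n : nat) : seq code :=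
  if f is f'.+1 then
    (if n == 1%N then [:: Unit] else [::]) ++
    flatten [seq flatten [seq children c m | c <- codes_fuel f' (n - m)] | m <- iota 1 n]
  else [::].
Definition codes n := codes_fuel n n.

Lemma codes_fuelE f g n : (n <= f)%N -> (n <= g)%N -> codes_fuel f n = codes_fuel g n.
Proof.
elim: f g n => [|f IH] [|g] n //=; rewrite ?leqn0; try by move=> /eqP -> //.
  by move=> _ /eqP ->.
move=> nf ng; congr (_ ++ flatten _); apply/eq_in_map => m.
by rewrite mem_iota => mn; rewrite (IH g) //; lia.
Qed.

Lemma codesE n : codes n = (if n == 1%N then [:: Unit] else [::]) ++
  flatten [seq flatten [seq children c m | c <- codes (n - m)] | m <- iota 1 n].
Proof.
case: n => [//|n]; rewrite {1}/codes.
rewrite -[codes_fuel n.+1 n.+1]/((if n.+1 == 1%N then [:: Unit] else [::]) ++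
  flatten [seq flatten [seq children c m | c <- codes_fuel n (n.+1 - m)] |
    m <- iota 1 n.+1]).
congr (_ ++ flatten _); apply/eq_in_map => m; rewrite mem_iota => mn.
by congr (flatten (map _ _)); apply: codes_fuelE; lia.
Qed.

Lemma count_codes P n : count P (codes n) = (P Unit && (n == 1%N) +
  \sum_(m <- iota 1 n) \sum_(c <- codes (n - m)) count P (children c m))%N.
Proof.
rewrite codesE count_cat; congr (_ + _)%N.
  by case: (n == _); rewrite /= ?addn0 ?andbT ?andbF.
rewrite count_flatten sumnE !big_map; apply: eq_bigr => m _.
by rewrite count_flatten sumnE !big_map.
Qed.

Lemma sum_count (T : Type) (P : pred T) (s : seq T) :
  (\sum_(c <- s) P c)%N = count P s.
Proof. by elim: s => [|c s IH]; rewrite ?big_nil ?big_cons //= IH. Qed.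

Lemma count_children P c m : count P (children c m) = 
  ([&& (0 < m <= (wd c).+1)%N & P (Top c m)] +
   [&& (0 < kind c)%N, (0 < m <= (ht c).+1)%N & P (Right c m)] +
   [&& (1 < kind c)%N, (0 < m < wd c)%N & P (Bottom c m)])%N.
Proof.
have count_if (b : bool) (d : code) : count P (if b then [:: d] else [::]) = (b && P d).
  by case: b; rewrite /= ?addn0.
by rewrite /children !count_cat addnA !count_if -!andbA.
Qed.

Lemma sum_iota1 (F : nat -> nat) n k : 
  (\sum_(m <- iota 1 n) (m == k) * F m = (0 < k <= n) * F k)%N.
Proof.
elim: n => [|n IH]; first by rewrite big_nil (_ : (0 < k <= 0)%N = false)//; lia.
rewrite -(addn1 n) (iotaD 1 n 1) big_cat big_seq1 IH add1n /=.
have [<-|ne] := eqVneq n.+1 k; first by rewrite ltnn addn1 ltnSn !mul1n.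
by rewrite mul0n addn0; congr (nat_of_bool _ * _)%N; lia.
Qed.

(** Equality of codes comes from classical logic and does not compute, so constructors are compared
    by rewriting. *)
Lemma eq_code : (forall c m d k, (Top c m == Top d k) = (c == d) && (m == k)) *
  (forall c m d k, (Right c m == Right d k) = (c == d) && (m == k)) *
  (forall c m d k, (Bottom c m == Bottom d k) = (c == d) && (m == k)) *
  ((forall c m d k, (Top c m == Right d k) = false) *
  (forall c m d k, (Top c m == Bottom d k) = false) *
  (forall c m d k, (Right c m == Top d k) = false) *
  (forall c m d k, (Right c m == Bottom d k) = false) *
  (forall c m d k, (Bottom c m == Top d k) = false) *
  (forall c m d k, (Bottom c m == Right d k) = false)) *
  ((forall d k, (Unit == Top d k) = false) * (forall d k, (Unit == Right d k) = false) *
  (forall d k, (Unit == Bottom d k) = false) * (forall d k, (Top d k == Unit) = false) *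
  (forall d k, (Right d k == Unit) = false) * (forall d k, (Bottom d k == Unit) = false)).
Proof.
by do !split => *; do [apply/eqP/andP => [[-> ->]//|[/eqP-> /eqP->]//]|exact/eqP].
Qed.

Lemma sum_codes n (F : code -> nat -> bool) (y : code) k :
  (forall m, count_mem y (codes m) = valid y && (ar y == m)) ->
  (forall c m, F c m = [&& c == y, m == k & F y k]) ->
  (\sum_(m <- iota 1 n) \sum_(c <- codes (n - m)) F c m)%N =
  [&& valid y, ar y + k == n, (0 < k)%N & F y k]%N.
Proof.
move=> IH FE; rewrite (eq_bigr (fun m => (m == k) *
    ((count_mem y (codes (n - m))) * F y k)))%N; last first.
  move=> m _; rewrite -sum_count big_distrl big_distrr /=; apply: eq_bigr => c _.
  by rewrite FE; case: (c == y); case: (m == k); case: (F y k).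
rewrite sum_iota1 IH; case: (F y k); case: (valid y); rewrite ?muln0 ?andbF//= ?muln1 ?andbT.
by rewrite mulnb; lia.
Qed.

(** Computing multiplicities gives membership and the absence of repetitions at once. *)
Lemma count_mem_codes x n : count_mem x (codes n) = valid x && (ar x == n).
Proof.
elim: x n => [|x IH k|x IH k|x IH k] n; rewrite count_codes.
- rewrite big1 ?addn0 /= => [|m _]; first by rewrite eqxx eq_sym.
  by rewrite big1// => c _; rewrite count_children /= !eq_code !andbF.
- rewrite /= eq_code add0n.
  rewrite (eq_bigr (fun m => \sum_(c <- codes (n - m))
     ([&& c == x, m == k & (0 < k <= (wd x).+1)%N] : nat))%N); last first.
    move=> m _; apply: eq_bigr => c _.
    rewrite count_children /= !eq_code !andbF !addn0.
    by case: eqP => [->|] //=; rewrite ?andbF//; case: eqP => [->|] /=; rewrite ?andbT ?andbF.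
  rewrite (@sum_codes n (fun c m => [&& c == x, m == k & (0 < k <= (wd x).+1)%N]) x k)//=.
    by rewrite !eqxx; case: (valid x); lia.
  by move=> c m; rewrite !eqxx.
- rewrite /= eq_code add0n.
  rewrite (eq_bigr (fun m => \sum_(c <- codes (n - m))
     ([&& c == x, m == k, (0 < kind x)%N & (0 < k <= (ht x).+1)%N] : nat))%N); last first.
    move=> m _; apply: eq_bigr => c _.
    rewrite count_children /= !eq_code !andbF !addn0.
    by case: eqP => [->|] //=; rewrite ?andbF//; case: eqP => [->|] /=; rewrite ?andbT ?andbF.
  rewrite (@sum_codes n (fun c m => [&& c == x, m == k, (0 < kind x)%N & (0 < k <= (ht x).+1)%N]) x k)//=.
    by rewrite !eqxx; case: (valid x); case: (0 < kind x)%N; lia.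
  by move=> c m; rewrite !eqxx.
- rewrite /= eq_code add0n.
  rewrite (eq_bigr (fun m => \sum_(c <- codes (n - m))
     ([&& c == x, m == k, (1 < kind x)%N & (0 < k < wd x)%N] : nat))%N); last first.
    move=> m _; apply: eq_bigr => c _.
    rewrite count_children /= !eq_code !andbF !add0n.
    by case: eqP => [->|] //=; rewrite ?andbF//; case: eqP => [->|] /=; rewrite ?andbT ?andbF.
  rewrite (@sum_codes n (fun c m => [&& c == x, m == k, (1 < kind x)%N & (0 < k < wd x)%N]) x k)//=.
    by rewrite !eqxx; case: (valid x); case: (1 < kind x)%N; lia.
  by move=> c m; rewrite !eqxx.
Qed.

Lemma mem_codes c n : (c \in codes n) = valid c && (ar c == n).
Proof. by rewrite -has_pred1 has_count count_mem_codes lt0b. Qed.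

Lemma uniq_codes n : uniq (codes n).
Proof. by apply: count_mem_uniq => x; rewrite count_mem_codes mem_codes. Qed.

(** * Recurrences for the numbers of codes *)

Definition num (k n i j : nat) : nat :=
  count (fun c => [&& kind c == k, wd c == i & ht c == j]) (codes n).
Definition num12 n i j := (num 1 n i j + num 2 n i j)%N.
Definition num012 n i j := (num 0 n i j + num12 n i j)%N.

Lemma num_card (K : set walk) k n i j :
  (forall w, K w -> base_class w) ->
  (forall c, valid c -> K (full c) <-> kind c = k) ->
  Defs.card [set w | [/\ K w, area w = n, width (enclosed w) = i &
     height (enclosed w) = j]] = num k n i j.
Proof.
move=> Kb Kk; pose P c := [&& kind c == k, wd c == i & ht c == j].
rewrite /num -size_filter -(size_map full).
rewrite -(card_seq (s := map full (filter P (codes n)))); last first.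
  rewrite map_inj_in_uniq ?filter_uniq ?uniq_codes// => c d.
  rewrite !mem_filter !mem_codes => /and3P[_ vc _] /and3P[_ vd _].
  exact: full_inj.
congr (Defs.card _); apply/seteqP; split=> w /=.
  case=> Kw an wi hj; have [c vc e] := (base_classE w).1 (Kb _ Kw).
  subst w; apply: map_f; rewrite mem_filter mem_codes vc.
  move: an wi hj; rewrite area_full// enclosed_full// width_cells// height_cells//.
  by rewrite /P => -> -> ->; rewrite !eqxx !andbT; apply/eqP/Kk.
case/mapP => c; rewrite mem_filter mem_codes /P.
case/andP => /and3P[/eqP kk /eqP wi /eqP hj] /andP[vc /eqP an] ->.
by rewrite area_full// enclosed_full// width_cells// height_cells//; split=> //; apply/Kk.
Qed.

Lemma X_coef n i j : X n i j = (num 0 n i j)%:Z.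
Proof.
rewrite /X /=; congr (_%:Z); apply: num_card; last exact: classXE.
by move=> w [].
Qed.

Lemma Y_coef n i j : Y n i j = (num 1 n j i)%:Z.
Proof.
rewrite /Y /=; congr (_%:Z); rewrite -(@num_card classY); last exact: classYE.
  by congr (Defs.card _); apply/seteqP; split=> w /= [].
by move=> w [->|[]//]; apply/base_classE; exists Unit.
Qed.

Lemma Z_coef n i j : Z n i j = (num 2 n i.+1 j)%:Z.
Proof.
rewrite /Z /=; congr (_%:Z); apply: num_card; last exact: classZE.
by move=> w [].
Qed.

Lemma num12E n i j : num12 n i j =
  count (fun c => [&& (0 < kind c)%N, wd c == i & ht c == j]) (codes n).
Proof.
rewrite /num12 /num -!sum_count -big_split /=; apply: eq_bigr => c _.
by have := kind_le2 c; case: (kind c) => [|[|[|k]]] //=; rewrite addn0.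
Qed.

Lemma num012E n i j : num012 n i j =
  count (fun c => (wd c == i) && (ht c == j)) (codes n).
Proof.
rewrite /num012 num12E /num -!sum_count -big_split /=; apply: eq_bigr => c _.
by case: (kind c) => [|k] //=; rewrite addn0.
Qed.

Lemma sum_iota_lt (F : nat -> nat) n i :
  (\sum_(m <- iota 1 n) (m <= i) * F m = \sum_(k < i) (k < n) * F k.+1)%N.
Proof.
transitivity (\sum_(1 <= m < n.+1) (m <= i) * F m)%N.
  by rewrite /index_iota subSS subn0.
rewrite big_add1 big_mkord /=.
rewrite (big_ord_widen (n + i) (fun k => (k < i) * F k.+1)%N) ?leq_addr//.
rewrite (big_ord_widen (n + i) (fun k => (k < n) * F k.+1)%N) ?leq_addl//.
rewrite big_mkcond [RHS]big_mkcond; apply: eq_bigr => k _.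
by case: (k < n)%N; case: (k < i)%N.
Qed.

Lemma count_sum3 P n : count P (codes n) = (P Unit && (n == 1%N) +
  (\sum_(m <- iota 1 n) count (fun c => (m <= (wd c).+1)%N && P (Top c m)) (codes (n - m)) +
   \sum_(m <- iota 1 n) count (fun c => [&& (0 < kind c)%N, (m <= (ht c).+1)%N & P (Right c m)])
     (codes (n - m)) +
   \sum_(m <- iota 1 n) count (fun c => [&& (1 < kind c)%N, (m < wd c)%N & P (Bottom c m)])
     (codes (n - m))))%N.
Proof.
rewrite count_codes -!big_split /=; congr (_ + _)%N; apply: eq_big_seq => m.
rewrite mem_iota => /andP[m0 _]; rewrite -!sum_count -!big_split /=.
by apply: eq_bigr => c _; rewrite count_children m0.
Qed.

(** The last row has [k + 1] cells, at most the width, and lies on a polygon of any kind; [k < n]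
    guards the truncated subtraction. *)
Lemma num_rec0 n i j : num 0 n i j.+1 =
  (\sum_(k < i) (k < n) * num012 (n - k.+1) i j)%N.
Proof.
rewrite -(sum_iota_lt (fun m => num012 (n - m) i j)) /num count_sum3 /= add0n.
rewrite [X in (_ + X + _)%N]big1 ?addn0 => [|m _]; last first.
  by rewrite (eq_count (a2 := pred0)) ?count_pred0// => c; rewrite /= !andbF.
rewrite [X in (_ + X)%N]big1 ?addn0 => [|m _]; last first.
  by rewrite (eq_count (a2 := pred0)) ?count_pred0// => c; rewrite /= !andbF.
apply: eq_bigr => m _; rewrite num012E -!sum_count big_distrr /=; apply: eq_bigr => c _.
rewrite eqSS mulnb; congr (nat_of_bool _).
by case: (ht c == j); rewrite ?andbF ?andbT//; lia.
Qed.

Lemma num_rec00 n i : num 0 n i 0 = 0%N.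
Proof.
by rewrite /num (eq_count (a2 := pred0)) ?count_pred0//; case=> *; rewrite /= ?andbF.
Qed.

(** The three origins of kind 1: the unit square, a top row one cell longer than the old width, and
    a right column no longer than the height. *)
Lemma num_rec1 n i j : num 1 n i j =
  (((n == 1) && (i == 1) && (j == 1)) +
   (if (i, j) is (i'.+1, j'.+1) then (i'.+1 <= n) * num012 (n - i'.+1) i' j' else 0) +
   (if i is i'.+1 then \sum_(k < j) (k < n) * num12 (n - k.+1) i' j else 0))%N.
Proof.
rewrite /num count_sum3 /= [X in (_ + (_ + _ + X))%N]big1 ?addn0 => [|m _]; last first.
  by rewrite (eq_count (a2 := pred0)) ?count_pred0// => c; rewrite /= !andbF.
rewrite -addnA; congr (_ + (_ + _))%N.
- by rewrite andbC -andbA (eq_sym 1%N i) (eq_sym 1%N j).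
- case: i j => [|i] [|j].
  + rewrite big1_seq// => m _; rewrite (eq_count (a2 := pred0)) ?count_pred0// => c /=.
    by rewrite !andbF.
  + rewrite big1_seq// => m; rewrite mem_iota => mi.
    by rewrite (eq_count (a2 := pred0)) ?count_pred0// => c /=; lia.
  + rewrite big1_seq// => m _; rewrite (eq_count (a2 := pred0)) ?count_pred0// => c /=.
    by rewrite !andbF.
  rewrite -[RHS](sum_iota1 (fun m => num012 (n - m) i j)); apply: eq_bigr => m _.
  rewrite num012E -!sum_count big_distrr /=; apply: eq_bigr => c _.
  rewrite eqSS mulnb; congr (nat_of_bool _).
  by case: (ht c == j); rewrite ?andbF ?andbT//; lia.
- case: i => [|i].
    by rewrite big1// => m _; rewrite (eq_count (a2 := pred0)) ?count_pred0// => c; rewrite /= !andbF.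
  rewrite -(sum_iota_lt (fun m => num12 (n - m) i j)); apply: eq_bigr => m _.
  rewrite num12E -!sum_count big_distrr /=; apply: eq_bigr => c _.
  rewrite !eqSS mulnb; congr (nat_of_bool _).
  by case: (wd c == i); case: (0 < kind c)%N; rewrite ?andbF ?andbT//=; lia.
Qed.

(** The two origins of kind 2: a bottom row shorter than the width, and a right column one cell
    longer than the old height. *)
Lemma num_rec2 n i j : num 2 n i j =
  ((if j is j'.+1 then \sum_(k < i.-1) (k < n) * num 2 (n - k.+1) i j' else 0) +
   (if (i, j) is (i'.+1, j'.+1) then (j'.+1 <= n) * num12 (n - j'.+1) i' j' else 0))%N.
Proof.
rewrite /num count_sum3 /= add0n [X in (X + _ + _)%N]big1 ?add0n => [|m _]; last first.
  rewrite (eq_count (a2 := pred0)) ?count_pred0// => c /=.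
  by case: (_ < _)%N; rewrite /= ?andbF.
rewrite addnC; congr (_ + _)%N.
- case: j => [|j].
    by rewrite big1// => m _; rewrite (eq_count (a2 := pred0)) ?count_pred0// => c; rewrite /= !andbF.
  rewrite -(sum_iota_lt (fun m => num 2 (n - m) i j)); apply: eq_big_seq => m.
  rewrite mem_iota => mi; rewrite /num -!sum_count big_distrr /=; apply: eq_bigr => c _.
  rewrite eqSS mulnb; congr (nat_of_bool _).
  have := kind_le2 c; case: (ht c == j); rewrite ?andbF ?andbT//.
  by lia.
- case: i j => [|i] [|j].
  + by rewrite big1// => m _; rewrite (eq_count (a2 := pred0)) ?count_pred0// => c; rewrite /= !andbF.
  + by rewrite big1// => m _; rewrite (eq_count (a2 := pred0)) ?count_pred0// => c; rewrite /= !andbF.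
  + rewrite big1_seq// => m; rewrite mem_iota => mi.
    by rewrite (eq_count (a2 := pred0)) ?count_pred0// => c /=; lia.
  rewrite -[RHS](sum_iota1 (fun m => num12 (n - m) i j)); apply: eq_bigr => m _.
  rewrite num12E -!sum_count big_distrr /=; apply: eq_bigr => c _.
  rewrite !eqSS mulnb; congr (nat_of_bool _).
  by case: (wd c == i); case: (0 < kind c)%N; rewrite ?andbF ?andbT//=; lia.
Qed.

(** * Coefficients of power series *)

Section FpsCoef.
Variable R : comNzRingType.

Lemma fps_mulrE (f g : fps R) n : (f * g) n = \sum_(k < n.+1) f k * g (n - k)%N.
Proof. by []. Qed.

Lemma fps_addrE (f g : fps R) n : (f + g) n = f n + g n.
Proof. by []. Qed.

Lemma fps_oppE (f : fps R) n : (- f) n = - f n.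
Proof. by []. Qed.

Lemma fps_mulC_coef (c : R) (f : fps R) n : (fpsC c * f) n = c * f n.
Proof.
rewrite fps_mulrE big_ord_recl /= subn0 big1 ?addr0// => k _.
by rewrite mul0r.
Qed.

Lemma fps_mulX_coef (f : fps R) n : (fpsX R * f) n = if n is n'.+1 then f n' else 0.
Proof.
rewrite fps_mulrE; case: n => [|n]; first by rewrite big_ord_recl big_ord0 /= mul0r addr0.
rewrite !big_ord_recl /= mul0r add0r mul1r subSS subn0 big1 ?addr0// => k _.
by rewrite mul0r.
Qed.

Lemma fps_1E n : (1 : fps R) n = (n == 0%N)%:R.
Proof. by case: n. Qed.

Lemma fps_0E n : (0 : fps R) n = 0.
Proof. by case: n. Qed.
End FpsCoef.

Lemma coef_q (F : fps3) N I J :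
  (Defs.q * F) N I J = if N is N'.+1 then F N' I J else 0.
Proof. by rewrite fps_mulX_coef; case: N => //; rewrite !fps_0E. Qed.

Lemma coef_u (F : fps3) N I J :
  (Defs.u * F) N I J = if I is I'.+1 then F N I' J else 0.
Proof. by rewrite fps_mulC_coef fps_mulX_coef; case: I => //; rewrite !fps_0E. Qed.

Lemma coef_v (F : fps3) N I J :
  (Defs.v * F) N I J = if J is J'.+1 then F N I J' else 0.
Proof. by rewrite fps_mulC_coef fps_mulC_coef fps_mulX_coef. Qed.

Lemma coef_qX (F : fps3) n N I J :
  (Defs.q ^+ n * F) N I J = if (n <= N)%N then F (N - n)%N I J else 0.
Proof.
elim: n N => [|n IH] N; first by rewrite expr0 mul1r subn0.
by rewrite exprS -mulrA coef_q; case: N => [//|N]; rewrite IH subSS.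
Qed.

Lemma coef_uX (F : fps3) n N I J :
  (Defs.u ^+ n * F) N I J = if (n <= I)%N then F N (I - n)%N J else 0.
Proof.
elim: n I => [|n IH] I; first by rewrite expr0 mul1r subn0.
by rewrite exprS -mulrA coef_u; case: I => [//|I]; rewrite IH subSS.
Qed.

Lemma coef_vX (F : fps3) n N I J :
  (Defs.v ^+ n * F) N I J = if (n <= J)%N then F N I (J - n)%N else 0.
Proof.
elim: n J => [|n IH] J; first by rewrite expr0 mul1r subn0.
by rewrite exprS -mulrA coef_v; case: J => [//|J]; rewrite IH subSS.
Qed.

Definition mono (n i j : nat) : fps3 := Defs.q ^+ n * Defs.u ^+ i * Defs.v ^+ j.

Lemma coef_mono n i j N I J :
  mono n i j N I J = [&& N == n, I == i & J == j]%:R.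
Proof.
rewrite /mono -mulrA coef_qX -[_ ^+ j]mulr1 coef_uX coef_vX !fps_1E.
have eqn_sub (a b : nat) : (a == b) = (b <= a)%N && (a - b == 0)%N by lia.
rewrite (eqn_sub N) (eqn_sub I) (eqn_sub J).
case: (n <= N)%N => //=; case: (i <= I)%N => //=; rewrite ?andbF//.
case: (j <= J)%N => //=; rewrite ?andbF//.
case: (N - n == 0)%N; rewrite ?fps_1E ?fps_0E//=.
by case: (I - i == 0)%N; rewrite ?fps_1E ?fps_0E//=.
Qed.

Lemma substE F (a b : fps3) N I J : F@[a, b] N I J =
  \sum_(n < (N + I + J).+1) \sum_(i < (N + I + J).+1) \sum_(j < (N + I + J).+1)
    F n i j * (Defs.q ^+ n * a ^+ i * b ^+ j) N I J.
Proof. by []. Qed.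

Lemma sum_pick D n0 (G : nat -> int) : (n0 < D)%N ->
  (forall n, n != n0 -> G n = 0) -> \sum_(n < D) G n = G n0.
Proof.
move=> h G0; rewrite (bigD1 (Ordinal h)) //= big1 ?addr0// => n ne.
by apply: G0; apply: contra ne => /eqP e; apply/eqP/val_inj.
Qed.

(** For monomials [a] and [b] at most one term contributes; the bounds on [n0], [i0] and [j0] keep
    it inside the truncation. *)
Lemma subst_coef F (a b : fps3) N I J (n0 i0 j0 : nat) :
  (forall n i j, (Defs.q ^+ n * a ^+ i * b ^+ j) N I J =
     [&& n == n0, i == i0 & j == j0]%:R) ->
  (n0 <= N + I + J)%N -> (i0 <= N + I + J)%N -> (j0 <= N + I + J)%N ->
  F@[a, b] N I J = F n0 i0 j0.
Proof.
rewrite substE => H hn hi hj; set D := (N + I + J).+1.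
under eq_bigr do under eq_bigr do under eq_bigr do rewrite H.
rewrite (sum_pick (n0 := n0) (G := fun n => \sum_(i < D) \sum_(j < D) F n i j * [&& n == n0, (i : nat) == i0 & (j : nat) == j0]%:R))//; last first.
  move=> n /negbTE ->; rewrite big1// => i _; rewrite big1// => j _.
  by rewrite mulr0.
rewrite (sum_pick (n0 := i0) (G := fun i => \sum_(j < D) F n0 i j * [&& n0 == n0, (i : nat) == i0 & (j : nat) == j0]%:R))//; last first.
  by move=> i /negbTE ->; rewrite big1// => j _; rewrite andbF mulr0.
rewrite (sum_pick (n0 := j0) (G := fun j => F n0 i0 j * [&& n0 == n0, i0 == i0 & (j : nat) == j0]%:R))//; last first.
  by move=> i /negbTE ->; rewrite !andbF mulr0.
by rewrite !eqxx mulr1.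
Qed.

Lemma subst_coef0 F (a b : fps3) N I J :
  (forall n i j, (Defs.q ^+ n * a ^+ i * b ^+ j) N I J = 0) -> F@[a, b] N I J = 0.
Proof.
move=> H; rewrite substE big1// => n _; rewrite big1// => i _; rewrite big1// => j _.
by rewrite H mulr0.
Qed.

Lemma monomial_swap (R : comPzRingType) (q u v : R) n i j :
  q ^+ n * v ^+ i * u ^+ j = q ^+ n * u ^+ j * v ^+ i.
Proof. by rewrite mulrAC. Qed.

Lemma monomial_l (R : comPzRingType) (q u v : R) n i j :
  q ^+ n * (q * u) ^+ i * v ^+ j = q ^+ (n + i) * u ^+ i * v ^+ j.
Proof. by rewrite exprMn exprD !mulrA. Qed.

Lemma monomial_r (R : comPzRingType) (q u v : R) n i j :
  q ^+ n * u ^+ i * (q * v) ^+ j = q ^+ (n + j) * u ^+ i * v ^+ j.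
Proof. by rewrite mulrAC monomial_l mulrAC. Qed.

Section SubstCoef.
Variables (F : fps3) (N I J : nat).

Lemma subst_uv : F@[Defs.u, Defs.v] N I J = F N I J.
Proof.
apply: subst_coef; try lia; move=> n i j; rewrite coef_mono.
by congr (nat_of_bool _)%:R; lia.
Qed.

Lemma subst_vu : F@[Defs.v, Defs.u] N I J = F N J I.
Proof.
apply: subst_coef; try lia; move=> n i j.
rewrite monomial_swap -[_ * _]/(mono n j i) coef_mono.
by congr (nat_of_bool _)%:R; lia.
Qed.

Lemma subst_quv : F@[Defs.q * Defs.u, Defs.v] N I J =
  if (I <= N)%N then F (N - I)%N I J else 0.
Proof.
have E n i j : Defs.q ^+ n * (Defs.q * Defs.u) ^+ i * Defs.v ^+ j = mono (n + i) i j.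
  exact: monomial_l.
case: leqP => IN; [apply: subst_coef; try lia|apply: subst_coef0] => n i j;
rewrite E coef_mono; [congr (nat_of_bool _)%:R|rewrite (_ : (_ && _) = false)//]; lia.
Qed.

Lemma subst_vqu : F@[Defs.v, Defs.q * Defs.u] N I J =
  if (I <= N)%N then F (N - I)%N J I else 0.
Proof.
have E n i j : Defs.q ^+ n * Defs.v ^+ i * (Defs.q * Defs.u) ^+ j = mono (n + j) j i.
  rewrite monomial_swap; exact: monomial_l.
case: leqP => IN; [apply: subst_coef; try lia|apply: subst_coef0] => n i j;
rewrite E coef_mono; [congr (nat_of_bool _)%:R|rewrite (_ : (_ && _) = false)//]; lia.
Qed.

Lemma subst_qvu : F@[Defs.q * Defs.v, Defs.u] N I J =
  if (J <= N)%N then F (N - J)%N J I else 0.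
Proof.
have E n i j : Defs.q ^+ n * (Defs.q * Defs.v) ^+ i * Defs.u ^+ j = mono (n + i) j i.
  rewrite monomial_l; exact: monomial_swap.
case: leqP => IN; [apply: subst_coef; try lia|apply: subst_coef0] => n i j;
rewrite E coef_mono; [congr (nat_of_bool _)%:R|rewrite (_ : (_ && _) = false)//]; lia.
Qed.

Lemma subst_uqv : F@[Defs.u, Defs.q * Defs.v] N I J =
  if (J <= N)%N then F (N - J)%N I J else 0.
Proof.
have E n i j : Defs.q ^+ n * Defs.u ^+ i * (Defs.q * Defs.v) ^+ j = mono (n + j) i j.
  exact: monomial_r.
case: leqP => IN; [apply: subst_coef; try lia|apply: subst_coef0] => n i j;
rewrite E coef_mono; [congr (nat_of_bool _)%:R|rewrite (_ : (_ && _) = false)//]; lia.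
Qed.
End SubstCoef.

(* (F(q,u,v) - F(q,qu,v)) / (1 - q), since 1 + q + ... + q^(I-1) = (1 - q^I) / (1 - q). *)
Definition geom (F : fps3) : fps3 := Fps (fun N => Fps (fun I => Fps (fun J =>
  \sum_(k < I | (k <= N)%N) F (N - k)%N I J))).

Lemma geom_coef (F : fps3) N I J :
  geom F N I J = \sum_(k < I | (k <= N)%N) F (N - k)%N I J.
Proof. by []. Qed.

Lemma geom_telescope (F : fps3) N I J : ((1 - Defs.q) * geom F) N I J =
  F N I J - (if (I <= N)%N then F (N - I)%N I J else 0).
Proof.
rewrite mulrBl mul1r !fps_addrE !fps_oppE coef_q geom_coef.
case: I => [|I]; first by case: N => [|N]; rewrite ?geom_coef ?big_ord0 ?subrr // subn0 subrr.
rewrite big_mkcond big_ord_recl /= subn0; case: N => [|N].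
  by rewrite big1 ?addr0.
rewrite [X in _ - X]big_mkcond big_ord_recr /=.
rewrite (eq_bigr (fun k : 'I_I => if (k <= N)%N then F (N - k)%N I.+1 J else 0)) => [|k _].
  by rewrite opprD addrA addrK subSS.
by rewrite ltnS subSS.
Qed.

Lemma fps3P (F G : fps3) : (forall N I J, F N I J = G N I J) -> F = G.
Proof. by move=> FG; apply: fpsP => N; apply: fpsP => I; apply: fpsP => J. Qed.

Lemma fps3_addE (F G : fps3) N I J : (F + G) N I J = F N I J + G N I J.
Proof. by []. Qed.

Lemma fps3_oppE (F : fps3) N I J : (- F) N I J = - F N I J.
Proof. by []. Qed.

Lemma Posz_sum (f : nat -> nat) N I :
  \sum_(k < I | (k <= N)%N) (f k)%:Z = (\sum_(k < I) (k < N.+1) * f k)%N%:Z.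
Proof.
rewrite (big_morph Posz PoszD (erefl _)) big_mkcond; apply: eq_bigr => k _.
by rewrite ltnS; case: leqP; rewrite ?mul1n.
Qed.

(** * The functional equations *)

Lemma geom_uv F : F@[Defs.u, Defs.v] - F@[Defs.q * Defs.u, Defs.v] =
  (1 - Defs.q) * geom F.
Proof.
apply: fps3P => N I J; rewrite geom_telescope fps3_addE fps3_oppE.
congr (_ - _); [exact: subst_uv|exact: subst_quv].
Qed.

Lemma geom_vu F : F@[Defs.v, Defs.u] - F@[Defs.v, Defs.q * Defs.u] =
  (1 - Defs.q) * geom F@[Defs.v, Defs.u].
Proof.
apply: fps3P => N I J; rewrite geom_telescope fps3_addE fps3_oppE.
congr (_ - _); apply: etrans (subst_vqu F N I J) _.
by case: ifP => // _; apply: esym; exact: subst_vu.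
Qed.

(** In [Z] the exponent of [u] is the width minus 1. The product [u * Z] restores the width, and
    putting [q * u] for [u] in it yields the extra factor [q]. *)
Lemma geom_u F : Defs.u * (F@[Defs.u, Defs.v] - Defs.q * F@[Defs.q * Defs.u, Defs.v]) =
  (1 - Defs.q) * geom (Defs.u * F).
Proof.
apply: fps3P => N I J; rewrite geom_telescope !coef_u; case: I => [|I].
  by rewrite subrr.
rewrite fps3_addE fps3_oppE subst_uv coef_q; case: N => [//|N].
by rewrite subst_quv ltnS subSS.
Qed.

Lemma wd_gt0 c : (0 < wd c)%N.
Proof. by elim: c => [|c IH k|c IH k|c IH k] //=; rewrite leq_max IH. Qed.

Lemma num_0wd k n j : num k n 0 j = 0%N.
Proof.
rewrite /num (eq_count (a2 := pred0)) ?count_pred0// => c /=.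
by rewrite (gtn_eqF (wd_gt0 c)) andbF.
Qed.

Lemma num_n0 k i j : num k 0 i j = 0%N.
Proof. by []. Qed.

Lemma Yvu_coef N I J : Y@[Defs.v, Defs.u] N I J = (num 1 N I J)%:Z.
Proof. by rewrite subst_vu Y_coef. Qed.

Lemma uZ_coef N I J : (Defs.u * Z) N I J = (num 2 N I J)%:Z.
Proof. by rewrite coef_u; case: I => [|I]; rewrite ?num_0wd ?Z_coef. Qed.

Lemma Zvu_coef N I J : Z@[Defs.v, Defs.u] N I J = (num 2 N J.+1 I)%:Z.
Proof. by rewrite subst_vu Z_coef. Qed.

Section EquationAlgebra.
Variables (R : comUnitRingType) (q u v : R).
Hypothesis q1 : 1 - q \is a GRing.unit.

Let div_geom a b g : b = (1 - q) * g -> a / (1 - q) * b = a * g.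
Proof. by move=> ->; rewrite mulrA divrK. Qed.

(** Cancels the quotients by [1 - q] and nests the remaining factors one by one, as [coef_q],
    [coef_u] and [coef_v] read them. *)
Lemma divided_X x y z g1 g2 g3 : x = (1 - q) * g1 -> y = (1 - q) * g2 ->
  u * z = (1 - q) * g3 ->
  q * v / (1 - q) * x + q * v / (1 - q) * y + q * u * v / (1 - q) * z =
  q * (v * (g1 + g2 + g3)).
Proof.
move=> e1 e2 e3; rewrite (div_geom _ e1) (div_geom _ e2).
have -> : q * u * v / (1 - q) * z = q * v / (1 - q) * (u * z).
  by rewrite -!mulrA; congr (q * _); rewrite mulrCA; congr (v * _); rewrite mulrCA.
by rewrite (div_geom _ e3) -!mulrDr mulrA.
Qed.

Lemma divided_Y y z w g1 g2 : y = (1 - q) * g1 -> z = (1 - q) * g2 ->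
  q * u * v + q * v / (1 - q) * y + q * v ^+ 2 / (1 - q) * z + q * u * v * w =
  q * (u * v) + q * (v * g1) + q * (v * (v * g2)) + q * (u * (v * w)).
Proof.
by move=> e1 e2; rewrite (div_geom _ e1) (div_geom _ e2) expr2 -!mulrA.
Qed.

Lemma divided_Z z y w g : z = (1 - q) * g ->
  q * v / (1 - q) * z + q * v * y + q * u * v * w =
  q * (v * g) + q * (v * y) + q * (u * (v * w)).
Proof. by move=> e; rewrite (div_geom _ e) -!mulrA. Qed.
End EquationAlgebra.

Lemma equation_X : X@[Defs.u, Defs.v] =
  Defs.q * Defs.v / (1 - Defs.q) *
    (X@[Defs.u, Defs.v] - X@[Defs.q * Defs.u, Defs.v])
  + Defs.q * Defs.v / (1 - Defs.q) *
    (Y@[Defs.v, Defs.u] - Y@[Defs.v, Defs.q * Defs.u])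
  + Defs.q * Defs.u * Defs.v / (1 - Defs.q) *
    (Z@[Defs.u, Defs.v] - Defs.q * Z@[Defs.q * Defs.u, Defs.v]).
Proof.
apply: etrans _ (esym (divided_X Defs.v unit_1subq (geom_uv X) (geom_vu Y) (geom_u Z))).
apply: fps3P => N I J; apply: etrans (subst_uv X N I J) _.
rewrite X_coef coef_q; case: N => [|N]; first by rewrite num_n0.
rewrite coef_v; case: J => [|J]; first by rewrite num_rec00.
rewrite num_rec0 -(Posz_sum (fun k => num012 (N.+1 - k.+1) I J)) !fps3_addE !geom_coef -!big_split; apply: eq_bigr => k _.
by rewrite X_coef Yvu_coef uZ_coef subSS /num012 /num12 !PoszD addrA.
Qed.

Lemma coef_v1 N I J : Defs.v N I J = [&& N == 0%N, I == 0%N & J == 1%N]%:R.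
Proof.
rewrite -[Defs.v]mulr1 coef_v; case: J => [|J]; first by rewrite !andbF.
by rewrite eqSS -(coef_mono 0 0 0 N I J) /mono !expr0 !mulr1.
Qed.

(** A top row one cell longer than the width [J] has [J] cells accounted for by [q * v] in place of
    the width variable, and one by the prefactor [q * u * v]. The factor [q * v] before [Z] makes up
    for its width exponent. *)
Lemma coef_top_extension N I J :
  (X@[Defs.q * Defs.v, Defs.u] + Y@[Defs.u, Defs.q * Defs.v]
     + Defs.q * Defs.v * Z@[Defs.q * Defs.v, Defs.u]) N I J =
  ((J <= N) * num012 (N - J) J I)%N%:Z.
Proof.
rewrite !fps3_addE -mulrA coef_q.
transitivity ((if (J <= N)%N then X (N - J)%N J I else 0) +
  (if (J <= N)%N then Y (N - J)%N I J else 0) +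
  (if (J <= N)%N then (num 2 (N - J) J I)%:Z else 0)).
  congr (_ + _ + _); [exact: subst_qvu|exact: subst_uqv|].
  case: N => [|N]; first by case: J => [|J].
  rewrite coef_v; case: J => [|J]; first by rewrite num_0wd.
  by apply: etrans (subst_qvu Z N I J) _; rewrite Z_coef.
rewrite X_coef Y_coef /num012 /num12.
by case: leqP => _; rewrite ?addr0// mul1n !PoszD addrA.
Qed.

Lemma coef_geom_YZ N I J :
  geom Y N I J + (Defs.v * geom Z@[Defs.v, Defs.u]) N I J =
  (\sum_(k < I) (k < N.+1) * num12 (N.+1 - k.+1) J I)%N%:Z.
Proof.
rewrite coef_v -(Posz_sum (fun k => num12 (N.+1 - k.+1) J I)); case: J => [|J].
  (* The factor [v] leaves no [Z] term at [J = 0], in agreement with the absence of codes of width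
     0. *)
  rewrite addr0 geom_coef; apply: eq_bigr => k _.
  by rewrite Y_coef /num12 !num_0wd.
rewrite !geom_coef -big_split; apply: eq_bigr => k _.
by rewrite Y_coef Zvu_coef subSS.
Qed.

Lemma equation_Y : Y@[Defs.u, Defs.v] =
  Defs.q * Defs.u * Defs.v
  + Defs.q * Defs.v / (1 - Defs.q) *
    (Y@[Defs.u, Defs.v] - Y@[Defs.q * Defs.u, Defs.v])
  + Defs.q * Defs.v ^+ 2 / (1 - Defs.q) *
    (Z@[Defs.v, Defs.u] - Z@[Defs.v, Defs.q * Defs.u])
  + Defs.q * Defs.u * Defs.v *
    (X@[Defs.q * Defs.v, Defs.u] + Y@[Defs.u, Defs.q * Defs.v]
     + Defs.q * Defs.v * Z@[Defs.q * Defs.v, Defs.u]).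
Proof.
apply: etrans _ (esym (divided_Y Defs.u Defs.v unit_1subq _ (geom_uv Y) (geom_vu Z))).
set W := _ + _ * Z@[_, _].
apply: fps3P => N I J; apply: etrans (subst_uv Y N I J) _.
rewrite Y_coef !fps3_addE !coef_q; case: N => [|N]; first by rewrite num_n0.
rewrite num_rec1 !coef_u !coef_v; case: J => [|J].
  by case: I => [|I]; rewrite ?coef_v1 ?coef_v ?andbF.
rewrite -[X in _ = X + _]addrA coef_geom_YZ PoszD; case: I => [|I].
  by rewrite big_ord0 andbF addr0.
rewrite coef_v1 coef_v coef_top_extension !eqSS !PoszD [in RHS]addrAC.
congr (_ + _ + _); first by case: (N == 0%N); case: (J == 0%N); case: (I == 0%N).
Show.
Qed.

Lemma equation_Z : Z@[Defs.u, Defs.v] =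
  Defs.q * Defs.v / (1 - Defs.q) *
    (Z@[Defs.u, Defs.v] - Z@[Defs.q * Defs.u, Defs.v])
  + Defs.q * Defs.v * Y@[Defs.q * Defs.v, Defs.u]
  + Defs.q * Defs.u * Defs.v * Z@[Defs.u, Defs.q * Defs.v].
Proof.
apply: etrans _ (esym (divided_Z Defs.u Defs.v unit_1subq _ _ (geom_uv Z))).
apply: fps3P => N I J; apply: etrans (subst_uv Z N I J) _.
rewrite Z_coef !fps3_addE !coef_q; case: N => [|N]; first by rewrite num_n0.
rewrite num_rec2 !coef_u !coef_v; case: J => [|J].
  by case: I => [|I]; rewrite ?coef_v.
transitivity (geom Z N I J + (if (J <= N)%N then Y (N - J)%N J I else 0) +
    (if (J <= N)%N then (num 2 (N - J) I J)%:Z else 0)); last first.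
  congr (_ + _ + _); first by apply: esym; exact: subst_qvu.
  case: I => [|I]; first by rewrite num_0wd if_same.
  by rewrite coef_v; apply: esym; apply: etrans (subst_uqv Z N I J) _; rewrite Z_coef.
rewrite Y_coef geom_coef PoszD.
rewrite -(Posz_sum (fun k => num 2 (N.+1 - k.+1) I.+1 J)) -addrA; congr (_ + _).
  by apply: eq_bigr => k _; rewrite Z_coef subSS.
by rewrite ltnS subSS /num12; case: leqP; rewrite ?mul1n ?addr0// PoszD.
Qed.

(** * Counting all polygons of given area *)

Definition polygons n : seq walk := [seq map (sym g) (full c) | g <- syms, c <- codes n].

Lemma uniq_polygons n : uniq (polygons n).
Proof.
apply: allpairs_uniq; [by []|exact: uniq_codes|] => -[g c] [g' c'].
move=> /allpairsP[[g1 c1] [_ c1n [-> ->]]] /allpairsP[[g2 c2] [_ c2n [-> ->]]] /= e.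
move: c1n c2n; rewrite !mem_codes => /andP[v1 _] /andP[v2 _].
exact: sym_full_inj.
Qed.

Lemma polygons_of_areaE n : polygons_of_area n = [set` polygons n].
Proof.
apply/seteqP; split=> w /=; rewrite /polygons_of_area /=.
  case=> /polygon_sym_full[g [c [vc ->]]]; rewrite area_sym// => an.
  by apply/allpairsP; exists (g, c); rewrite mem_syms mem_codes vc an eqxx.
case/allpairsP => -[g c] [_ + ->]; rewrite mem_codes => /andP[vc /eqP an].
by split; [apply: prudent_polygon_sym; exact: prudent_polygon_full|rewrite area_sym].
Qed.

Lemma finite_polygons n : finite_set (polygons_of_area n).
Proof. by rewrite polygons_of_areaE; exact: finite_seq. Qed.

Lemma PA4_coef n : PA4 n = (8 * size (codes n))%N%:Z.
Proof.
by rewrite /PA4 /= polygons_of_areaE card_seq ?uniq_polygons// size_allpairs.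
Qed.

(** The sum is supported on the finitely many pairs of values taken on [s], and each code counts for
    exactly one of them. *)
Lemma sum_count_pairs (s : seq code) (Q : pred code) (a b : code -> nat) :
  \sum_(ij \in [set: nat * nat])
    (count (fun c => [&& Q c, a c == ij.1 & b c == ij.2]) s)%:Z = (count Q s)%:Z.
Proof.
pose r := undup [seq (a c, b c) | c <- s].
rewrite (_ : setT = [set` predT]); last by apply/seteqP.
rewrite -(bigfs _ (r := r)); [|exact: undup_uniq|]; last first.
  move=> [i j] _ /=; rewrite mem_undup => ij; congr Posz; apply/eqP.
  rewrite -leqn0 leqNgt -has_count; apply: contra ij => /hasP[c cs /=].
  by case/and3P => _ /eqP <- /eqP <-; apply: (map_f (fun c => (a c, b c))).
rewrite -(big_morph Posz PoszD (erefl _)); congr Posz.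
under eq_bigr do rewrite -sum_count.
rewrite exchange_big -sum_count /=; apply: eq_big_seq => c cs.
rewrite (bigD1_seq (a c, b c)) ?undup_uniq//=; last first.
  by rewrite mem_undup; apply: (map_f (fun c => (a c, b c))).
rewrite !eqxx !andbT big1 ?addn0// => -[i j] /=; rewrite xpair_eqE negb_and.
by case/orP => /negbTE; rewrite eq_sym => ->; rewrite ?andbF.
Qed.

Lemma at11_X n : at11 X n = (count (fun c => kind c == 0%N) (codes n))%:Z.
Proof.
rewrite /at11 /= -(sum_count_pairs _ _ wd ht); apply: eq_fsbigr => -[i j] _.
exact: X_coef.
Qed.

Lemma at11_Y n : at11 Y n = (count (fun c => kind c == 1%N) (codes n))%:Z.
Proof.
rewrite /at11 /= -(sum_count_pairs _ _ ht wd); apply: eq_fsbigr => -[i j] _.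
apply: etrans (Y_coef _ _ _) _; congr Posz; apply: eq_count => c /=.
by congr (_ && _); rewrite andbC.
Qed.

Lemma at11_Z n : at11 Z n = (count (fun c => kind c == 2%N) (codes n))%:Z.
Proof.
rewrite /at11 /= -(sum_count_pairs _ _ (fun c => (wd c).-1) ht).
apply: eq_fsbigr => -[i j] _; apply: etrans (Z_coef _ _ _) _; congr Posz.
by apply: eq_count => c /=; rewrite -(prednK (wd_gt0 c)) eqSS.
Qed.

Lemma PA4E : PA4 = 8 * (at11 X + at11 Y + at11 Z).
Proof.
apply: fpsP => n; rewrite PA4_coef mulr_natl.
have mulrnE (f : fps int) k : (f *+ k) n = f n *+ k.
  by elim: k => [|k IH]; rewrite ?mulr0n ?fps_0E// !mulrS fps_addrE IH.
rewrite mulrnE !fps_addrE at11_X at11_Y at11_Z -!PoszD -mulr_natr natz -PoszM mulnC.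
congr (Posz (_ * _)); rewrite -sum1_size -!sum_count -!big_split /=.
apply: eq_bigr => c _.
by have := kind_le2 c; case: (kind c) => [|[|[|k]]].
Qed.

Lemma PA4_first : [seq PA4 n | n <- iota 0 11] =
  [:: 0; 8; 16; 40; 96; 232; 560; 1336; 3176; 7480; 17528].
Proof.
(* The codes themselves are enumerated; the functional equations are not solved. *)
have sizes : [seq size (codes n) | n <- iota 0 11] =
    [:: 0; 1; 2; 5; 12; 29; 70; 167; 397; 935; 2191]%N.
  by vm_compute.
under eq_map do rewrite PA4_coef.
rewrite (map_comp (fun k => (8 * k)%N%:Z) (fun n => size (codes n))) sizes.
by vm_compute.
Qed.

Theorem proposition2 :
  [/\ X@[u, v] =
        q * v / (1 - q) * (X@[u, v] - X@[q * u, v])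
        + q * v / (1 - q) * (Y@[v, u] - Y@[v, q * u])
        + q * u * v / (1 - q) * (Z@[u, v] - q * Z@[q * u, v]),
      Y@[u, v] =
        q * u * v
        + q * v / (1 - q) * (Y@[u, v] - Y@[q * u, v])
        + q * v ^+ 2 / (1 - q) * (Z@[v, u] - Z@[v, q * u])
        + q * u * v * (X@[q * v, u] + Y@[u, q * v] + q * v * Z@[q * v, u]),
      Z@[u, v] =
        q * v / (1 - q) * (Z@[u, v] - Z@[q * u, v])
        + q * v * Y@[q * v, u]
        + q * u * v * Z@[u, q * v] &
      [/\ forall n, finite_set (polygons_of_area n),
          PA4 = 8 * (at11 X + at11 Y + at11 Z) &
          [seq PA4 n | n <- iota 0 11] =
            [:: 0; 8; 16; 40; 96; 232; 560; 1336; 3176; 7480; 17528]]].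
Proof.
split; [exact: equation_X|exact: equation_Y|exact: equation_Z|].
by split; [exact: finite_polygons|exact: PA4E|exact: PA4_first].
Qed.
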